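(* Let $(x_i)_i$ be a spreading Schauder basic sequence. (i) If $(x_i)_i$ is unconditional, then there exists a reflexive Banach space $X$ with an unconditional Schauder basis $(e_i)_i$ that generates a spreading model equivalent to $(x_i)_i$. (ii) If $(x_i)_i$ is conditional, then there exists a Banach space $X$ that is quasi-reflexive of order one with a Schauder basis $(e_i)_i$ that generates a spreading model equivalent to $(x_i)_i$.
   Context: Banach spaces are real. Two sequences are equivalent if the norms of their finite linear combinations with the same coefficients are comparable up to uniform positive constants. A sequence is spreading if it is equivalent to all of its subsequences. Conditional means not unconditional. A Banach space $X$ is quasi-reflexive of order one if the canonical image of $X$ in $X^{**}$ has codimension one. A bounded sequence $(y_i)_i$ in a Banach space generates a sequence $(v_i)_i$ in a semi-normed space as a spreading model if for any $n\in\mathbb{N}$, $\varepsilon>0$ (and coefficients in a bounded set, say $a_1,\dots,a_n\in[-1,1]$) there is $n_0\in\mathbb{N}$ such that for any $n_0\leqslant k_1<\cdots<k_n$ and all such $a_1,\ldots,a_n$, $$\Big|\Big\|\sum_{i=1}^na_iy_{k_i}\Big\|-\Big\|\sum_{i=1}^na_iv_i\Big\|\Big|<\varepsilon.$$ *)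

(* Defs.v *)
(* Real Banach spaces are [completeNormedModType R] for [R : realType]. *)
From HB Require Import structures.
From mathcomp Require Import all_boot all_order all_algebra.
From mathcomp Require Import all_classical all_reals all_analysis.

Set Implicit Arguments.
Unset Strict Implicit.
Unset Printing Implicit Defensive.

Import Order.TTheory GRing.Theory Num.Theory.
Import numFieldNormedType.Exports.

Local Open Scope classical_set_scope.
Local Open Scope ring_scope.

(* The topological dual as a normed module: continuous linear functionals with
   the operator norm. Being a [normedModType] again, it can be iterated to
   obtain the bidual. *)
Section Dual.
Context {R : realType} (V : normedModType R).

Definition functional : {pred V -> R^o} :=
  mem [set f : V -> R^o | linear f /\ continuous f].

Record dual := Dual {
  dual_fun :> V -> R^o ;
  dual_funP : dual_fun \in functional }.

HB.instance Definition _ := [isSub for dual_fun].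
HB.instance Definition _ := [Choice of dual by <:].

Fact functional_submod_closed : submod_closed functional.
Proof.
split; first by rewrite inE; split=> [c x y|x] /=;
  [rewrite scaler0 addr0|exact: cvg_cst].
move=> c f g; rewrite !inE => -[lf cf] [lg cg]; split=> [k x y|x].
  rewrite !fctE lf lg !scalerDr !scalerA (mulrC c) -!addrA; congr (_ + _).
  by rewrite addrCA.
by apply: cvgD; [apply: cvgZr; exact: cf|exact: cg].
Qed.

HB.instance Definition _ := GRing.isSubmodClosed.Build R (V -> R^o) functional
  functional_submod_closed.
HB.instance Definition _ := [SubChoice_isSubLmodule of dual by <:].

Fact dual_linear (f : dual) : linear f.
Proof. by case: f => f /= /[!inE] -[]. Qed.

HB.instance Definition _ (f : dual) :=
  GRing.isLinear.Build R V R^o *:%R f (@dual_linear f).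

Fact dual_continuous (f : dual) : continuous f.
Proof. by case: f => f /= /[!inE] -[]. Qed.

Definition opnorm (f : dual) : R :=
  sup [set `|f x| | x in [set x : V | `|x| <= 1]].

Fact opnorm_has_sup (f : dual) :
  has_sup [set `|f x| | x in [set x : V | `|x| <= 1]].
Proof.
split; first by exists `|f 0|, 0 => //=; rewrite normr0.
have /linear_boundedP/pinfty_ex_gt0[M M0 fM] :=
  continuous_linear_bounded 0 (@dual_continuous f 0).
exists M => _ [x /= x1 <-]; apply: le_trans (fM x) _.
by rewrite ler_piMr// ltW.
Qed.

Fact opnorm_ub (f : dual) (x : V) : `|x| <= 1 -> `|f x| <= opnorm f.
Proof. by move=> x1; apply: sup_upper_bound (opnorm_has_sup f) _ _; exists x. Qed.

Fact opnorm_le (f : dual) (M : R) :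
  (forall x : V, `|x| <= 1 -> `|f x| <= M) -> opnorm f <= M.
Proof.
by move=> fM; apply: ge_sup => [|_ [x x1 <-]]; [case: (opnorm_has_sup f)|exact: fM].
Qed.

Fact opnorm_ge0 (f : dual) : 0 <= opnorm f.
Proof. by apply: le_trans (opnorm_ub f (x := 0) _); rewrite ?normr0. Qed.

Fact opnormP (f : dual) (x : V) : `|f x| <= opnorm f * `|x|.
Proof.
have [->|x0] := eqVneq x 0; first by rewrite linear0 !normr0 mulr0.
have nx0 : 0 < `|x| by rewrite normr_gt0.
rewrite -ler_pdivrMr//.
have -> : `|f x| / `|x| = `|f (`|x|^-1 *: x)|.
  by rewrite linearZ normrZ normfV normr_id mulrC.
by apply: opnorm_ub; rewrite normrZ normfV normr_id mulVf ?gt_eqF.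
Qed.

Fact opnormD (f g : dual) : opnorm (f + g) <= opnorm f + opnorm g.
Proof.
apply: opnorm_le => x x1.
by apply: le_trans (ler_normD _ _) _; rewrite lerD// opnorm_ub.
Qed.

Fact opnormZ (c : R) (f : dual) : opnorm (c *: f) = `|c| * opnorm f.
Proof.
have le_opnormZ k (g : dual) : opnorm (k *: g) <= `|k| * opnorm g.
  by apply: opnorm_le => x x1; rewrite normrZ ler_wpM2l// opnorm_ub.
apply/eqP; rewrite eq_le le_opnormZ/=.
have [->|c0] := eqVneq c 0; first by rewrite normr0 mul0r opnorm_ge0.
rewrite -ler_pdivlMl ?normr_gt0// -normfV.
by have := le_opnormZ c^-1 (c *: f); rewrite scalerA mulVf// scale1r.
Qed.

Fact opnorm_eq0 (f : dual) : opnorm f = 0 -> f = 0.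
Proof.
move=> f0; apply/val_inj/funext => x /=.
by have := opnormP f x; rewrite f0 mul0r normr_le0 => /eqP.
Qed.

HB.instance Definition _ :=
  Lmodule_isNormed.Build R dual opnormD opnormZ opnorm_eq0.

End Dual.

Arguments functional {R} V.

Section Bidual.
Context {R : realType} (X : normedModType R).

Definition evaluation (x : X) : dual X -> R^o := fun f => f x.

Fact evaluation_linear (x : X) : linear (evaluation x).
Proof. by []. Qed.

HB.instance Definition _ (x : X) := GRing.isLinear.Build R (dual X) R^o *:%R
  (evaluation x) (@evaluation_linear x).

Fact evaluationP (x : X) : evaluation x \in functional (dual X).
Proof.
rewrite inE; split; first exact: evaluation_linear.
apply: bounded_linear_continuous; apply/linear_boundedP.
near=> r => f; apply: le_trans (opnormP f x) _; rewrite mulrC ler_wpM2r//.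
exact: opnorm_ge0.
Unshelve. all: by end_near. Qed.

Definition canonical_embedding (x : X) : dual (dual X) := Dual (evaluationP x).

Definition reflexive_space := range canonical_embedding = setT.

(* [A] is meant to be a linear subspace: the quotient [W / A] is then spanned
   by the nonzero class of [w]. *)
Definition codimension_one (W : lmodType R) (A : set W) :=
  exists w : W, ~ A w /\
    forall v : W, exists (u : W) (c : R), A u /\ v = u + c *: w.

Definition quasi_reflexive_order_one :=
  codimension_one (range canonical_embedding).

End Bidual.

Section Bases.
Context {R : realType} {X : normedModType R}.
Implicit Types (e : nat -> X) (A : set X).

Definition expansion (a : nat -> R) e : nat -> X := fun n => a n *: e n.

Definition closed_span e : set X :=
  closure [set x | exists (n : nat) (a : nat -> R),
                     x = \sum_(i < n) expansion a e i].

Definition schauder_basis_of A e :=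
  (forall n, A (e n)) /\
  (forall x, A x ->
     exists! a : nat -> R, series (expansion a e) @ \oo --> x).

Definition schauder_basis e := schauder_basis_of setT e.

Definition schauder_basic e := schauder_basis_of (closed_span e) e.

Definition unconditionally_cvg (u : nat -> X) :=
  forall s : nat -> nat, bijective s -> cvgn (series (u \o s)).

(* For a Schauder basic sequence, the convergent series below are exactly the
   expansions of the elements of its closed linear span. *)
Definition unconditional e :=
  forall a : nat -> R, cvgn (series (expansion a e)) ->
    unconditionally_cvg (expansion a e).

Definition conditional e := ~ unconditional e.

End Bases.

Section SpreadingModels.
Context {R : realType}.

(* Nonnegativity and [p 0 = 0] follow from these two properties. *)
Definition seminorm (V : lmodType R) (p : V -> R) :=
  (forall x y, p (x + y) <= p x + p y) /\
  (forall (c : R) x, p (c *: x) = `|c| * p x).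

(* The (semi-)norms are explicit because spreading models live in semi-normed
   spaces. *)
Definition equivalent (V W : lmodType R) (p : V -> R) (v : nat -> V)
    (q : W -> R) (w : nat -> W) :=
  exists c C : R, [/\ 0 < c, 0 < C &
    forall (n : nat) (a : nat -> R),
      c * p (\sum_(i < n) a i *: v i) <= q (\sum_(i < n) a i *: w i) /\
      q (\sum_(i < n) a i *: w i) <= C * p (\sum_(i < n) a i *: v i)].

Definition spreading (X : normedModType R) (x : nat -> X) :=
  forall s : nat -> nat, {homo s : i j / (i < j)%N} ->
    equivalent Num.norm x Num.norm (x \o s).

Definition generates_spreading_model (X : normedModType R) (y : nat -> X)
    (V : lmodType R) (p : V -> R) (v : nat -> V) :=
  [/\ bounded_fun y, seminorm p &
  forall (n : nat) (eps : R), 0 < eps ->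
    exists n0 : nat, forall (k : 'I_n -> nat) (a : 'I_n -> R),
      (forall i, (n0 <= k i)%N) -> {homo k : i j / (i < j)%N} ->
      (forall i, -1 <= a i <= 1) ->
      `| `|\sum_(i < n) a i *: y (k i)| - p (\sum_(i < n) a i *: v i) | < eps].

Definition generates_spreading_model_equivalent_to
    (X : normedModType R) (y : nat -> X) (E : normedModType R) (x : nat -> E) :=
  exists (V : lmodType R) (p : V -> R) (v : nat -> V),
    generates_spreading_model y p v /\ equivalent p v Num.norm x.

End SpreadingModels.

(* Main.v *)
Require Import Defs.
From HB Require Import structures.
From mathcomp Require Import all_boot all_order all_algebra.
From mathcomp Require Import all_classical all_reals all_analysis.
From mathcomp Require Import ring lra zify.

(** A spreading sequence [x] is replaced by a 1-spreading norm [p] on finitely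
    supported vectors, obtained from iterated upper limits of the norms of
    combinations of [x] ([spread_renorming]; the equivalence with [x] rests on
    a Baire category argument, [uniform_spreading]). Averaging translates of a
    vector inside a gap of another one then gives everything that is needed
    about [p]: a vector of sum zero can be dropped from a gap without increasing
    [p] ([drop_sum0]); if the means of the basis vectors tend to zero, so can
    any vector, and [x] is unconditional ([drop_avg0]); if they do not, the sum
    of the coefficients is a bounded functional ([norm_horner1_le]). In the
    latter case a gliding hump shows that [x] is either conditional, with
    uniformly bounded initial segments, or equivalent to the basis of l_1
    ([initial_segments_bounded], [unconditional_l1]).

    From [p] a Banach space is built in two steps. For a finite set [F] one takes
    the quotient of [p] by the vectors that vanish on [F] (and have sum zero on
    each gap of [F], in the conditional case). Being able to drop such vectors
    means that the quotient norm is [p] on vectors supported by [F]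
    ([quot_norm_supp]). The Schreier norm is the supremum over the sets [F] with
    at most [min F + 1] elements. It has the right spreading model, and far
    blocks are weakly null for it, but bounded sums of blocks need not converge.
    To repair this, the final norm takes l_2 sums, over partitions into windows,
    of means of the Schreier norms of pieces of the windows, where a window
    starting at [l] contains [l + 1] pieces.
    - A vector with [n] nonzero coordinates beyond [n0] is seen by one window
      only, up to an error of order [n / n0]; so the spreading model does not
      change ([ebasis_spreading_model]).
    - If the partial sums of a series of blocks are bounded, the Schreier norms
      of the blocks tend to zero, since windows with many blocks could otherwise
      be accumulated; and then the lower l_2 estimate applies to the blocks up
      to a small error. So the basis is boundedly complete
      ([partition_norm_tail]), and the sequences of finite norm form the space.
    - Means of means of far blocks have small Schreier norm, because a Schreier
      set meeting one of them is too small to see the next ones; on blocks of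
      small Schreier norm the final norm is almost an l_2 norm. So no bounded
      functional stays away from zero on far blocks, provided that these have
      sum zero in the conditional case ([no_far_blocks]).

    By the last point the coordinates span the dual, together with the sum
    functional in the conditional case. By the second one an element of the
    bidual has the coordinates of an element of the space ([bidual_coords]).
    Hence the space is reflexive, or of codimension one in its bidual, the
    additional direction being the limit along the basis
    ([reflexive_nonsumming], [quasi_reflexive_summing]). *)

Set Implicit Arguments.
Unset Strict Implicit.
Unset Printing Implicit Defensive.

Import Order.TTheory GRing.Theory Num.Theory.
Import numFieldNormedType.Exports.

Local Open Scope classical_set_scope.
Local Open Scope ring_scope.

(** * Finitely supported vectors *)

Section FiniteVectors.
Context {R : realType}.
Implicit Types (a b z : {poly R}) (l r n : nat).

(** Finitely supported coefficient sequences are encoded as polynomials: the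
    power 'X^i stands for the [i]-th vector, a shift is a multiplication by a
    power of 'X, and the sum of the coefficients is the value at 1. *)
Definition lcomb (V : lmodType R) (v : nat -> V) (a : {poly R}) : V :=
  \sum_(i < size a) a`_i *: v i.

Lemma lcomb_wide (V : lmodType R) (v : nat -> V) n a :
  (size a <= n)%N -> lcomb v a = \sum_(i < n) a`_i *: v i.
Proof.
move=> an; rewrite /lcomb (big_ord_widen n (fun i => a`_i *: v i) an).
rewrite big_mkcond /=; apply: eq_bigr => i _; case: ltnP => // ai.
by rewrite nth_default // scale0r.
Qed.

Fact lcomb_linear (V : lmodType R) (v : nat -> V) : linear (lcomb v).
Proof.
move=> c a b.
pose n := maxn (size (c *: a + b)%R) (maxn (size a) (size b)).
have h0 : (size (c *: a + b)%R <= n)%N by rewrite leq_maxl.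
have h1 : (size a <= n)%N by rewrite !leq_max leqnn orbT.
have h2 : (size b <= n)%N by rewrite !leq_max leqnn !orbT.
rewrite (lcomb_wide _ h0) (lcomb_wide _ h1) (lcomb_wide _ h2).
rewrite scaler_sumr -big_split; apply: eq_bigr => i _ /=.
by rewrite coefD coefZ scalerDl scalerA.
Qed.

HB.instance Definition _ (V : lmodType R) (v : nat -> V) :=
  GRing.isLinear.Build R {poly R} V *:%R (lcomb v) (lcomb_linear v).

Lemma lcombXn (V : lmodType R) (v : nat -> V) n : lcomb v 'X^n = v n.
Proof.
rewrite /lcomb size_polyXn (bigD1 ord_max) //= coefXn eqxx scale1r big1 ?addr0//.
by move=> i /negbTE; rewrite coefXn -val_eqE /= => ->; rewrite scale0r.
Qed.

Lemma poly_sumXn n a : (size a <= n)%N -> a = \sum_(i < n) a`_i *: 'X^i.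
Proof.
move=> an; rewrite -poly_def; apply/polyP => i; rewrite coef_poly.
by case: ltnP => // ni; rewrite nth_default // (leq_trans an).
Qed.

Lemma lcombX a : lcomb (fun i => 'X^i) a = a.
Proof. by rewrite /lcomb -poly_sumXn. Qed.

Lemma lcomb_comp (V : lmodType R) (v : nat -> V) (k : nat -> nat) a :
  lcomb v (lcomb (fun i => 'X^(k i)) a) = lcomb (v \o k) a.
Proof.
by rewrite {2}/lcomb linear_sum; apply: eq_bigr => i _; rewrite linearZ /= lcombXn.
Qed.

Lemma lcomb_shift n a : lcomb (fun i => 'X^(n + i)) a = 'X^n * a.
Proof.
rewrite {2}(poly_sumXn (leqnn (size a))) mulr_sumr; apply: eq_bigr => i _.
by rewrite exprD scalerAr.
Qed.

Definition seg l r (a : nat -> R) : {poly R} :=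
  \poly_(i < r) (if (l <= i)%N then a i else 0).

Lemma coef_seg l r (a : nat -> R) i :
  (seg l r a)`_i = if (l <= i < r)%N then a i else 0.
Proof. by rewrite coef_poly; case: (leqP l i); case: (ltnP i r). Qed.

Lemma size_seg l r (a : nat -> R) : (size (seg l r a) <= r)%N.
Proof. exact: size_poly. Qed.

Lemma segE l r (a : nat -> R) : seg l r a = \sum_(l <= i < r) a i *: 'X^i.
Proof.
apply/polyP => i; rewrite coef_seg coef_sum.
under eq_bigr do rewrite coefZ coefXn.
case: ifP => ilr.
  rewrite (bigD1_seq i) ?mem_index_iota ?iota_uniq //= eqxx mulr1 big1 ?addr0//.
  by move=> j /negbTE; rewrite eq_sym => ->; rewrite mulr0.
rewrite big_seq big1 // => j; rewrite mem_index_iota => jlr.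
by case: eqP => [ij|]; rewrite ?mulr0 //; move: jlr; rewrite -ij ilr.
Qed.

Lemma horner1E a : a.[1] = \sum_(i < size a) a`_i.
Proof. by rewrite horner_coef; apply: eq_bigr => i _; rewrite expr1n mulr1. Qed.

Lemma horner1_wide n a : (size a <= n)%N -> a.[1] = \sum_(i < n) a`_i.
Proof.
by move=> an; rewrite (horner_coef_wide _ an); apply: eq_bigr => i _; rewrite expr1n mulr1.
Qed.

End FiniteVectors.

Section Seminorms.
Context {R : realType} {V : lmodType R} (p : V -> R).
Hypothesis ps : seminorm p.

Lemma seminormD x y : p (x + y) <= p x + p y. Proof. by case: ps. Qed.
Lemma seminormZ c x : p (c *: x) = `|c| * p x. Proof. by case: ps. Qed.
Lemma seminorm0 : p 0 = 0.
Proof. by rewrite -(scale0r 0) seminormZ normr0 mul0r. Qed.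
Lemma seminormN x : p (- x) = p x.
Proof. by rewrite -scaleN1r seminormZ normrN1 mul1r. Qed.
Lemma seminorm_ge0 x : 0 <= p x.
Proof. by have := seminormD x (- x); rewrite subrr seminorm0 seminormN; lra. Qed.
Lemma seminormB x y : p (x - y) <= p x + p y.
Proof. by rewrite -(seminormN y) seminormD. Qed.
Lemma seminorm_sum (I : Type) (s : seq I) (P : pred I) (F : I -> V) :
  p (\sum_(i <- s | P i) F i) <= \sum_(i <- s | P i) p (F i).
Proof.
elim/big_rec2: _ => [|i y x _ yx]; first by rewrite seminorm0.
by apply: le_trans (seminormD _ _) _; rewrite lerD2l.
Qed.
End Seminorms.

Lemma le_of_inv_nat {R : realType} (x y c : R) :
  (forall M : nat, (0 < M)%N -> x <= y + c / M%:R) -> x <= y.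
Proof.
move=> h; apply/ler_addgt0Pr => e e0.
have [c0|c0] := leP c 0.
  have := h 1%N isT; rewrite divr1; lra.
have [M hM] : exists M : nat, c / e < M%:R.
  by exists (Num.bound (c / e)); rewrite archi_boundP // divr_ge0 // ltW.
have M0 : (0 < M)%N by rewrite -(ltr_nat R); apply: le_lt_trans hM; rewrite divr_ge0 // ltW.
apply: le_trans (h M M0) _; rewrite lerD2l ler_pdivrMr ?ltr0n //.
by rewrite ltr_pdivrMr // in hM; rewrite mulrC ltW.
Qed.

Section Averaging.
Context {R : realType} (p : {poly R} -> R).
Implicit Types (a z : {poly R}).

(** What is usually called a 1-spreading seminorm. *)
Definition spread_invariant := forall (k : nat -> nat) a,
  {homo k : i j / (i < j)%N} -> p (lcomb (fun i => 'X^(k i)) a) = p a.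

Hypotheses (ps : seminorm p) (pI : spread_invariant).

Lemma spread_shift n a : p ('X^n * a) = p a.
Proof. by rewrite -lcomb_shift pI // => i j; rewrite ltn_add2l. Qed.

Lemma spread_Xn n : p 'X^n = p 1.
Proof. by rewrite -[RHS](spread_shift n) mulr1. Qed.

Definition ones_avg (M : nat) : {poly R} := M%:R^-1 *: \sum_(t < M) 'X^t.

(** Only the order of the supports matters, so [z] may be moved freely inside
    a gap of [a] that has been widened by [M]. *)
Lemma spread_gap l r a z M t :
  (forall i, (l <= i < r)%N -> a`_i = 0) ->
  (forall i, ~~ (l <= i < r)%N -> z`_i = 0) -> (t <= M)%N ->
  p (lcomb (fun i => 'X^(if (i < l)%N then i else i + M)%N) a + 'X^t * z) = p (a + z).
Proof.
move=> a0 z0 tM.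
pose k i := (if i < l then i else if i < r then t + i else i + M)%N.
have kH : {homo k : i j / (i < j)%N}.
  by move=> i j ij; rewrite /k; do ?[case: ifP => ?]; lia.
rewrite -(pI (a + z) kH); congr p.
pose n := maxn (size (a + z)%R) (maxn (size a) (size z)).
have h0 : (size (a + z)%R <= n)%N by rewrite leq_maxl.
have h1 : (size a <= n)%N by rewrite !leq_max leqnn orbT.
have h2 : (size z <= n)%N by rewrite !leq_max leqnn !orbT.
rewrite -lcomb_shift (lcomb_wide _ h0) (lcomb_wide _ h1) (lcomb_wide _ h2) -big_split.
apply: eq_bigr => i _ /=; rewrite /k coefD scalerDl.
case: ltnP => il; first by rewrite (z0 i) ?scale0r//; lia.
case: ltnP => ir; first by rewrite (a0 i) ?scale0r//; lia.
by rewrite (z0 i) ?scale0r//; lia.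
Qed.

(** Average the translates of [z] inside a widened gap of [a]: all of them give
    the value [p (a + z)], and their mean is [a] plus the mean of the translates
    of [z] alone. *)
Lemma drop_avg l r a z M :
  (forall i, (l <= i < r)%N -> a`_i = 0) ->
  (forall i, ~~ (l <= i < r)%N -> z`_i = 0) -> (0 < M)%N ->
  p a <= p (a + z) + p (ones_avg M * z).
Proof.
move=> a0 z0 M0.
set A := lcomb (fun i => 'X^(if (i < l)%N then i else i + M)%N) a.
have pA : p A = p a.
  by rewrite pI // => i j ij; do ?[case: ifP => ?]; lia.
have M1 : M%:R != 0 :> R by rewrite pnatr_eq0 -lt0n.
have AE : A = M%:R^-1 *: (\sum_(t < M) (A + 'X^t * z)) - ones_avg M * z.
  rewrite big_split /= sumr_const card_ord scalerDr -(scaler_nat M A) scalerA mulVf // scale1r.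
  by rewrite /ones_avg -scalerAl mulr_suml addrK.
rewrite -pA {1}AE; apply: le_trans (seminormB ps _ _) _; rewrite lerD2r.
rewrite (seminormZ ps) normfV normr_nat ler_pdivrMl ?ltr0n //.
apply: le_trans (seminorm_sum ps _ _ _) _.
rewrite (eq_bigr (fun=> p (a + z))) ?sumr_const ?card_ord ?mulr_natl // => t _.
exact: (spread_gap a0 z0 (ltnW (ltn_ord t))).
Qed.

(** A vector of sum zero is a multiple of 'X - 1, so that the sum of its
    translates telescopes. *)
Lemma ones_avg_sum0 (w : {poly R}) M : (0 < M)%N ->
  p (ones_avg M * (w * ('X - 1%:P))) <= (p w + p w) / M%:R.
Proof.
move=> M0; rewrite /ones_avg -scalerAl mulrCA (mulrC _ ('X - _)) -subrX1.
rewrite (seminormZ ps) normfV normr_nat mulrC ler_pM2r ?invr_gt0 ?ltr0n//.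
rewrite mulrBr mulr1; apply: le_trans (seminormB ps _ _) _.
by rewrite mulrC spread_shift.
Qed.

Lemma drop_sum0 l r a z :
  (forall i, (l <= i < r)%N -> a`_i = 0) ->
  (forall i, ~~ (l <= i < r)%N -> z`_i = 0) -> z.[1] = 0 -> p a <= p (a + z).
Proof.
move=> a0 z0 /eqP; rewrite -/(root z 1) => /factor_theorem[w zE].
apply: (@le_of_inv_nat _ _ _ (p w + p w)) => M M0.
apply: le_trans (drop_avg a0 z0 M0) _; rewrite lerD2l zE.
exact: ones_avg_sum0.
Qed.

Lemma p_ones_avgM a M : p (ones_avg M * a) <= (\sum_(i < size a) `|a`_i|) * p (ones_avg M).
Proof.
rewrite {1}(poly_sumXn (leqnn (size a))) mulr_sumr mulr_suml.
apply: le_trans (seminorm_sum ps _ _ _) _; apply: ler_sum => i _.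
by rewrite -scalerAr (seminormZ ps) mulrC (mulrC (ones_avg M)) spread_shift mulrC.
Qed.

Lemma drop_avg0 l r a z :
  (forall e, 0 < e -> exists2 M, (0 < M)%N & p (ones_avg M) < e) ->
  (forall i, (l <= i < r)%N -> a`_i = 0) ->
  (forall i, ~~ (l <= i < r)%N -> z`_i = 0) -> p a <= p (a + z).
Proof.
move=> d0 a0 z0; apply/ler_addgt0Pr => e e0.
set S := 1 + \sum_(i < size z) `|z`_i|.
have S0 : 0 < S by rewrite /S ltr_pwDl // sumr_ge0.
have [M M0 pM] := d0 (e / S) (divr_gt0 e0 S0).
apply: le_trans (drop_avg a0 z0 M0) _; rewrite lerD2l.
apply: le_trans (p_ones_avgM _ _) _.
rewrite ltr_pdivlMr // in pM; apply: le_trans (ltW pM).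
rewrite mulrC ler_wpM2l ?(seminorm_ge0 ps)// /S; lra.
Qed.

(** The mean of the translates of [a] differs from [a.[1]] times the mean of the
    basis vectors by a telescoping term, and taking the mean of translates does
    not increase a 1-spreading seminorm. *)
Lemma norm_horner1_le d a :
  (forall M, (0 < M)%N -> d <= p (ones_avg M)) -> d * `|a.[1]| <= p a.
Proof.
move=> hd.
have : root (a - a.[1]%:P) 1 by rewrite /root !hornerE subrr.
move=> /factor_theorem[w aE].
apply: (@le_of_inv_nat _ _ _ (p w + p w)) => M M0.
have -> : d * `|a.[1]| = `|a.[1]| * d by rewrite mulrC.
apply: (@le_trans _ _ (p (a.[1] *: ones_avg M))).
  by rewrite (seminormZ ps) ler_wpM2l // hd.
have -> : a.[1] *: ones_avg M = ones_avg M * a - ones_avg M * (w * ('X - 1%:P)).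
  by rewrite -mulrBr -aE opprB addrC subrK mulrC mul_polyC.
apply: le_trans (seminormB ps _ _) _; apply: lerD; last exact: ones_avg_sum0.
rewrite /ones_avg -scalerAl mulr_suml (seminormZ ps) normfV normr_nat.
rewrite ler_pdivrMl ?ltr0n //; apply: le_trans (seminorm_sum ps _ _ _) _.
under eq_bigr do rewrite spread_shift.
by rewrite sumr_const card_ord mulr_natl.
Qed.

End Averaging.

#[global] Opaque seg.

(** * A 1-spreading renorming by iterated upper limits *)

Section Limsup.
Context {R : realType}.
Implicit Types u v : nat -> R.

(** For bounded sequences this is the upper limit. *)
Definition lsup u : R := inf [set c | exists N, forall k, (N <= k)%N -> u k <= c].

Definition bddseq u := exists B, forall k, `|u k| <= B.

Lemma lsup_has_inf u : bddseq u ->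
  has_inf [set c | exists N, forall k, (N <= k)%N -> u k <= c].
Proof.
move=> [B uB]; split.
  by exists B, 0%N => k _; apply: le_trans (uB k); rewrite ler_norm.
exists (- B) => c [N hN]; apply: le_trans (hN N (leqnn N)).
by have := uB N; rewrite ler_norml => /andP[].
Qed.

Lemma lsup_le N c u : bddseq u -> (forall k, (N <= k)%N -> u k <= c) -> lsup u <= c.
Proof. by move=> bu h; apply: ge_inf; [case: (lsup_has_inf bu)|exists N]. Qed.

Lemma lsup_ge N c u : bddseq u -> (forall k, (N <= k)%N -> c <= u k) -> c <= lsup u.
Proof.
move=> bu h; apply: lb_le_inf; first by case: (lsup_has_inf bu).
move=> c' [N' hN']; apply: le_trans (h (maxn N N') _) (hN' _ _).
  exact: leq_maxl.
exact: leq_maxr.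
Qed.

Lemma lsup_cst c : lsup (fun=> c) = c.
Proof.
have bc : bddseq (fun=> c) by exists `|c|.
by apply/eqP; rewrite eq_le (@lsup_le 0%N) // (@lsup_ge 0%N).
Qed.

Lemma lsupD u v w : bddseq u -> bddseq v -> bddseq w ->
  (forall k, w k <= u k + v k) -> lsup w <= lsup u + lsup v.
Proof.
move=> bu bv bw wuv; rewrite -lerBlDl.
apply: lb_le_inf; first by case: (lsup_has_inf bv).
move=> c' [N' hN'].
rewrite lerBlDl -lerBlDr; apply: lb_le_inf; first by case: (lsup_has_inf bu).
move=> c [N hN]; rewrite lerBlDr; apply: (@lsup_le (maxn N N')) => // k.
rewrite geq_max => /andP[Nk N'k]; apply: le_trans (wuv k) _.
by rewrite lerD ?hN ?hN'.
Qed.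

Lemma lsupZ c u : bddseq u -> 0 <= c -> lsup (fun k => c * u k) = c * lsup u.
Proof.
move=> bu; rewrite le_eqVlt => /predU1P[<-|c0].
  by under eq_fun do rewrite mul0r; rewrite lsup_cst mul0r.
have bcu : bddseq (fun k => c * u k).
  case: bu => B uB; exists (c * B) => k.
  by rewrite normrM (gtr0_norm c0) ler_pM2l.
apply/eqP; rewrite eq_le; apply/andP; split.
  rewrite -ler_pdivrMl //; apply: lb_le_inf; first by case: (lsup_has_inf bu).
  move=> d [N hN]; rewrite ler_pdivrMl //; apply: (@lsup_le N) => // k /hN.
  by rewrite ler_pM2l.
apply: lb_le_inf; first by case: (lsup_has_inf bcu).
move=> d [N hN]; rewrite -ler_pdivlMl //; apply: (@lsup_le N) => // k /hN.
by rewrite ler_pdivlMl.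
Qed.

End Limsup.

Section IteratedLimsup.
Context {R : realType} {E : normedModType R} (x : nat -> E) (B : R).
Hypothesis xB : forall i, `|x i| <= B.

(** The inner limits are taken first, so each index goes to infinity while the
    previous ones are fixed. A zero coefficient makes its limit trivial: this
    is what makes the result insensitive to spreading. *)
Fixpoint ilim (s : seq R) (y : E) : R :=
  if s is c :: s' then lsup (fun k => ilim s' (y + c *: x k)) else `|y|.

Lemma ilim_bounds s y : 0 <= ilim s y <= `|y| + B * \sum_(c <- s) `|c|.
Proof.
have B0 : 0 <= B by apply: le_trans (xB 0%N).
elim: s y => [|c s IH] y /=; first by rewrite big_nil mulr0 addr0 normr_ge0 lexx.
have h k : 0 <= ilim s (y + c *: x k) <= `|y| + B * \sum_(c <- c :: s) `|c|.
  have /andP[-> /= h] := IH (y + c *: x k); apply: le_trans h _.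
  rewrite big_cons mulrDr addrA lerD2r; apply: le_trans (ler_normD _ _) _.
  by rewrite lerD2l normrZ mulrC ler_wpM2r.
have bb : bddseq (fun k => ilim s (y + c *: x k)).
  exists (`|y| + B * \sum_(c <- c :: s) `|c|) => k.
  by have /andP[h0 h1] := h k; rewrite ger0_norm.
apply/andP; split.
  by apply: (@lsup_ge _ 0%N) => // k _; case/andP: (h k).
by apply: (@lsup_le _ 0%N) => // k _; case/andP: (h k).
Qed.

Lemma ilim_ge0 s y : 0 <= ilim s y. Proof. by case/andP: (ilim_bounds s y). Qed.

Lemma ilim_bdd s y c : bddseq (fun k => ilim s (y + c *: x k)).
Proof.
exists ((`|y| + B * `|c|) + B * \sum_(c <- s) `|c|) => k.
rewrite ger0_norm ?ilim_ge0 //; have /andP[_ h] := ilim_bounds s (y + c *: x k).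
apply: le_trans h _; rewrite lerD2r; apply: le_trans (ler_normD _ _) _.
by rewrite lerD2l normrZ mulrC ler_wpM2r.
Qed.

Lemma ilim_filter s y : ilim s y = ilim [seq c <- s | c != 0] y.
Proof.
elim: s y => //= c s IH y; case: eqP => [->|_] /=.
  under eq_fun do rewrite scale0r addr0.
  by rewrite lsup_cst IH.
by congr lsup; apply: funext => k; rewrite IH.
Qed.

Lemma mkseqS (f : nat -> R) n : mkseq f n.+1 = f 0%N :: mkseq (f \o S) n.
Proof. by rewrite /mkseq /= (iotaDl 1 0 n) -map_comp. Qed.

Lemma ilimD (f g : nat -> R) n y z :
  ilim (mkseq (fun i => f i + g i) n) (y + z) <= ilim (mkseq f n) y + ilim (mkseq g n) z.
Proof.
elim: n f g y z => [|n IH] f g y z; first exact: ler_normD.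
rewrite !mkseqS; apply: lsupD; [exact: ilim_bdd..|] => k.
have := IH (f \o S) (g \o S) (y + f 0%N *: x k) (z + g 0%N *: x k).
by rewrite scalerDl addrACA.
Qed.

Lemma ilimZ (f : nat -> R) n y c :
  ilim (mkseq (fun i => c * f i) n) (c *: y) = `|c| * ilim (mkseq f n) y.
Proof.
elim: n f y => [|n IH] f y; first exact: normrZ.
rewrite !mkseqS /= -lsupZ //; last exact: ilim_bdd.
by congr lsup; apply: funext => k; rewrite -IH scalerDr scalerA.
Qed.

Lemma ilim_le s y N c : (forall k : nat -> nat, {homo k : i j / (i < j)%N} ->
    (N <= k 0)%N -> `|y + \sum_(i < size s) s`_i *: x (k i)| <= c) -> ilim s y <= c.
Proof.
elim: s y N => [|b s IH] y N h /=.
  by have := h (addn N) _ _; rewrite big_ord0 addr0; apply=> [i j|]; lia.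
apply: (@lsup_le _ N); first exact: ilim_bdd.
move=> k0 Nk0; apply: (IH _ k0.+1) => k kH k0k.
have := h (fun i => if i is j.+1 then k j else k0) _ _.
rewrite big_ord_recl /= addrA; apply=> //.
move=> [|i] [|j] //= ij; last exact: kH.
by apply: leq_trans k0k _; case: (posnP j) => [->//|/kH/ltnW].
Qed.

Lemma ilim_ge s y N c : (forall k : nat -> nat, {homo k : i j / (i < j)%N} ->
    (N <= k 0)%N -> c <= `|y + \sum_(i < size s) s`_i *: x (k i)|) -> c <= ilim s y.
Proof.
elim: s y N => [|b s IH] y N h /=.
  by have := h (addn N) _ _; rewrite big_ord0 addr0; apply=> [i j|]; lia.
apply: (@lsup_ge _ N); first exact: ilim_bdd.
move=> k0 Nk0; apply: (IH _ k0.+1) => k kH k0k.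
have := h (fun i => if i is j.+1 then k j else k0) _ _.
rewrite big_ord_recl /= addrA; apply=> //.
move=> [|i] [|j] //= ij; last exact: kH.
by apply: leq_trans k0k _; case: (posnP j) => [->//|/kH/ltnW].
Qed.

Definition pspread (a : {poly R}) : R := ilim a 0.

Lemma pspread_wide n (a : {poly R}) : (size a <= n)%N -> pspread a = ilim (mkseq (nth 0 a) n) 0.
Proof.
move=> an; rewrite /pspread ilim_filter [RHS]ilim_filter; congr ilim.
rewrite -[in mkseq _ _](subnKC an) /mkseq iotaD map_cat add0n filter_cat.
rewrite -[X in X ++ _](_ : [seq c <- a | c != 0] = _); last first.
  by rewrite -/(mkseq _ _) mkseq_nth.
rewrite [X in _ ++ X](_ : _ = [::]) ?cats0 //.
apply/eqP; rewrite -size_eq0 size_filter -leqn0 leqNgt -has_count.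
apply/hasPn => c /mapP[i]; rewrite mem_iota => /andP[ai _] ->.
by rewrite nth_default ?eqxx.
Qed.

Lemma pspread_seminorm : seminorm pspread.
Proof.
split=> [a b|c a].
  pose n := maxn (size (a + b)%R) (maxn (size a) (size b)).
  rewrite (@pspread_wide n (a + b)) ?leq_maxl//.
  rewrite (@pspread_wide n a) ?leq_max ?leqnn ?orbT//.
  rewrite (@pspread_wide n b) ?leq_max ?leqnn ?orbT//.
  rewrite (eq_mkseq (_ : _ =1 fun i => a`_i + b`_i)) => [|i]; last by rewrite coefD.
  by have := ilimD (nth 0 a) (nth 0 b) n 0 0; rewrite addr0.
rewrite (pspread_wide (leqnn (size a))) (@pspread_wide (size a)) ?size_scale_leq//.
rewrite -ilimZ scaler0; congr ilim; apply: eq_mkseq => i.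
by rewrite coefZ.
Qed.

Lemma coef_spread (k : nat -> nat) (a : {poly R}) j :
  (lcomb (fun i => 'X^(k i)) a)`_j = \sum_(i < size a | k i == j) a`_i.
Proof.
rewrite coef_sum [RHS]big_mkcond; apply: eq_bigr => i _.
by rewrite coefZ coefXn eq_sym; case: eqP => _; rewrite ?mulr1 ?mulr0.
Qed.

(** Spreading a vector only inserts zeros between its nonzero coefficients. *)
Lemma pspread_spread : spread_invariant pspread.
Proof.
move=> k a kH; set P := lcomb _ a.
have kinj : injective k 
  by move=> i j kij; apply/eqP; case: ltngtP => // /kH; rewrite kij ltnn.
have Pk (i : nat) : P`_(k i) = a`_i.
  rewrite coef_spread; case: (ltnP i (size a)) => [ia|ai].
    by rewrite (big_pred1 (Ordinal ia)) // => j; rewrite /= (inj_eq kinj).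
  rewrite (nth_default _ ai) big1 // => j /eqP/kinj ji; move: (ltn_ord j); lia.
have PN j : P`_j != 0 -> exists2 i, (i < size a)%N & j = k i.
  rewrite coef_spread => h; apply: contrapT => hn; case/eqP: h.
  by rewrite big1 // => i /eqP ij; case: hn; exists i.
have sP : (size P <= k (size a))%N.
  apply/leq_sizeP => j kj; apply/eqP; apply: contraT => /PN[i ia jk].
  by move: kj; rewrite jk leqNgt kH.
rewrite (pspread_wide sP) (pspread_wide (leqnn _)) ilim_filter [RHS]ilim_filter; congr ilim.
rewrite /mkseq !filter_map.
rewrite [X in map _ X](_ : _ = map k [seq i <- iota 0 (size a) | a`_i != 0]); last first.
  apply: (irr_sorted_eq ltn_trans ltnn).
  - by apply: sorted_filter; [exact: ltn_trans|exact: iota_ltn_sorted].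
  - rewrite sorted_map; apply: (@sub_sorted _ ltn) => [i j ij|]; first exact: kH.
    by apply: sorted_filter; [exact: ltn_trans|exact: iota_ltn_sorted].
  move=> j; rewrite mem_filter mem_iota /= add0n; apply/andP/mapP.
    move=> [Pj _]; have [i ia jk] := PN _ Pj; exists i => //.
    by rewrite mem_filter mem_iota /= add0n ia andbT -Pk -jk.
  move=> [i]; rewrite mem_filter mem_iota /= add0n => /andP[ai ia] ->.
  by rewrite Pk ai kH.
by rewrite -map_comp; apply: eq_map => i /=; rewrite Pk.
Qed.

Lemma pspread_le N c (a : {poly R}) : (forall k : nat -> nat,
    {homo k : i j / (i < j)%N} -> (N <= k 0)%N -> `|lcomb (x \o k) a| <= c) -> pspread a <= c.
Proof. by move=> h; apply: (@ilim_le _ _ N) => k kH Nk; rewrite add0r; exact: h. Qed.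

Lemma pspread_ge N c (a : {poly R}) : (forall k : nat -> nat,
    {homo k : i j / (i < j)%N} -> (N <= k 0)%N -> c <= `|lcomb (x \o k) a|) -> c <= pspread a.
Proof. by move=> h; apply: (@ilim_ge _ _ N) => k kH Nk; rewrite add0r; exact: h. Qed.

End IteratedLimsup.

Section UniformSpreading.
Context {R : realType} {E : normedModType R} (x : nat -> E).
Hypothesis x_spreading : spreading x.

Definition equiv_subseq (C : R) (k : nat -> nat) := forall a : {poly R},
  `|lcomb (x \o k) a| <= C * `|lcomb x a| /\ `|lcomb x a| <= C * `|lcomb (x \o k) a|.

Lemma spreading_equiv (k : nat -> nat) : {homo k : i j / (i < j)%N} ->
  exists C, 0 < C /\ equiv_subseq C k.
Proof.
move=> /x_spreading[c [C [c0 C0 h]]].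
exists (Num.max C c^-1); split; first by rewrite lt_max C0.
move=> a; have [h1 h2] := h (size a) (nth 0 a).
split; first by apply: le_trans h2 _; rewrite ler_wpM2r // le_max lexx.
move: h1; rewrite -ler_pdivlMl // => h1; apply: le_trans h1 _.
by rewrite ler_wpM2r // le_max lexx orbT.
Qed.

(** A Baire category argument on the tree of increasing sequences: if no finite
    prefix forced a uniform constant, one could extend prefixes so as to defeat
    every constant in turn, and the limiting subsequence would not be equivalent
    to [x]. *)
Lemma uniform_on_tree : exists (k0 : nat -> nat) (m : nat) (C : R),
  [/\ {homo k0 : i j / (i < j)%N}, 0 < C &
    forall k : nat -> nat, {homo k : i j / (i < j)%N} ->
      (forall i, (i < m)%N -> k i = k0 i) -> equiv_subseq C k].
Proof.
apply: contrapT => hN.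
have step (km : (nat -> nat) * nat * nat) : exists km' : (nat -> nat) * nat * nat,
    {homo km.1.1 : i j / (i < j)%N} ->
    [/\ {homo km'.1.1 : i j / (i < j)%N}, (km.1.2 < km'.1.2)%N, km'.2 = km.2.+1,
        (forall i, (i < km.1.2)%N -> km'.1.1 i = km.1.1 i) &
        forall k : nat -> nat, (forall i, (i < km'.1.2)%N -> k i = km'.1.1 i) ->
          ~ equiv_subseq km.2.+1%:R k].
  case: km => -[k0 m] j /=; apply: contrapT => hs; apply: hN.
  have [k0H|k0N] := pselect {homo k0 : i j / (i < j)%N}; last first.
    by case: hs; exists ((k0, m), j).
  exists k0, m, j.+1%:R; split => // k kH kk0 a.
  apply: contrapT => ha; apply: hs; exists ((k, maxn m.+1 (size a)), j.+1) => /= _.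
  split=> //; first by rewrite leq_max leqnn.
  move=> k' kk' /(_ a); rewrite (_ : lcomb (x \o k') a = lcomb (x \o k) a) //.
  by apply: eq_bigr => i _ /=; rewrite kk' // leq_max ltn_ord orbT.
have [f fP] := choice step.
pose st j := iter j f ((id, 0), 0)%N.
have stH j : {homo (st j).1.1 : i j / (i < j)%N}.
  by elim: j => //= j IH; have [] := fP _ IH.
have stj j : (st j).2 = j.
  by elim: j => //= j IH; have [_ _ -> _ _] := fP _ (stH j); rewrite IH.
have stm j : (j <= (st j).1.2)%N.
  by elim: j => //= j IH; have [_ h _ _ _] := fP _ (stH j); exact: leq_ltn_trans h.
have stmm j d : ((st j).1.2 <= (st (j + d)%N).1.2)%N.
  elim: d => [|d IH]; first by rewrite addn0.
  by rewrite addnS; have [_ h _ _ _] := fP _ (stH (j + d)%N); apply: leq_trans IH (ltnW h).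
have stE j d i : (i < (st j).1.2)%N -> (st (j + d)%N).1.1 i = (st j).1.1 i.
  move=> ij; elim: d => [|d IH]; first by rewrite addn0.
  rewrite addnS -IH; have [_ _ _ h _] := fP _ (stH (j + d)%N); apply: h.
  exact: leq_trans (stmm j d).
pose k i := (st i.+1).1.1 i.
have kE j i : (i < (st j).1.2)%N -> k i = (st j).1.1 i.
  move=> ij; rewrite /k; case: (leqP j i.+1) => [ji|/ltnW ij'].
    by rewrite -(subnKC ji) stE.
  by rewrite -[in RHS](subnKC ij') stE // (leq_trans _ (stm _)).
have kH : {homo k : i j / (i < j)%N}.
  move=> i j ij; rewrite (kE j.+1 i) ?(kE j.+1 j) ?stm ?stH //.
  by apply: leq_trans (stm j.+1); rewrite ltnS ltnW.
have [C [C0 kC]] := spreading_equiv kH.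
have [j hj] : exists j : nat, C < j.+1%:R.
  exists (Num.bound C); have := archi_boundP (ltW C0) => h.
  by apply: lt_trans h _; rewrite ltr_nat.
have [_ _ _ _ h] := fP _ (stH j); apply: (h k) => [i ij|a].
  exact: (kE j.+1).
rewrite stj; have [h1 h2] := kC a.
by split; [apply: le_trans h1 _|apply: le_trans h2 _]; rewrite ler_wpM2r // ltW.
Qed.

(** Prepend to [k] the prefix provided by [uniform_on_tree]; the shift of the
    coefficients is one more passage to a subsequence. *)
Lemma uniform_spreading : exists (T : nat) (C : R), 0 < C /\
  forall k : nat -> nat, {homo k : i j / (i < j)%N} -> (T <= k 0)%N -> equiv_subseq C k.
Proof.
have [k0 [m [C [k0H C0 h]]]] := uniform_on_tree.
have mH : {homo addn m : i j / (i < j)%N} by move=> i j; rewrite ltn_add2l.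
have [D [D0 hD]] := spreading_equiv mH.
exists (k0 m), (C * D); split; first exact: mulr_gt0.
move=> k kH Tk a; set k' := fun i => (if i < m then k0 i else k (i - m))%N.
have k'H : {homo k' : i j / (i < j)%N}.
  move=> i j ij; rewrite /k'; case: ifP => im; case: ifP => jm.
  - exact: k0H.
  - apply: leq_trans (k0H _ _ im) (leq_trans Tk _).
    by case: (posnP (j - m)) => [->//|/kH/ltnW].
  - lia.
  - by apply: kH; lia.
have k'k0 i : (i < m)%N -> k' i = k0 i by rewrite /k' => ->.
have [h1 h2] := h k' k'H k'k0 (lcomb (fun i => 'X^(m + i)) a).
have [h3 h4] := hD a.
move: h1 h2; rewrite !lcomb_comp (_ : (x \o k') \o addn m = x \o k); last first.
  by apply: funext => i /=; rewrite /k' ltnNge leq_addr /= addKn.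
move=> h1 h2; split.
  by apply: le_trans h1 _; rewrite -mulrA ler_pM2l.
apply: le_trans h4 _; rewrite (mulrC C) -mulrA ler_pM2l //; exact: h2.
Qed.

Lemma spreading_bounded : exists B, forall i, `|x i| <= B.
Proof.
have [T [C [C0 h]]] := uniform_spreading.
exists (C * `|x 0%N| + \sum_(i < T) `|x i|) => i.
case: (ltnP i T) => [iT|Ti].
  rewrite (bigD1 (Ordinal iT)) //= addrCA lerDl addr_ge0 ?sumr_ge0 //.
  by rewrite mulr_ge0 // ltW.
have iH : {homo addn i : j k / (j < k)%N} by move=> j k; rewrite ltn_add2l.
have Ti0 : (T <= i + 0)%N by rewrite addn0.
have [h1 _] := h (addn i) iH Ti0 'X^0.
rewrite !lcombXn /= addn0 in h1; apply: le_trans h1 _.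
by rewrite lerDl sumr_ge0.
Qed.

(** The iterated limits only see subsequences that start far out, where the
    constant of equivalence is uniform. *)
Lemma spread_renorming : exists (p : {poly R} -> R) (c : R),
  [/\ seminorm p, spread_invariant p, 0 < c &
    forall a, p a <= c * `|lcomb x a| /\ `|lcomb x a| <= c * p a].
Proof.
have [B xB] := spreading_bounded; have [T [C [C0 h]]] := uniform_spreading.
exists (pspread x), C; split=> //; first exact: pspread_seminorm xB.
  exact: pspread_spread.
move=> a; split.
  by apply: (pspread_le xB (N := T)) => k kH Tk; have [] := h k kH Tk a.
rewrite -ler_pdivrMl //; apply: (pspread_ge xB (N := T)) => k kH Tk.
by rewrite ler_pdivrMl //; have [] := h k kH Tk a.
Qed.

End UniformSpreading.

(** * Segments and sums over partitions *)

Section Segments.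
Context {R : realType}.
Implicit Types (a : {poly R}) (f g : nat -> R).

Lemma seg_add l r f g : seg l r (fun i => f i + g i) = seg l r f + seg l r g.
Proof. by apply/polyP => i; rewrite coefD !coef_seg; case: ifP; rewrite ?addr0. Qed.

Lemma seg_scale l r c f : seg l r (fun i => c * f i) = c *: seg l r f.
Proof. by apply/polyP => i; rewrite coefZ !coef_seg; case: ifP; rewrite ?mulr0. Qed.

Lemma eq_seg l r f g : (forall i, (l <= i < r)%N -> f i = g i) -> seg l r f = seg l r g.
Proof. by move=> fg; apply/polyP => i; rewrite !coef_seg; case: ifP => // /fg. Qed.

Lemma seg_eq0 l r f : (forall i, (l <= i < r)%N -> f i = 0) -> seg l r f = 0.
Proof. by move=> f0; apply/polyP => i; rewrite coef_seg coef0; case: ifP => // /f0. Qed.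

Lemma segD l r a b : seg l r (nth 0 (a + b)) = seg l r (nth 0 a) + seg l r (nth 0 b).
Proof. by rewrite -seg_add; apply: eq_seg => i _; rewrite coefD. Qed.

Lemma segZ l r c a : seg l r (nth 0 (c *: a)) = c *: seg l r (nth 0 a).
Proof. by rewrite -seg_scale; apply: eq_seg => i _; rewrite coefZ. Qed.

Lemma seg_seg l r l' r' f :
  seg l r (nth 0 (seg l' r' f)) = seg (maxn l l') (minn r r') f.
Proof.
apply/polyP => i; rewrite !coef_seg geq_max leq_min.
by case: (l <= i)%N; case: (l' <= i)%N; case: (i < r)%N; case: (i < r')%N.
Qed.

Lemma seg_all n a : (size a <= n)%N -> seg 0 n (nth 0 a) = a.
Proof.
move=> an; apply/polyP => i; rewrite coef_seg /=; case: ltnP => // ni.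
by rewrite nth_default // (leq_trans an).
Qed.

Lemma seg_split l m r f : (l <= m <= r)%N -> seg l r f = seg l m f + seg m r f.
Proof.
move=> lmr; apply/polyP => i; rewrite coefD !coef_seg.
by case: (leqP l i); case: (leqP m i); case: (ltnP i r) => //=;
  rewrite ?addr0 ?add0r //; lia.
Qed.

End Segments.

Section SegSums.
Context {R : realType}.

(** The list [l :: s] is read as a partition into consecutive intervals. *)
Fixpoint chain (g : nat -> nat -> R) (l : nat) (s : seq nat) : R :=
  if s is r :: s' then g l r + chain g r s' else 0.

Lemma chain_cat g l s s' : chain g l (s ++ s') = chain g l s + chain g (last l s) s'.
Proof. by elim: s l => [|r s IH] l /=; rewrite ?add0r // IH addrA. Qed.

Lemma chain_add g h l s :
  chain (fun i j => g i j + h i j) l s = chain g l s + chain h l s.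
Proof. by elim: s l => [|r s IH] l /=; rewrite ?addr0 // IH addrACA. Qed.

Lemma chain_scale c g l s : chain (fun i j => c * g i j) l s = c * chain g l s.
Proof. by elim: s l => [|r s IH] l /=; rewrite ?mulr0 // IH mulrDr. Qed.

Lemma path_leq_last l s : path leq l s -> (l <= last l s)%N.
Proof. by elim: s l => [|r s IH] l //= /andP[lr /IH]; exact: leq_trans. Qed.

Lemma ler_chain g h l s : path leq l s ->
  (forall i j, (l <= i)%N -> (i <= j)%N -> (j <= last l s)%N -> g i j <= h i j) ->
  chain g l s <= chain h l s.
Proof.
elim: s l => [|r s IH] l //= /andP[lr rs] gh; apply: lerD.
  by apply: gh => //; exact: path_leq_last.
by apply: IH => // i j ri ij js; apply: gh => //; apply: leq_trans ri.
Qed.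

Lemma eq_chain g h l s : path leq l s ->
  (forall i j, (l <= i)%N -> (i <= j)%N -> (j <= last l s)%N -> g i j = h i j) ->
  chain g l s = chain h l s.
Proof.
by move=> ls gh; apply/eqP; rewrite eq_le !ler_chain // => i j li ij jl; rewrite gh.
Qed.

Lemma chain_ge0 g l s : (forall i j, 0 <= g i j) -> 0 <= chain g l s.
Proof. by move=> g0; elim: s l => [|r s IH] l //=; rewrite addr_ge0. Qed.

Lemma chain_le_size g c l s : path leq l s ->
  (forall i j, (l <= i)%N -> (i <= j)%N -> (j <= last l s)%N -> g i j <= c) ->
  chain g l s <= (size s)%:R * c.
Proof.
move=> ls gc; apply: le_trans (ler_chain ls gc) _.
by elim: s l {ls gc} => [|r s IH] l /=; rewrite ?mul0r // -natr1 mulrDl mul1r addrC lerD2r.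
Qed.

Lemma chain_le_sum g (w : nat -> R) l s : path leq l s ->
  (forall i j, (i <= j)%N -> g i j <= \sum_(i <= k < j) w k) ->
  chain g l s <= \sum_(l <= k < last l s) w k.
Proof.
elim: s l => [|r s IH] l /=; first by rewrite big_geq.
move=> /andP[lr rs] gw.
rewrite (@big_cat_nat _ _ _ r) ?path_leq_last //=; apply: lerD; first exact: gw.
exact: IH.
Qed.

Lemma chain_sqr_le g l s : (forall i j, 0 <= g i j) ->
  chain (fun i j => g i j ^+ 2) l s <= chain g l s ^+ 2.
Proof.
move=> g0; elim: s l => [|r s IH] l /=; first by rewrite expr0n.
apply: le_trans (_ : _ <= g l r ^+ 2 + chain g r s ^+ 2) _; first by rewrite lerD2l.
by have := chain_ge0 r s g0; have := g0 l r; nra.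
Qed.

(** Minkowski's inequality, from the convexity of the square with the two
    norms as weights; these are perturbed to be positive. *)
Lemma chain_minkowski g h k l s : path leq l s ->
  (forall i j, 0 <= g i j) -> (forall i j, 0 <= h i j) ->
  (forall i j, (i <= j)%N -> 0 <= k i j <= g i j + h i j) ->
  Num.sqrt (chain (fun i j => k i j ^+ 2) l s) <=
  Num.sqrt (chain (fun i j => g i j ^+ 2) l s) + Num.sqrt (chain (fun i j => h i j ^+ 2) l s).
Proof.
move=> ls g0 h0 kgh.
set G := chain (fun i j => g i j ^+ 2) l s; set H := chain (fun i j => h i j ^+ 2) l s.
have G0 : 0 <= G by apply: chain_ge0 => i j; exact: sqr_ge0.
have H0 : 0 <= H by apply: chain_ge0 => i j; exact: sqr_ge0.
suff key : forall A B, 0 < A -> 0 < B -> G <= A ^+ 2 -> H <= B ^+ 2 ->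
    Num.sqrt (chain (fun i j => k i j ^+ 2) l s) <= A + B.
  apply/ler_addgt0Pr => e e0.
  have e2 : 0 < e / 2 by rewrite divr_gt0.
  apply: le_trans (key (Num.sqrt G + e / 2) (Num.sqrt H + e / 2) _ _ _ _) _.
  - by rewrite ltr_wpDl ?sqrtr_ge0.
  - by rewrite ltr_wpDl ?sqrtr_ge0.
  - rewrite -{1}(sqr_sqrtr G0) ler_sqr ?nnegrE ?addr_ge0 ?sqrtr_ge0 ?(ltW e2) //.
    by rewrite lerDl ltW.
  - rewrite -{1}(sqr_sqrtr H0) ler_sqr ?nnegrE ?addr_ge0 ?sqrtr_ge0 ?(ltW e2) //.
    by rewrite lerDl ltW.
  - lra.
move=> A B A0 B0 GA HB.
rewrite -(ger0_norm (ltW (addr_gt0 A0 B0))) -sqrtr_sqr ler_wsqrtr //.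
(* (g + h)^2 <= (A + B) (g^2 / A + h^2 / B), by convexity of the square *)
apply: le_trans (_ : _ <= chain (fun i j => (A + B) / A * g i j ^+ 2 + (A + B) / B * h i j ^+ 2) l s) _.
  apply: ler_chain => // i j _ ij _; have /andP[k0 kle] := kgh i j ij.
  apply: (@le_trans _ _ ((g i j + h i j) ^+ 2)).
    by rewrite ler_sqr ?nnegrE ?addr_ge0.
  rewrite -subr_ge0; have -> : (A + B) / A * g i j ^+ 2 + (A + B) / B * h i j ^+ 2
      - (g i j + h i j) ^+ 2 = (B * g i j - A * h i j) ^+ 2 / (A * B).
    by field; rewrite !gt_eqF.
  by rewrite divr_ge0 ?sqr_ge0 // ltW // mulr_gt0.
rewrite chain_add !chain_scale -/G -/H.
apply: le_trans (_ : _ <= (A + B) / A * A ^+ 2 + (A + B) / B * B ^+ 2) _.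
  by rewrite lerD // ler_wpM2l // divr_ge0 // ltW // addr_gt0.
by rewrite le_eqVlt; apply/orP; left; apply/eqP; field; rewrite !gt_eqF.
Qed.

(** Restarting a partition at [n] loses only the interval that straddles [n]. *)
Lemma chain_sqr_restart n (t : nat -> nat -> R) q i s :
  (forall i j, (j <= n)%N -> t i j = 0) -> (forall i j, 0 <= t i j <= q) ->
  (i <= n)%N -> path leq i s ->
  exists2 s', path leq n s' &
    chain (fun i j => t i j ^+ 2) i s <= q ^+ 2 + chain (fun i j => t i j ^+ 2) n s'.
Proof.
move=> window tq; elim: s i => [|r s IH] i iN /=.
  by move=> _; exists [::]; rewrite //= addr0 sqr_ge0.
move=> /andP[ir rs]; case: (leqP r n) => rn.
  by have [s' ns' h] := IH r rn rs; exists s'; rewrite // window // expr0n add0r.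
exists (r :: s); rewrite /= ?(ltnW rn) //.
apply: lerD; last by rewrite lerDr sqr_ge0.
by have /andP[h1 h2] := tq i r; rewrite ler_sqr ?nnegrE // (le_trans h1).
Qed.

(** Only the interval that straddles [n] sees both summands; it is responsible
    for the cross term. *)
Lemma chain_sqr_add n (f g h : nat -> nat -> R) qf qg i s :
  (forall i j, (j <= n)%N -> h i j = f i j) -> (forall i j, (n <= i)%N -> h i j = g i j) ->
  (forall i j, 0 <= f i j <= qf) -> (forall i j, 0 <= g i j <= qg) ->
  (forall i j, 0 <= h i j <= f i j + g i j) -> path leq i s ->
  chain (fun i j => h i j ^+ 2) i s <=
  chain (fun i j => f i j ^+ 2) i s + chain (fun i j => g i j ^+ 2) i s + qf * qg *+ 2.
Proof.
move=> hf hg fq gq hfg.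
have /andP[f0 fq0] := fq 0%N 0%N; have /andP[g0 gq0] := gq 0%N 0%N.
have q0 : 0 <= qf * qg by apply: mulr_ge0; [exact: le_trans f0 fq0|exact: le_trans g0 gq0].
elim: s i => [|r s IH] i /=; first by move=> _; rewrite mulr2n; lra.
move=> /andP[ir rs]; case: (leqP r n) => rn.
  by rewrite hf //; have := IH r rs; have := sqr_ge0 (g i r); lra.
have -> : chain (fun i j => h i j ^+ 2) r s = chain (fun i j => g i j ^+ 2) r s.
  by apply: (eq_chain rs) => k j rk _ _; rewrite hg //; apply: leq_trans rk; exact: ltnW.
have c0 : 0 <= chain (fun i j => f i j ^+ 2) r s.
  by apply: chain_ge0 => k j; exact: sqr_ge0.
have /andP[f1 f2] := fq i r; have /andP[g1 g2] := gq i r; have /andP[h1 h2] := hfg i r.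
have h3 : h i r ^+ 2 <= (f i r + g i r) ^+ 2 by rewrite ler_sqr ?nnegrE ?addr_ge0.
have h4 : f i r * g i r <= qf * qg by apply: ler_pM.
rewrite sqrrD mulr2n in h3; rewrite mulr2n; lra.
Qed.

Lemma chain_sqr_far n (t : nat -> nat -> R) (w : nat -> R) s :
  (forall i j, 0 <= t i j) -> (forall i, 0 <= w i) -> path leq n s ->
  (forall i j, (n <= i)%N -> t i j <= \sum_(i <= k < j) w k) ->
  chain (fun i j => t i j ^+ 2) n s <= (\sum_(n <= k < last n s) w k) ^+ 2.
Proof.
move=> t0 w0 ns tw; apply: le_trans (chain_sqr_le _ _ t0) _.
rewrite ler_sqr ?nnegrE ?chain_ge0 ?sumr_ge0 //.
apply: (@le_trans _ _ (chain (fun i j => (if (n <= i)%N then t i j else 0)) n s)).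
  by apply: (ler_chain ns) => i j -> _ _.
apply: chain_le_sum => // i j ij; case: ifP => ni; first exact: tw.
exact: sumr_ge0.
Qed.

End SegSums.

(** * Quotient norms by vectors in the gaps of a finite set *)

Lemma horner1_seg (R : realType) l r (f : nat -> R) : (seg l r f).[1] = \sum_(l <= i < r) f i.
Proof.
by rewrite segE horner_sum; apply: eq_bigr => i _; rewrite !hornerE expr1n mulr1.
Qed.

(** What the construction uses of a 1-spreading norm. In the summing case the
    sum of the coefficients is a bounded functional and only vectors of sum zero
    can be dropped from a gap; in the other case every vector can, which is
    unconditionality. *)
Record spreading_datum (R : realType) := SpreadingDatum {
  datum_norm :> {poly R} -> R ;
  summing : bool ;
  seg_const : R ;
  sum_const : R ;
  d_seminorm : seminorm datum_norm ;
  d_drop : forall l r (a z : {poly R}),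
    (forall i, (l <= i < r)%N -> a`_i = 0) ->
    (forall i, ~~ (l <= i < r)%N -> z`_i = 0) ->
    (summing -> z.[1] = 0) -> datum_norm a <= datum_norm (a + z) ;
  d_sum : summing -> forall a : {poly R}, `|a.[1]| <= sum_const * datum_norm a ;
  d_seg : forall l r (a : {poly R}), datum_norm (seg l r (nth 0 a)) <= seg_const * datum_norm a ;
  d_spread : spread_invariant datum_norm ;
  d_gt0 : 0 < datum_norm 1 }.

Section Quotient.
Context {R : realType} (p : spreading_datum R).
Implicit Types (a b z : {poly R}) (F : seq nat).
Let ps : seminorm p := d_seminorm p.

(** The annihilator of the functionals that are constant on the gaps of [F]
    (in the summing case) or vanish off [F] (in the other case). Given that [z]
    vanishes on [F], zero partial sums at the points of [F] say that the sum of
    [z] over each bounded gap is zero. *)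
Definition null F z :=
  (forall i, i \in F -> z`_i = 0) /\
  (summing p -> z.[1] = 0 /\ forall i, i \in F -> \sum_(0 <= j < i) z`_j = 0).

Lemma null0 F : null F 0.
Proof.
split=> [i _|_]; first by rewrite coef0.
by rewrite horner0; split=> // i _; rewrite big1 // => j _; rewrite coef0.
Qed.

Lemma nullD F z z' : null F z -> null F z' -> null F (z + z').
Proof.
move=> [z1 z2] [z'1 z'2]; split=> [i iF|/[dup]/z2[h1 h2]/z'2[h3 h4]].
  by rewrite coefD z1 ?z'1 ?addr0.
split=> [|i iF]; first by rewrite hornerD h1 h3 addr0.
under eq_bigr do rewrite coefD.
by rewrite big_split /= h2 // h4 // addr0.
Qed.

Lemma nullZ F c z : null F z -> null F (c *: z).
Proof.
move=> [z1 z2]; split=> [i iF|/z2[h1 h2]]; first by rewrite coefZ z1 ?mulr0.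
split=> [|i iF]; first by rewrite hornerZ h1 mulr0.
by under eq_bigr do rewrite coefZ; rewrite -mulr_sumr h2 // mulr0.
Qed.

Lemma null_gap F l r z : (forall i, (l <= i < r)%N -> i \notin F) ->
  (forall i, ~~ (l <= i < r)%N -> z`_i = 0) -> (summing p -> z.[1] = 0) -> null F z.
Proof.
move=> Flr z0 zs; split=> [i iF|/zs z1]; first by apply: z0; apply: contraL iF; exact: Flr.
split=> // i iF; case: (ltnP i l) => [il|li].
  by rewrite big_nat big1 // => j ji; apply: z0; lia.
have ri : (r <= i)%N by rewrite leqNgt; apply: contraL iF => ir; apply: Flr; rewrite li.
rewrite -[RHS]z1 big_mkord -horner1_wide //; apply/leq_sizeP => j ij.
by apply: z0; lia.
Qed.

Definition quot_norm F a : R := inf [set p (a + z) | z in null F].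

Lemma quot_norm_has_inf F a : has_inf [set p (a + z) | z in null F].
Proof.
split; first by exists (p (a + 0)), 0 => //; exact: null0.
by exists 0 => _ [z _ <-]; exact: seminorm_ge0.
Qed.

Lemma quot_norm_le F a z : null F z -> quot_norm F a <= p (a + z).
Proof. by move=> h; apply: ge_inf; [case: (quot_norm_has_inf F a)|exists z]. Qed.

Lemma quot_norm_ge F a c : (forall z, null F z -> c <= p (a + z)) -> c <= quot_norm F a.
Proof.
by move=> h; apply: lb_le_inf; [case: (quot_norm_has_inf F a)|move=> _ [z /h hz <-]].
Qed.

Lemma quot_norm_le_p F a : quot_norm F a <= p a.
Proof. by have := quot_norm_le a (null0 F); rewrite addr0. Qed.

Lemma quot_norm_ge0 F a : 0 <= quot_norm F a.
Proof. by apply: quot_norm_ge => z _; exact: seminorm_ge0. Qed.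

Lemma quot_norm_seminorm F : seminorm (quot_norm F).
Proof.
have hZ c a : quot_norm F (c *: a) <= `|c| * quot_norm F a.
  have [->|c0] := eqVneq c 0.
    by rewrite scale0r normr0 mul0r; apply: le_trans (quot_norm_le_p _ _) _; rewrite (seminorm0 ps).
  rewrite -ler_pdivrMl ?normr_gt0 //; apply: quot_norm_ge => z /(nullZ c) zn.
  rewrite ler_pdivrMl ?normr_gt0 // -(seminormZ ps) scalerDr.
  exact: quot_norm_le.
split=> [a b|c a].
  rewrite -lerBlDl; apply: quot_norm_ge => z' nz'.
  rewrite lerBlDl -lerBlDr; apply: quot_norm_ge => z nz; rewrite lerBlDr.
  apply: le_trans (quot_norm_le _ (nullD nz nz')) _.
  by rewrite addrACA; exact: seminormD.
apply/eqP; rewrite eq_le hZ /=.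
have [->|c0] := eqVneq c 0; first by rewrite normr0 mul0r quot_norm_ge0.
rewrite -ler_pdivlMl ?normr_gt0 // -normfV.
by have := hZ c^-1 (c *: a); rewrite scalerA mulVf // scale1r.
Qed.

Lemma quot_norm_null F z : null F z -> quot_norm F z = 0.
Proof.
move=> nz; apply/eqP; rewrite eq_le quot_norm_ge0 andbT.
by have := quot_norm_le z (nullZ (-1) nz); rewrite scaleN1r subrr (seminorm0 ps).
Qed.

(** The parts of [z] in the gaps of [F] are dropped from left to right; each of
    them has sum zero in the summing case. Adding the size of [z] to [F] closes
    the last gap. *)
Lemma p_le_add_null F a z :
  (forall i, i \notin F -> a`_i = 0) -> null F z -> p a <= p (a + z).
Proof.
move=> aF [zF zs]; pose M := size z; pose F' := M :: F.
have zF' i : i \in F' -> z`_i = 0.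
  by rewrite inE => /predU1P[->|/zF//]; rewrite nth_default.
have zs' : summing p -> forall i, i \in F' -> \sum_(0 <= j < i) z`_j = 0.
  move=> /zs[z1 z2] i; rewrite inE => /predU1P[->|/z2//].
  by rewrite big_mkord -horner1E z1.
have key n : exists g, [/\ (g <= n)%N, (forall i, (g <= i < n)%N -> i \notin F'),
    (summing p -> \sum_(0 <= j < g) z`_j = 0) &
    p (a + seg g M (nth 0 z)) <= p (a + z)].
  elim: n => [|n [g [gn gF gs gp]]].
    by exists 0%N; split=> // [_|]; [rewrite big_geq|rewrite seg_all].
  have [nF|nF] := boolP (n \in F'); last first.
    exists g; split=> // [|i /andP[gi]]; first exact: leq_trans gn _.
    by rewrite ltnS leq_eqVlt => /predU1P[->//|il]; apply: gF; rewrite gi il.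
  exists n.+1; split=> // [i|s|]; first lia.
    by rewrite big_nat_recr //= zF' // addr0 zs'.
  apply: le_trans gp.
  have -> : seg g M (nth 0 z) = seg n.+1 M (nth 0 z) + seg g n (nth 0 z).
    apply/polyP => i; rewrite coefD !coef_seg.
    have [->|ne] := eqVneq i n; first by rewrite zF' // !if_same addr0.
    have [iM|Mi] := ltnP i M; last by rewrite nth_default // !if_same addr0.
    by do 3![case: ifP => ?]; rewrite ?addr0 ?add0r //; lia.
  rewrite addrA; apply: (@d_drop _ p g n) => [i gin|i gin|s].
  - have iF' := gF i gin; have iF : i \notin F by move: iF'; rewrite inE negb_or => /andP[].
    by rewrite coefD aF // coef_seg; case: ifP; rewrite ?addr0//; lia.
  - by rewrite coef_seg (negbTE gin).
  rewrite horner1_seg; have := zs' s n nF.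
  by rewrite (@big_cat_nat _ _ _ g) //= gs // add0r.
have [g [gM gF _]] := key M.+1.
have gE : g = M.+1.
  apply/eqP; rewrite eqn_leq gM /= ltnNge; apply/negP => h.
  by have := gF M; rewrite h ltnSn inE eqxx => /(_ isT).
rewrite gE (_ : seg _ _ _ = 0) ?addr0 //; apply: seg_eq0; lia.
Qed.

Lemma quot_norm_supp F a : (forall i, i \notin F -> a`_i = 0) -> quot_norm F a = p a.
Proof.
move=> aF; apply/eqP; rewrite eq_le quot_norm_le_p; apply: quot_norm_ge => z.
exact: p_le_add_null.
Qed.

End Quotient.

(** * The Schreier norm and the partition norms *)

Section SupSeminorm.
Context {R : realType} {V : lmodType R} {I : Type} (f : I -> V -> R).

Definition sup_of (x : V) : R := sup (range (f^~ x)).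

Lemma sup_of_ge x M i : (forall i, f i x <= M) -> f i x <= sup_of x.
Proof.
move=> fM; apply: ub_le_sup; last by exists i.
by exists M => _ [j _ <-].
Qed.

Lemma sup_of_le (i0 : I) x c : (forall i, f i x <= c) -> sup_of x <= c.
Proof.
by move=> fc; apply: ge_sup; [exists (f i0 x), i0|move=> _ [j _ <-]].
Qed.

Lemma sup_of_seminorm (i0 : I) : (forall i, seminorm (f i)) ->
  (forall x, exists M, forall i, f i x <= M) -> seminorm sup_of.
Proof.
move=> fs fb; have hZ c x : sup_of (c *: x) <= `|c| * sup_of x.
  have [M xM] := fb x; apply: (sup_of_le i0) => i.
  by rewrite (seminormZ (fs i)) ler_wpM2l // (sup_of_ge _ xM).
have s0 x : 0 <= sup_of x.
  by have [M xM] := fb x; apply: le_trans (sup_of_ge i0 xM); exact: (seminorm_ge0 (fs i0)).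
split=> [x y|c x].
  have [M xM] := fb x; have [N yN] := fb y; apply: (sup_of_le i0) => i.
  by apply: le_trans (seminormD (fs i) _ _) _; rewrite lerD ?(sup_of_ge _ xM) ?(sup_of_ge _ yN).
apply/eqP; rewrite eq_le hZ /=.
have [->|c0] := eqVneq c 0; first by rewrite normr0 mul0r.
rewrite -ler_pdivlMl ?normr_gt0 // -normfV.
by have := hZ c^-1 (c *: x); rewrite scalerA mulVf // scale1r.
Qed.

End SupSeminorm.

Lemma seminorm_zero (R : realType) (V : lmodType R) : seminorm (fun _ : V => 0 : R).
Proof. by split=> [x y|c x]; rewrite ?addr0 ?mulr0. Qed.

Lemma seminorm_if (R : realType) (V : lmodType R) (b : bool) (p : V -> R) :
  (b -> seminorm p) -> seminorm (fun x => if b then p x else 0).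
Proof. by case: b => [/(_ isT)//|_]; exact: seminorm_zero. Qed.

Section Norms.
Context {R : realType} (p : spreading_datum R).
Implicit Types (a b z : {poly R}) (F s u : seq nat).
Let ps : seminorm p := d_seminorm p.

Let K_ge0 : 0 <= seg_const p.
Proof.
have h := d_seg p 0 1 1; move: h; rewrite seg_all ?size_poly1 // => h.
by have := d_gt0 p; nra.
Qed.

(** This will be the norm of the spreading model. Restrictions to intervals are
    built in because the final norm is monotone under them, which [p] need not
    be. *)
Definition interval_norm : {poly R} -> R := sup_of (fun (lr : nat * nat) a => p (seg lr.1 lr.2 (nth 0 a))).

Lemma interval_norm_ge l r a : p (seg l r (nth 0 a)) <= interval_norm a.
Proof. by apply: (sup_of_ge (f := fun (lr : nat * nat) a => p (seg lr.1 lr.2 (nth 0 a))) (l, r) (M := seg_const p * p a)) => i; exact: d_seg. Qed.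

Lemma interval_norm_le c a : (forall l r, p (seg l r (nth 0 a)) <= c) -> interval_norm a <= c.
Proof. by move=> h; apply: (sup_of_le (0, 0)%N) => -[l r]; exact: h. Qed.

Lemma p_le_interval_norm a : p a <= interval_norm a.
Proof. by have := interval_norm_ge 0 (size a) a; rewrite seg_all. Qed.

Lemma interval_norm_le_p a : interval_norm a <= seg_const p * p a.
Proof. by apply: interval_norm_le => l r; exact: d_seg. Qed.

Lemma seg_seminorm (g : {poly R} -> R) l r : seminorm g -> seminorm (fun a => g (seg l r (nth 0 a))).
Proof. by move=> [gD gZ]; split=> [a b|c a]; rewrite ?segD ?segZ. Qed.

Lemma interval_norm_seminorm : seminorm interval_norm.
Proof.
apply: (sup_of_seminorm (0, 0)%N) => [[l r]|a]; first exact: seg_seminorm.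
by exists (seg_const p * p a) => i; exact: d_seg.
Qed.

(** Schreier sets, normalized so that singletons, including that of 0, belong
    to the family. *)
Definition adm F := all (fun i => size F <= i.+1)%N F.

(** Far out this norm agrees with the spreading norm on vectors with few
    nonzero coordinates, but it forgets so much about long vectors that far
    blocks are weakly null for it (up to their sum, in the summing case). *)
Definition schreier : {poly R} -> R := sup_of (fun (Flr : seq nat * (nat * nat)) a =>
  if adm Flr.1 then quot_norm p Flr.1 (seg Flr.2.1 Flr.2.2 (nth 0 a)) else 0).

Lemma schreier_ge F l r a : adm F -> quot_norm p F (seg l r (nth 0 a)) <= schreier a.
Proof.
move=> aF; have := @sup_of_ge _ _ _ (fun (Flr : seq nat * (nat * nat)) a =>
  if adm Flr.1 then quot_norm p Flr.1 (seg Flr.2.1 Flr.2.2 (nth 0 a)) else 0) a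
  (seg_const p * p a) (F, (l, r)).
rewrite /= aF; apply=> -[G [l' r']] /=; case: ifP => _.
  exact: le_trans (quot_norm_le_p _ _ _) (d_seg _ _ _ _).
by rewrite mulr_ge0 // (seminorm_ge0 ps).
Qed.

Lemma schreier_le a c : 0 <= c ->
  (forall F l r, adm F -> quot_norm p F (seg l r (nth 0 a)) <= c) -> schreier a <= c.
Proof.
move=> c0 h; apply: (sup_of_le ([::], (0, 0)%N)) => -[F [l r]] /=.
by case: ifP => // aF; exact: h.
Qed.

Lemma schreier_seminorm : seminorm schreier.
Proof.
apply: (sup_of_seminorm ([::], (0, 0)%N)) => [[F [l r]]|a] /=.
  by apply: seminorm_if => _; apply: seg_seminorm; exact: quot_norm_seminorm.
exists (seg_const p * p a) => -[F [l r]] /=; case: ifP => _.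
  exact: le_trans (quot_norm_le_p _ _ _) (d_seg _ _ _ _).
by rewrite mulr_ge0 // (seminorm_ge0 ps).
Qed.

Lemma schreier_ge0 a : 0 <= schreier a. Proof. exact: seminorm_ge0 schreier_seminorm a. Qed.

Lemma schreier_le_interval_norm a : schreier a <= interval_norm a.
Proof.
apply: schreier_le => [|F l r _]; first exact: (seminorm_ge0 interval_norm_seminorm).
exact: le_trans (quot_norm_le_p _ _ _) (interval_norm_ge _ _ _).
Qed.

Lemma schreier_quot F a : adm F -> quot_norm p F a <= schreier a.
Proof. by move=> aF; have := schreier_ge 0 (size a) a aF; rewrite seg_all. Qed.

Lemma schreier_seg l r a : schreier (seg l r (nth 0 a)) <= schreier a.
Proof. by apply: schreier_le => [|F l' r' aF]; rewrite ?schreier_ge0 // seg_seg; exact: schreier_ge. Qed.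

Lemma schreier_segf l r l' r' (f : nat -> R) : (l' <= l)%N -> (r <= r')%N ->
  schreier (seg l r f) <= schreier (seg l' r' f).
Proof.
move=> ll rr; have := schreier_seg l r (seg l' r' f); rewrite seg_seg.
by rewrite (maxn_idPl ll) (minn_idPl rr).
Qed.

(** The quotient norm by [null F] is the full norm on vectors supported by
    [F]. *)
Lemma schreier_supp F a : adm F -> (forall i, i \notin F -> a`_i = 0) -> schreier a = interval_norm a.
Proof.
move=> aF h; apply/eqP; rewrite eq_le schreier_le_interval_norm; apply: interval_norm_le => l r.
rewrite -(@quot_norm_supp _ p F); first exact: schreier_ge.
by move=> i iF; rewrite coef_seg h // if_same.
Qed.

Lemma schreier_Xn n : schreier 'X^n <= seg_const p * p 1.
Proof.
apply: le_trans (schreier_le_interval_norm _) (le_trans (interval_norm_le_p _) _).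
by rewrite (spread_Xn (@d_spread _ p)).
Qed.

Lemma schreier_seg_sum l r (f : nat -> R) :
  schreier (seg l r f) <= \sum_(l <= i < r) `|f i| * (seg_const p * p 1).
Proof.
rewrite segE; apply: le_trans (seminorm_sum schreier_seminorm _ _ _) _.
apply: ler_sum => i _; rewrite (seminormZ schreier_seminorm) ler_wpM2l //; exact: schreier_Xn.
Qed.

(** The singleton of [i] is admissible and has the [i]-th term as quotient. *)
Lemma schreier_coef (f : nat -> R) l r i : (l <= i < r)%N -> `|f i| * p 1 <= schreier (seg l r f).
Proof.
move=> ilr.
have := @schreier_ge [:: i] i i.+1 (seg l r f) isT; rewrite quot_norm_supp; last first.
  move=> j; rewrite inE => ji; rewrite coef_seg.
  by case: ifP => //; move: ji; case: eqP => //; lia.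
apply: le_trans; rewrite seg_seg segE.
have -> : maxn i l = i by lia.
have -> : minn i.+1 r = i.+1 by lia.
by rewrite big_nat1 (seminormZ ps) (spread_Xn (@d_spread _ p)).
Qed.

Lemma schreier_sum : summing p -> forall a, `|a.[1]| <= sum_const p * schreier a.
Proof.
move=> s a; have C0 : 0 <= sum_const p.
  have := d_sum s 1; rewrite hornerC normr1; have := d_gt0 p; nra.
apply: (@le_trans _ _ (sum_const p * quot_norm p [::] a)); last first.
  by rewrite ler_wpM2l //; exact: schreier_quot.
move: C0; rewrite le_eqVlt => /predU1P[C0|C0].
  by have := d_sum s a; rewrite -C0 !mul0r.
rewrite -ler_pdivrMl //; apply: quot_norm_ge => z [_ /(_ s)[z0 _]].
by rewrite ler_pdivrMl // -[a.[1]]addr0 -z0 -hornerD; exact: d_sum.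
Qed.

Definition window_sum (l : nat) (u : seq nat) (f : nat -> R^o) : R :=
  chain (fun i j => schreier (seg i j f)) l u.

(** A mean of Schreier norms of pieces of the window from [l] to [r]. The number
    of pieces grows with [l], so that a vector with few nonzero coordinates far
    out is nearly invisible, while a long sum of pieces of norm one is not. *)
Definition window (l r : nat) : (nat -> R^o) -> R := sup_of (fun u f =>
  if [&& path leq l u, (last l u <= r)%N & (size u <= l.+1)%N]
  then window_sum l u f / l.+1%:R else 0).

Let qf_seminorm l r : seminorm (fun f : nat -> R^o => schreier (seg l r f)).
Proof.
split=> [f g|c f].
  by rewrite (seg_add l r f g) (seminormD schreier_seminorm).
by rewrite (seg_scale l r c f) (seminormZ schreier_seminorm).
Qed.

Lemma window_sum_seminorm l u : seminorm (window_sum l u).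
Proof.
rewrite /window_sum; elim: u l => [|r u IH] l /=; first exact: seminorm_zero.
split=> [f g|c f].
  by rewrite addrACA lerD ?(seminormD (qf_seminorm _ _)) ?(seminormD (IH _)).
by rewrite mulrDr (seminormZ (qf_seminorm _ _)) (seminormZ (IH _)).
Qed.

Lemma window_sum_le l u r f : path leq l u -> (last l u <= r)%N -> (size u <= l.+1)%N ->
  window_sum l u f / l.+1%:R <= schreier (seg l r f).
Proof.
move=> lu ur ul; rewrite ler_pdivrMr ?ltr0n // mulrC.
apply: (@le_trans _ _ ((size u)%:R * schreier (seg l r f))).
  by apply: chain_le_size => // i j li _ ju; apply: schreier_segf => //; exact: leq_trans ur.
by rewrite ler_wpM2r ?schreier_ge0 // ler_nat.
Qed.

Lemma window_ge l u r f : path leq l u -> (last l u <= r)%N -> (size u <= l.+1)%N ->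
  window_sum l u f / l.+1%:R <= window l r f.
Proof.
move=> h1 h2 h3.
have := @sup_of_ge _ _ _ (fun u f =>
  if [&& path leq l u, (last l u <= r)%N & (size u <= l.+1)%N]
  then window_sum l u f / l.+1%:R else 0) f (schreier (seg l r f)) u.
rewrite /= h1 h2 h3; apply=> v; case: ifP => [/and3P[]|_]; last exact: schreier_ge0.
exact: window_sum_le.
Qed.

Lemma window_le l r f c : 0 <= c -> (forall u, path leq l u -> (last l u <= r)%N ->
  (size u <= l.+1)%N -> window_sum l u f / l.+1%:R <= c) -> window l r f <= c.
Proof.
by move=> c0 h; apply: (sup_of_le [::]) => u; case: ifP => // /and3P[]; exact: h.
Qed.

Lemma window_le_qn l r f : window l r f <= schreier (seg l r f).
Proof. by apply: window_le => [|u]; [exact: schreier_ge0|exact: window_sum_le]. Qed.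

Lemma window_seminorm l r : seminorm (window l r).
Proof.
apply: (sup_of_seminorm [::]) => [u|f].
  apply: seminorm_if => _; have hs := window_sum_seminorm l u.
  by split=> [f g|c f]; rewrite -?mulrDl ?(seminormZ hs) ?mulrA // ler_wpM2r ?(seminormD hs).
exists (schreier (seg l r f)) => u; case: ifP => [/and3P[]|_]; last exact: schreier_ge0.
exact: window_sum_le.
Qed.

Lemma window_ge0 l r f : 0 <= window l r f. Proof. exact: seminorm_ge0 (window_seminorm l r) f. Qed.

Lemma window_mono l r f g : (forall i j, (l <= i)%N -> (i <= j)%N -> (j <= r)%N ->
  schreier (seg i j f) <= schreier (seg i j g)) -> window l r f <= window l r g.
Proof.
move=> fg; apply: window_le => [|u lu ur ul]; first exact: window_ge0.
apply: le_trans (window_ge _ lu ur ul); rewrite ler_pM2r ?invr_gt0 ?ltr0n //.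
by apply: ler_chain => // i j li ij ju; apply: fg => //; exact: leq_trans ur.
Qed.

Lemma eq_window l r f g : (forall i, (l <= i < r)%N -> f i = g i) -> window l r f = window l r g.
Proof.
move=> fg; have e i j : (l <= i)%N -> (j <= r)%N -> seg i j f = seg i j g.
  by move=> li jr; apply: eq_seg => k ikj; apply: fg; lia.
by apply/le_anti/andP; split; apply: window_mono => i j li ij jr; rewrite e.
Qed.

Lemma window_seg l r l' r' f : window l r (nth 0 (seg l' r' f)) <= window l r f.
Proof.
apply: window_mono => i j _ _ _; rewrite seg_seg; apply: schreier_segf; first exact: leq_maxl.
exact: geq_minl.
Qed.

Lemma window0 r f : schreier (seg 0 r f) <= window 0 r f.
Proof. by have := @window_ge 0 [:: r] r f; rewrite /window_sum /= addr0 divr1 leqnn; apply. Qed.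

Lemma window_seg_sum l r f : window l r f <= \sum_(l <= i < r) `|f i| * (seg_const p * p 1).
Proof. exact: le_trans (window_le_qn _ _ _) (schreier_seg_sum _ _ _). Qed.

Definition partition_sqr (s : seq nat) (f : nat -> R^o) : R :=
  chain (fun i j => window i j f ^+ 2) 0 s.

(** The norm of the space will be the supremum over all partitions. Squares
    are summed so that means of successive blocks tend to zero. *)
Definition partition_norm (s : seq nat) (f : nat -> R^o) : R :=
  if path leq 0 s then Num.sqrt (partition_sqr s f) else 0.

Lemma partition_sqr_ge0 s f : 0 <= partition_sqr s f.
Proof. by apply: chain_ge0 => i j; exact: sqr_ge0. Qed.

Lemma partition_norm_ge0 s f : 0 <= partition_norm s f.
Proof. by rewrite /partition_norm; case: ifP => // _; exact: sqrtr_ge0. Qed.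

Lemma partition_norm_seminorm s : seminorm (partition_norm s).
Proof.
apply: seminorm_if => ls; split=> [f g|c f].
  apply: chain_minkowski => // i j; rewrite ?window_ge0 // => ij.
  exact: (seminormD (window_seminorm i j)).
rewrite -sqrtr_sqr -sqrtrM ?sqr_ge0 //; congr Num.sqrt; rewrite /partition_sqr -chain_scale.
apply: eq_chain => // i j _ _ _.
by rewrite (seminormZ (window_seminorm i j)) exprMn real_normK ?num_real.
Qed.

Lemma partition_norm_le s f c : 0 <= c -> (path leq 0 s -> partition_sqr s f <= c ^+ 2) -> partition_norm s f <= c.
Proof.
move=> c0; rewrite /partition_norm; case: ifP => // ls /(_ isT) h.
by rewrite -(ger0_norm c0) -sqrtr_sqr ler_wsqrtr.
Qed.

Lemma partition_sqr_partition_norm s f c : path leq 0 s -> partition_norm s f <= c -> partition_sqr s f <= c ^+ 2.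
Proof.
move=> ls h; have c0 := le_trans (partition_norm_ge0 s f) h; move: h; rewrite /partition_norm ls => h.
by rewrite -(sqr_sqrtr (partition_sqr_ge0 s f)) ler_sqr ?nnegrE ?sqrtr_ge0.
Qed.

Lemma partition_norm_sum s f : partition_norm s f <= \sum_(0 <= i < last 0%N s) `|f i| * (seg_const p * p 1).
Proof.
have B0 : 0 <= seg_const p * p 1 by rewrite mulr_ge0 // ltW // d_gt0.
have S0 : 0 <= \sum_(0 <= i < last 0%N s) `|f i| * (seg_const p * p 1).
  by apply: sumr_ge0 => i _; rewrite mulr_ge0.
apply: partition_norm_le => // ls.
apply: le_trans (chain_sqr_le _ _ (fun i j => window_ge0 i j f)) _.
rewrite ler_sqr ?nnegrE ?(chain_ge0 _ _ (fun i j => window_ge0 i j f)) //.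
by apply: chain_le_sum => // i j _; exact: window_seg_sum.
Qed.

Lemma partition_norm_seg s l r f : partition_norm s (nth 0 (seg l r f)) <= partition_norm s f.
Proof.
rewrite /partition_norm; case: (boolP (path leq 0 s)) => ls; last exact: lexx.
apply: ler_wsqrtr; apply: (ler_chain ls) => i j _ _ _.
rewrite ler_sqr; [exact: window_seg|rewrite nnegrE; exact: window_ge0..].
Qed.

Lemma eq_partition_norm s f g : (forall i, (i < last 0 s)%N -> f i = g i) -> partition_norm s f = partition_norm s g.
Proof.
move=> fg; rewrite /partition_norm; case: (boolP (path leq 0 s)) => ls; last by [].
have e i j : (0 <= i)%N -> (i <= j)%N -> (j <= last 0 s)%N -> window i j f ^+ 2 = window i j g ^+ 2.
  move=> _ _ js; have -> : window i j f = window i j g; last by [].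
  by apply: eq_window => k /andP[_ kj]; apply: fg; exact: leq_trans js.
exact: (f_equal Num.sqrt (eq_chain ls e)).
Qed.

Lemma schreier_partition_norm r f : schreier (seg 0 r f) <= partition_norm [:: r] f.
Proof.
rewrite /partition_norm /= /partition_sqr /= addr0 sqrtr_sqr ger0_norm ?window_ge0 //; exact: window0.
Qed.

End Norms.

#[global] Opaque schreier window.

(** * Bounded completeness and almost orthogonality of the partition norms *)

Section Estimates.
Context {R : realType} (p : spreading_datum R).
Implicit Types (a b z : {poly R}) (F s u : seq nat) (f : nat -> R).

Definition norm_bounded f := exists M, forall s, partition_norm p s f <= M.

Lemma norm_bounded_partition_sqr f : norm_bounded f -> exists M, forall s, path leq 0%N s -> partition_sqr p s f <= M.
Proof. by move=> [M fM]; exists (M ^+ 2) => s ls; apply: partition_sqr_partition_norm. Qed.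

(** Iterating the extension gives partitions of arbitrarily large value. *)
Lemma unbounded_partition_sqr f d : norm_bounded f -> 0 < d ->
  ~ (forall s, path leq 0%N s -> exists2 s', path leq 0%N s' & partition_sqr p s f + d <= partition_sqr p s' f).
Proof.
move=> /norm_bounded_partition_sqr[M fM] d0 h.
have key k : exists2 s, path leq 0%N s & k%:R * d <= partition_sqr p s f.
  elim: k => [|k [s ls IH]]; first by exists [::]; rewrite ?mul0r.
  have [s' ls' ss'] := h s ls; exists s' => //.
  by apply: le_trans ss'; rewrite -natr1 mulrDl mul1r lerD2r.
have M0 : 0 <= M by have := fM [::] isT.
have [k hk] : exists k : nat, M / d < k%:R.
  by exists (Num.bound (M / d)); rewrite archi_boundP // divr_ge0 // ltW.
have [s ls ks] := key k.
by move: hk; rewrite ltr_pdivrMr // ltNge (le_trans ks (fM s ls)).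
Qed.

(** Otherwise every partition could be extended by a window that contains as
    many pieces of large Schreier norm as it averages over. *)
Lemma schreier_tail f e : norm_bounded f -> 0 < e ->
  exists n, forall l r, (n <= l)%N -> schreier p (seg l r f) <= e.
Proof.
move=> fb e0; apply: contrapT => hN.
have far n : exists lr : nat * nat, (n <= lr.1)%N /\ e < schreier p (seg lr.1 lr.2 f).
  apply: contrapT => h; apply: hN; exists n => l r nl.
  by rewrite leNgt; apply/negP => hq; apply: h; exists (l, r).
have blocks l m : exists u, [/\ path leq l u, size u = m & m%:R * e <= window_sum p l u f].
  elim: m l => [|m IH] l; first by exists [::]; rewrite mul0r.
  have [[l' r'] /= [ll' lr']] := far l.
  have lr'' : (l <= r')%N.
    rewrite leqNgt; apply/negP => r'l; move: lr'; rewrite seg_eq0; last by move=> i; lia.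
    by rewrite (seminorm0 (schreier_seminorm p)) ltNge ltW.
  have [u [r'u <- hu]] := IH r'; exists (r' :: u); split; rewrite /= ?lr'' //.
  rewrite -natr1 mulrDl mul1r addrC /window_sum /= lerD //.
  by apply: le_trans (ltW lr') _; exact: schreier_segf.
apply: (unbounded_partition_sqr fb (exprn_gt0 2 e0)) => s ls.
pose l := last 0%N s; have [u [lu su hu]] := blocks l l.+1.
exists (rcons s (last l u)).
  by rewrite rcons_path ls /=; exact: path_leq_last.
rewrite /partition_sqr -cats1 chain_cat lerD2l /= addr0 ler_sqr ?nnegrE ?window_ge0 ?(ltW e0) //.
have := @window_ge _ p l u (last l u) f lu (leqnn _); rewrite su leqnn => /(_ isT).
by apply: le_trans; rewrite ler_pdivlMr ?ltr0n // mulrC.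
Qed.

Lemma window_bounds i j f q : (forall l r, schreier p (seg l r f) <= q) -> 0 <= window p i j f <= q.
Proof. by move=> fq; rewrite window_ge0 (le_trans (window_le_qn _ _ _ _)). Qed.

Lemma window_far0 n f i j : (forall k, (k < n)%N -> f k = 0) -> (j <= n)%N -> window p i j f = 0.
Proof.
move=> fn jn; apply: le_anti; rewrite window_ge0 andbT.
apply: le_trans (window_le_qn _ _ _ _) _; rewrite seg_eq0 ?(seminorm0 (schreier_seminorm p)) // => k jk.
by apply: fn; lia.
Qed.

(** This is bounded completeness. Far segments have small Schreier norm, so a
    partition that detects such a segment can be restarted at its left end
    almost without loss, and be appended to any partition of what precedes. *)
Lemma partition_norm_tail f e : norm_bounded f -> 0 < e ->
  exists n, forall l r s, (n <= l)%N -> partition_norm p s (nth 0 (seg l r f)) <= e.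
Proof.
move=> fb e0; apply: contrapT => hN.
have e2 : 0 < e / 2 by rewrite divr_gt0.
have [n0 hn0] := schreier_tail fb e2.
have d0 : 0 < e ^+ 2 - (e / 2) ^+ 2 by nra.
apply: (unbounded_partition_sqr fb d0) => s ls; pose N := maxn (last 0%N s) n0.
have [l [r [s' [Nl hs]]]] : exists l r s', (N <= l)%N /\ e < partition_norm p s' (nth 0 (seg l r f)).
  apply: contrapT => h; apply: hN; exists N => l r s' Nl.
  by rewrite leNgt; apply/negP => hq; apply: h; exists l, r, s'.
have [ls' hs'] : path leq 0%N s' /\ e ^+ 2 < partition_sqr p s' (nth 0 (seg l r f)).
  move: hs; rewrite /partition_norm; case: (boolP (path leq 0%N s')) => [ls'|_] h; last first.
    by move: h; rewrite ltNge ltW.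
  split=> //; rewrite ltNge; apply/negP => h'; move: h; rewrite ltNge => /negP; apply.
  by rewrite -(ger0_norm (ltW e0)) -sqrtr_sqr ler_wsqrtr.
have b0 j : (j < last 0%N s)%N -> (seg l r f)`_j = 0.
  move=> jl; rewrite coef_seg; case: ifP => // lj.
  by move: Nl; rewrite geq_max => /andP[h _]; lia.
have [s'' ls'' h] := chain_sqr_restart (fun i j => window_far0 i b0)
  (fun i j => window_bounds i j (fun l' r' => schreier_seg p l' r' (seg l r f))) (leq0n _) ls'.
exists (s ++ s''); first by rewrite cat_path ls.
rewrite /partition_sqr chain_cat lerD2l.
have hq : schreier p (seg l r f) ^+ 2 <= (e / 2) ^+ 2.
  rewrite ler_sqr ?nnegrE ?schreier_ge0 ?(ltW e2) //; apply: hn0.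
  by apply: leq_trans Nl; rewrite leq_maxr.
apply: (@le_trans _ _ (chain (fun i j => window p i j (nth 0 (seg l r f)) ^+ 2) (last 0%N s) s'')).
  rewrite -/(partition_sqr _ _ _) in h; have := ltW hs'; lra.
apply: (ler_chain ls'') => i j _ _ _.
by rewrite ler_sqr; [exact: window_seg|rewrite nnegrE; exact: window_ge0..].
Qed.

Lemma partition_sqr_add n f g (qf qg : R) s :
  (forall i, (n <= i)%N -> f i = 0) -> (forall i, (i < n)%N -> g i = 0) ->
  (forall l r, schreier p (seg l r f) <= qf) -> (forall l r, schreier p (seg l r g) <= qg) ->
  path leq 0%N s ->
  partition_sqr p s (fun i => f i + g i) <= partition_sqr p s f + partition_sqr p s g + qf * qg *+ 2.
Proof.
move=> fn gn fq gq ls.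
apply: (@chain_sqr_add _ n (fun i j => window p i j f) (fun i j => window p i j g)
  (fun i j => window p i j (fun k => f k + g k))).
- by move=> i j jn; apply: eq_window => k /andP[_ kj]; rewrite gn ?addr0 // (leq_trans kj).
- by move=> i j ni; apply: eq_window => k /andP[ik _]; rewrite fn ?add0r // (leq_trans ni).
- by move=> i j; exact: window_bounds.
- by move=> i j; exact: window_bounds.
- by move=> i j; rewrite window_ge0; exact: (seminormD (window_seminorm p i j)).
- exact: ls.
Qed.

(** After the first window that meets the support, every window starts at
    [n] or later and divides by more than [n]. *)
Lemma partition_sqr_far n f s q (S : R) : (forall j, (j < n)%N -> f j = 0) -> path leq 0%N s ->
  (forall l r, schreier p (seg l r f) <= q) -> (forall m, \sum_(0 <= i < m) `|f i| <= S) ->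
  partition_sqr p s f <= q ^+ 2 + (S * (seg_const p * p 1) / n.+1%:R) ^+ 2.
Proof.
move=> fn ls fq fS.
have [s' ns' h] := chain_sqr_restart (fun i j => window_far0 i fn) (fun i j => window_bounds i j fq)
  (leq0n n) ls.
apply: le_trans h _; rewrite lerD2l.
have B0 : 0 <= seg_const p * p 1.
  by apply: le_trans (schreier_Xn p 0); exact: schreier_ge0.
pose w i := `|f i| * (seg_const p * p 1) / n.+1%:R.
have w0 i : 0 <= w i by rewrite /w divr_ge0 // mulr_ge0.
apply: le_trans (chain_sqr_far (w := w) (fun i j => window_ge0 p i j f) w0 ns' _) _.
  move=> i j ni; apply: window_le => [|u iu uj ui]; first exact: sumr_ge0.
  rewrite ler_pdivrMr ?ltr0n //.
  apply: (@le_trans _ _ (\sum_(i <= k < j) `|f k| * (seg_const p * p 1))).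
    apply: le_trans (chain_le_sum iu (fun k m _ => schreier_seg_sum p k m _)) _.
    rewrite [leRHS](@big_cat_nat _ _ _ (last i u)) ?path_leq_last //= lerDl.
    by apply: sumr_ge0 => k _; rewrite mulr_ge0.
  have -> : \sum_(i <= k < j) w k =
      (\sum_(i <= k < j) `|f k| * (seg_const p * p 1)) / n.+1%:R by rewrite mulr_suml.
  rewrite -mulrA ler_peMr; first by [].
    by apply: sumr_ge0 => k _; rewrite mulr_ge0.
  by rewrite mulrC ler_pdivlMr ?ltr0n // mul1r ler_nat ltnS.
have S0 : 0 <= S by have := fS 0%N; rewrite big_geq.
have T0 : 0 <= S * (seg_const p * p 1) / n.+1%:R.
  by apply: divr_ge0; [exact: mulr_ge0|exact: ler0n].
rewrite ler_sqr; [|by rewrite nnegrE sumr_ge0|by rewrite nnegrE].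
have -> : \sum_(n <= k < last n s') w k =
    (\sum_(n <= k < last n s') `|f k|) * (seg_const p * p 1) / n.+1%:R by rewrite !mulr_suml.
rewrite ler_pM2r ?invr_gt0 ?ltr0n // ler_wpM2r //.
apply: le_trans (fS (last n s')).
by rewrite [leRHS](@big_cat_nat _ _ _ n) ?path_leq_last //= lerDr sumr_ge0.
Qed.

End Estimates.

(** * Banach spaces of sequences *)

Lemma nested_limit (R : realType) (u c : nat -> R) :
  (forall m n, `|u m - u n| <= c m + c n) -> exists a, forall m, `|u m - a| <= c m.
Proof.
move=> uc; pose A := range (fun m => u m - c m).
have Aub n : ubound A (u n + c n).
  by move=> _ [m _ <-]; have := uc m n; rewrite ler_norml => /andP[_]; lra.
exists (sup A) => m; rewrite ler_norml; apply/andP; split.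
  have : sup A <= u m + c m; last by move: (sup A) => v; lra.
  by apply: ge_sup => //; exists (u 0%N - c 0%N), 0%N.
have : u m - c m <= sup A; last by move: (sup A) => v; lra.
by apply: ub_le_sup; [exists (u 0%N + c 0%N); exact: Aub|exists m].
Qed.

(** A supremum of seminorms, each involving finitely many coordinates; the
    coordinates are uniformly controlled. *)
Record seqnorm (R : realType) := SeqNorm {
  sn_index : Type ;
  sn_point : sn_index ;
  sn_fun :> sn_index -> (nat -> R^o) -> R ;
  sn_const : R ;
  sn_seminorm : forall i, seminorm (sn_fun i) ;
  sn_local : forall i, exists n C, forall f, sn_fun i f <= C * \sum_(k < n) `|f k| ;
  sn_coord : forall k, exists i, forall f, `|f k| <= sn_const * sn_fun i f }.

Section SequenceSpace.
Context {R : realType} (N : seqnorm R).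

Definition sn_bounded : {pred nat -> R^o} :=
  mem [set f : nat -> R^o | exists M, forall i, N i f <= M].

Record seqspace := SeqSpace { seq_fun :> nat -> R^o ; seq_funP : seq_fun \in sn_bounded }.

HB.instance Definition _ := [isSub for seq_fun].
HB.instance Definition _ := [Choice of seqspace by <:].

Fact sn_bounded_submod_closed : submod_closed sn_bounded.
Proof.
split; first by rewrite inE; exists 0 => i; rewrite (seminorm0 (sn_seminorm i)).
move=> c f g; rewrite !inE => -[M fM] [M' gM]; exists (`|c| * M + M') => i.
apply: le_trans (seminormD (sn_seminorm i) _ _) _; apply: lerD; last exact: gM.
by rewrite (seminormZ (sn_seminorm i)) ler_wpM2l.
Qed.

HB.instance Definition _ := GRing.isSubmodClosed.Build R (nat -> R^o) sn_bounded
  sn_bounded_submod_closed.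
HB.instance Definition _ := [SubChoice_isSubLmodule of seqspace by <:].

Lemma seqspaceE (x : seqspace) : exists M, forall i, N i x <= M.
Proof. by have := seq_funP x; rewrite inE. Qed.

Definition seq_norm (x : seqspace) : R := sup_of (sn_fun (s := N)) (x : nat -> R^o).

Lemma seq_norm_ge i (x : seqspace) : N i x <= seq_norm x.
Proof. by have [M xM] := seqspaceE x; exact: (sup_of_ge i xM). Qed.

Lemma seq_norm_le c (x : seqspace) : (forall i, N i x <= c) -> seq_norm x <= c.
Proof. by move=> h; apply: (sup_of_le (sn_point N)). Qed.

Fact seq_normD x y : seq_norm (x + y) <= seq_norm x + seq_norm y.
Proof.
apply: seq_norm_le => i; apply: le_trans (seminormD (sn_seminorm i) _ _) _.
by apply: lerD; exact: seq_norm_ge.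
Qed.

Fact seq_normZ c x : seq_norm (c *: x) = `|c| * seq_norm x.
Proof.
have hZ d y : seq_norm (d *: y) <= `|d| * seq_norm y.
  apply: seq_norm_le => i; rewrite (seminormZ (sn_seminorm i)).
  by apply: ler_wpM2l => //; exact: seq_norm_ge.
have n0 y : 0 <= seq_norm y.
  by apply: le_trans (seq_norm_ge (sn_point N) y); exact: seminorm_ge0 (sn_seminorm _) _.
apply/eqP; rewrite eq_le hZ /=.
have [->|c0] := eqVneq c 0; first by rewrite normr0 mul0r n0.
rewrite -ler_pdivlMl ?normr_gt0 // -normfV.
by have := hZ c^-1 (c *: x); rewrite scalerA mulVf // scale1r.
Qed.

Lemma sn_const_ge0 : 0 <= sn_const N.
Proof.
have [i h] := sn_coord N 0%N; have := h (fun=> 1); rewrite normr1.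
have := seminorm_ge0 (sn_seminorm i) (fun=> 1); nra.
Qed.

Lemma seq_coord_le k (x : seqspace) : `|(x : nat -> R^o) k| <= sn_const N * seq_norm x.
Proof.
have [i h] := sn_coord N k; apply: le_trans (h x) _.
by apply: ler_wpM2l; [exact: sn_const_ge0|exact: seq_norm_ge].
Qed.

Fact seq_norm_eq0 x : seq_norm x = 0 -> x = 0.
Proof.
move=> x0; apply/val_inj/funext => k /=.
by have := seq_coord_le k x; rewrite x0 mulr0 normr_le0 => /eqP.
Qed.

HB.instance Definition _ :=
  Lmodule_isNormed.Build R seqspace seq_normD seq_normZ seq_norm_eq0.

Lemma norm_seq_le (c : R) (x : seqspace) : (forall i, N i x <= c) -> `|x| <= c.
Proof. exact: seq_norm_le. Qed.

Lemma norm_seq_ge i (x : seqspace) : N i x <= `|x|.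
Proof. exact: seq_norm_ge. Qed.

Lemma norm_seq_coord k (x : seqspace) : `|(x : nat -> R^o) k| <= sn_const N * `|x|.
Proof. exact: seq_coord_le. Qed.

(** The coordinates converge, and estimates on a seminorm that involves only
    finitely many of them pass to the limit. *)
Lemma seqspace_limit (x : nat -> seqspace) :
  (forall m n, `|x m - x n| <= m.+1%:R^-1 + n.+1%:R^-1) ->
  exists a : seqspace, forall m, `|x m - a| <= m.+1%:R^-1.
Proof.
move=> xC; set c := sn_const N; have c0 : 0 <= c := sn_const_ge0.
pose xf m : nat -> R^o := x m.
have coord k m n : `|xf m k - xf n k| <= c * (m.+1%:R^-1 + n.+1%:R^-1).
  by apply: le_trans (norm_seq_coord k (x m - x n)) _; rewrite ler_wpM2l.
have lim k : exists ak, forall m, `|xf m k - ak| <= c * m.+1%:R^-1.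
  apply: (@nested_limit _ (fun m => xf m k) (fun m => c * m.+1%:R^-1)) => m n.
  by rewrite -mulrDr; exact: coord.
have [a' aP] := choice lim; pose a : nat -> R^o := a'.
have key i m : N i (xf m - a) <= m.+1%:R^-1.
  have [n [C hC]] := sn_local i.
  have C0 : 0 <= 1 + `|C| by rewrite addr_ge0.
  apply: (@le_of_inv_nat _ _ _ (1 + (1 + `|C|) * (n%:R * c))) => M M0.
  have -> : xf m - a = (xf m - xf M.-1) + (xf M.-1 - a) by rewrite addrA subrK.
  apply: le_trans (seminormD (sn_seminorm i) _ _) _.
  have h1 : N i (xf m - xf M.-1) <= m.+1%:R^-1 + M%:R^-1.
    by apply: le_trans (norm_seq_ge i (x m - x M.-1)) _; have := xC m M.-1; rewrite prednK.
  have h2 : N i (xf M.-1 - a) <= (1 + `|C|) * (n%:R * (c * M%:R^-1)).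
    have hs : \sum_(k < n) `|(xf M.-1 - a) k| <= n%:R * (c * M%:R^-1).
      rewrite -[n in n%:R]card_ord -[X in X%:R]/(#|'I_n|) mulr_natl -sumr_const.
      by apply: ler_sum => k _; have := aP k M.-1; rewrite prednK.
    apply: le_trans (hC _) _; apply: le_trans (_ : _ <= (1 + `|C|) * _) _; last first.
      by apply: ler_wpM2l hs.
    rewrite ler_wpM2r ?sumr_ge0 //; have := ler_norm C; lra.
  by rewrite mulrDl mul1r; apply: le_trans (lerD h1 h2) _; rewrite !mulrA addrA.
have aB : a \in sn_bounded.
  rewrite inE; exists (`|x 0%N| + 1) => i.
  rewrite -[a](subKr (xf 0%N)); apply: le_trans (seminormB (sn_seminorm i) _ _) _.
  apply: lerD; first exact: norm_seq_ge.
  by have := key i 0%N; rewrite invr1.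
exists (SeqSpace aB) => m; apply: norm_seq_le => i; exact: key.
Qed.

Fact seqspace_complete (F : set_system seqspace) : ProperFilter F -> cauchy F -> cvg F.
Proof.
move=> FF /cauchyP Fc.
have e0 m : 0 < m.+1%:R^-1 :> R by rewrite invr_gt0 ltr0n.
have [x xP] := choice (fun m => Fc _ (e0 m)).
have xC m n : `|x m - x n| <= m.+1%:R^-1 + n.+1%:R^-1.
  have [y [ym yn]] := filter_ex (filterI (xP m) (xP n)).
  move: ym yn; rewrite -!ball_normE /= => ym yn.
  have -> : x m - x n = (x m - y) - (x n - y) by rewrite opprB addrA subrK.
  by apply: le_trans (ler_normB _ _) _; rewrite lerD // ltW.
have [a aP] := seqspace_limit xC.
apply/cvg_ex; exists a; apply/fcvgrPdist_lt => e eg0.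
have [m hm] : exists m : nat, m.+1%:R^-1 < e / 2.
  have e2 : 0 < e / 2 by rewrite divr_gt0.
  exists (Num.bound (e / 2)^-1); rewrite invf_plt ?posrE //.
  have := archi_boundP (ltW (_ : 0 < (e / 2)^-1)); rewrite invr_gt0 => /(_ e2) h.
  by apply: lt_le_trans h _; rewrite ler_nat.
apply: filterS (xP m) => y; rewrite -ball_normE /= => ym.
have -> : a - y = (x m - y) - (x m - a) by rewrite opprB [RHS]addrC addrA subrK.
apply: le_lt_trans (ler_normB _ _) _.
move: ym (aP m) hm; move: (_^-1) => u; move: `|_| `|_| => v w; lra.
Qed.

HB.instance Definition _ := Uniform_isComplete.Build seqspace seqspace_complete.

End SequenceSpace.

(** * Norming functionals and duals *)

Section HahnBanach.
Context {R : realType} {V : lmodType R}.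
Implicit Types (h : V -> R) (v y z : V).

Definition sublinear h :=
  (forall y z, h (y + z) <= h y + h z) /\ (forall t y, 0 <= t -> h (t *: y) = t * h y).

Lemma sublinear0 h : sublinear h -> h 0 = 0.
Proof. by move=> [_ hZ]; rewrite -(scale0r 0) hZ // mul0r. Qed.

Lemma sublinearN_le h y : sublinear h -> - h y <= h (- y).
Proof. by move=> hs; have := hs.1 y (- y); rewrite subrr (sublinear0 hs); lra. Qed.

(** A sublinear minorant of [h] that is odd along [v] and keeps the value at
    [v]. *)
Definition oddify h v y : R := inf [set h (y + t *: v) - t * h v | t in [set t | 0 <= t]].

Lemma oddify_has_inf h v y : sublinear h ->
  has_inf [set h (y + t *: v) - t * h v | t in [set t | 0 <= t]].
Proof.
move=> hs; split; first by exists (h (y + 0 *: v) - 0 * h v), 0 => /=.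
exists (- h (- y)) => _ [t /= t0 <-].
have := hs.1 (y + t *: v) (- y); rewrite addrAC subrr add0r hs.2 //; lra.
Qed.

Lemma oddify_le h v y t : sublinear h -> 0 <= t -> oddify h v y <= h (y + t *: v) - t * h v.
Proof. by move=> hs t0; apply: ge_inf; [case: (oddify_has_inf v y hs)|exists t]. Qed.

Lemma oddify_ge h v y c : sublinear h ->
  (forall t, 0 <= t -> c <= h (y + t *: v) - t * h v) -> c <= oddify h v y.
Proof.
by move=> hs hc; apply: lb_le_inf; [case: (oddify_has_inf v y hs)|move=> _ [t /hc ? <-]].
Qed.

Lemma oddify_le_self h v y : sublinear h -> oddify h v y <= h y.
Proof.
by move=> hs; have := oddify_le v y hs (lexx 0); rewrite scale0r addr0 mul0r subr0.
Qed.

Lemma oddifyN h v : sublinear h -> oddify h v (- v) <= - h v.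
Proof.
move=> hs; have := oddify_le v (- v) hs ler01.
by rewrite scale1r addNr (sublinear0 hs) mul1r add0r.
Qed.

Lemma oddify_sublinear h v : sublinear h -> sublinear (oddify h v).
Proof.
move=> hs; have hZ t y : 0 < t -> oddify h v (t *: y) <= t * oddify h v y.
  move=> t0; rewrite -ler_pdivrMl //; apply: oddify_ge => // u u0.
  have := oddify_le v (t *: y) hs (mulr_ge0 (ltW t0) u0).
  rewrite -scalerA -scalerDr hs.2 ?(ltW t0) // -mulrA -mulrBr => h1.
  by rewrite ler_pdivrMl.
split=> [y z|t y].
  rewrite -lerBlDl; apply: oddify_ge => // t t0.
  rewrite lerBlDl -lerBlDr; apply: oddify_ge => // u u0; rewrite lerBlDr.
  apply: le_trans (oddify_le v (y + z) hs (addr_ge0 u0 t0)) _.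
  rewrite scalerDl addrACA mulrDl; have := hs.1 (y + u *: v) (z + t *: v); lra.
rewrite le_eqVlt => /predU1P[<-|t0].
  rewrite scale0r mul0r; apply/eqP; rewrite eq_le; apply/andP; split.
    by apply: le_trans (oddify_le_self _ _ hs) _; rewrite (sublinear0 hs).
  by apply: oddify_ge => // u u0; rewrite add0r hs.2 // subrr.
apply/eqP; rewrite eq_le hZ //= -ler_pdivlMl //.
have := hZ t^-1 (t *: y); rewrite invr_gt0 => /(_ t0).
by rewrite scalerA mulVf ?gt_eqF // scale1r.
Qed.

Lemma sublinear_odd_span (h : V -> R) (v : nat -> V) n (a : nat -> R) : sublinear h ->
  (forall i, (i < n)%N -> h (- v i) <= - h (v i)) ->
  h (\sum_(i < n) a i *: v i) <= \sum_(i < n) a i * h (v i).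
Proof.
move=> hs; elim: n => [|n IH] hn; first by rewrite !big_ord0 (sublinear0 hs).
rewrite !big_ord_recr /=; apply: le_trans (hs.1 _ _) _; apply: lerD.
  by apply: IH => i /ltnW; exact: hn.
have [a0|a0] := leP 0 (a n); first by rewrite hs.2.
have a0' : 0 <= - a n by rewrite oppr_ge0 ltW.
have -> : a n *: v n = (- a n) *: (- v n) by rewrite scalerN scaleNr opprK.
rewrite hs.2 //; have -> : a n * h (v n) = (- a n) * - h (v n) by rewrite mulrNN.
by apply: ler_wpM2l => //; exact: hn.
Qed.

(** A finite-dimensional Hahn-Banach argument: making [N] odd along the vector
    to be normed and then along each spanning vector only lowers it, and leaves
    it linear on the span. *)
Lemma norming_coefficients (N : V -> R) (v : nat -> V) n (x : nat -> R) : seminorm N ->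
  exists h : nat -> R,
    (forall a : nat -> R, `|\sum_(i < n) a i * h i| <= N (\sum_(i < n) a i *: v i)) /\
    N (\sum_(i < n) x i *: v i) = \sum_(i < n) x i * h i.
Proof.
move=> Ns; set vx := \sum_(i < n) x i *: v i.
have Nsub : sublinear N.
  split; [exact: (seminormD Ns)|move=> t y t0].
  by rewrite (seminormZ Ns) ger0_norm.
have [h [hs hN hx hv]] : exists h, [/\ sublinear h, (forall y, h y <= N y),
    h (- vx) <= - N vx & forall i, (i < n)%N -> h (- v i) <= - h (v i)].
  elim: n {x} vx => [|m IH] vx.
    exists (oddify N vx); split=> //; first exact: oddify_sublinear.
      by move=> y; exact: oddify_le_self.
    exact: oddifyN.
  have [h [hs hN hx hv]] := IH vx; exists (oddify h (v m)).
  have le_h y : oddify h (v m) y <= h y by exact: oddify_le_self.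
  split=> [|y||i]; first exact: oddify_sublinear.
  - exact: le_trans (le_h y) (hN y).
  - exact: le_trans (le_h _) hx.
  rewrite ltnS leq_eqVlt => /predU1P[->|/hv hi].
    by apply: le_trans (oddifyN _ hs) _; rewrite lerN2.
  by apply: le_trans (le_h _) (le_trans hi _); rewrite lerN2.
have up (a : nat -> R) : \sum_(i < n) a i * h (v i) <= N (\sum_(i < n) a i *: v i).
  have := sublinear_odd_span (fun i => - a i) hs hv.
  under eq_bigr do rewrite scaleNr; under [in leRHS]eq_bigr do rewrite mulNr.
  rewrite !sumrN => h1; have := sublinearN_le (\sum_(i < n) a i *: v i) hs.
  have := hN (\sum_(i < n) a i *: v i); lra.
exists (h \o v); split=> [a|].
  rewrite ler_norml; apply/andP; split; last exact: up.
  have := up (fun i => - a i).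
  under eq_bigr do rewrite mulNr; under [in leRHS]eq_bigr do rewrite scaleNr.
  rewrite !sumrN (seminormN Ns) /=; lra.
apply/eqP; rewrite eq_le up andbT.
apply: le_trans (sublinear_odd_span x hs hv); rewrite -/vx.
have := sublinearN_le (- vx) hs; rewrite opprK; lra.
Qed.

End HahnBanach.

Section DualTools.
Context {R : realType} (X : normedModType R).

Lemma functionalI (f : X -> R^o) M : linear f -> (forall y, `|f y| <= M * `|y|) ->
  f \in functional X.
Proof.
move=> lf fM; rewrite inE; split=> // y; apply/cvgrPdist_le => e e0.
have M0 : 0 < 1 + `|M| by rewrite ltr_pwDl.
near=> z.
have fB : f y - f z = f (y - z).
  have := lf (-1) z y; rewrite !scaleN1r (addrC (- z)) (addrC (- f z)) => ->; by [].
rewrite fB; apply: le_trans (fM _) _.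
apply: (@le_trans _ _ ((1 + `|M|) * `|y - z|)).
  by rewrite ler_wpM2r //; have := ler_norm M; lra.
rewrite -ler_pdivlMl //; near: z.
by apply: cvgr_dist_le => //; rewrite mulr_gt0 // invr_gt0.
Unshelve. all: by end_near. Qed.

Lemma dual_exists (f : X -> R^o) M : linear f -> (forall y, `|f y| <= M * `|y|) ->
  exists d : dual X, (forall y, d y = f y) /\ (0 <= M -> `|d| <= M).
Proof.
move=> lf fM; exists (Dual (functionalI lf fM)); split=> // M0.
apply: opnorm_le => y y1; apply: le_trans (fM y) _.
by rewrite ler_piMr.
Qed.

Lemma dual_le (f : dual X) (y : X) : `|f y| <= `|f| * `|y|.
Proof. exact: opnormP. Qed.

Lemma dual_addE (f g : dual X) (y : X) : (f + g) y = f y + g y. Proof. by []. Qed.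
Lemma dual_scaleE (c : R) (f : dual X) (y : X) : (c *: f) y = c * f y. Proof. by []. Qed.
Lemma dual_oppE (f : dual X) (y : X) : (- f) y = - f y. Proof. by []. Qed.

End DualTools.

(** * Far blocks are weakly null *)

Section Space.
Context {R : realType} (p : spreading_datum R).
Implicit Types (a b : {poly R}) (F s : seq nat).

Fact partition_norm_coord k : exists s, forall f : nat -> R^o, `|f k| <= (p 1)^-1 * partition_norm p s f.
Proof.
exists [:: k.+1] => f; rewrite ler_pdivlMl ?d_gt0 // mulrC.
apply: le_trans (schreier_partition_norm p k.+1 f); apply: schreier_coef; lia.
Qed.

Fact partition_norm_local s : exists n C, forall f : nat -> R^o, partition_norm p s f <= C * \sum_(k < n) `|f k|.
Proof.
exists (last 0%N s), (seg_const p * p 1) => f; apply: le_trans (partition_norm_sum p s f) _.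
by rewrite -mulr_suml big_mkord mulrC.
Qed.

Definition space_norm : seqnorm R :=
  SeqNorm [::] (partition_norm_seminorm p) partition_norm_local partition_norm_coord.

Definition space := seqspace space_norm.
Implicit Types x y : space.

Lemma partition_norm_le_norm s y : partition_norm p s y <= `|y|.
Proof. exact: (norm_seq_ge (N := space_norm) s y). Qed.

Lemma norm_le_partition_norm (c : R) y : (forall s, partition_norm p s y <= c) -> `|y| <= c.
Proof. exact: (@norm_seq_le _ space_norm c y). Qed.

Lemma mem_space (f : nat -> R^o) : norm_bounded p f -> f \in sn_bounded space_norm.
Proof. by rewrite inE. Qed.

Lemma space_bounded y : norm_bounded p y.
Proof. by exists `|y| => s; exact: partition_norm_le_norm. Qed.

Fact poly_bounded a : norm_bounded p (nth 0 a).
Proof.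
have B0 : 0 <= seg_const p * p 1 by apply: le_trans (schreier_Xn p 0); exact: schreier_ge0.
exists (\sum_(i < size a) `|a`_i| * (seg_const p * p 1)) => s.
apply: le_trans (partition_norm_sum p s _) _; pose m := maxn (size a) (last 0%N s).
have -> : \sum_(i < size a) `|a`_i| * (seg_const p * p 1) = \sum_(0 <= i < m) `|a`_i| * (seg_const p * p 1).
  rewrite [RHS](@big_cat_nat _ _ _ (size a)) ?leq_maxl //= big_mkord [X in _ = _ + X]big_nat.
  by rewrite [X in _ = _ + X]big1 ?addr0 // => i /andP[h _]; rewrite nth_default ?normr0 ?mul0r.
rewrite [leRHS](@big_cat_nat _ _ _ (last 0%N s)) ?leq_maxr //= lerDl.
by apply: sumr_ge0 => i _; rewrite mulr_ge0.
Qed.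

Definition ofpoly a : space := SeqSpace (mem_space (poly_bounded a)).

Lemma ofpolyE a k : ofpoly a k = a`_k. Proof. by []. Qed.

Fact ofpoly_linear : linear ofpoly.
Proof. by move=> c a b; apply/val_inj/funext => k; rewrite /= coefD coefZ. Qed.

HB.instance Definition _ := GRing.isLinear.Build R {poly R} space *:%R ofpoly ofpoly_linear.

Lemma norm_ofseg l r y : `|ofpoly (seg l r y)| <= `|y|.
Proof. by apply: norm_le_partition_norm => s; apply: le_trans (partition_norm_seg _ _ _ _ _) (partition_norm_le_norm _ _). Qed.

Lemma schreier_le_norm l r y : schreier p (seg l r y) <= `|y|.
Proof.
apply: le_trans (partition_norm_le_norm [:: r] y); apply: le_trans (schreier_partition_norm p r y).
by apply: schreier_segf.
Qed.

Lemma schreier_le_ofpoly a : schreier p a <= `|ofpoly a|.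
Proof. by have := schreier_le_norm 0 (size a) (ofpoly a); rewrite seg_all. Qed.

Lemma norm_ofXn n : `|ofpoly 'X^n| <= seg_const p * p 1.
Proof.
have B0 : 0 <= seg_const p * p 1 by apply: le_trans (schreier_Xn p 0); exact: schreier_ge0.
apply: norm_le_partition_norm => s; apply: le_trans (partition_norm_sum p s (nth 0 'X^n)) _; rewrite -mulr_suml.
apply: ler_piMl => //; case: (ltnP n (last 0%N s)) => ns.
  rewrite (bigD1_seq n) ?mem_index_iota ?iota_uniq //= coefXn eqxx normr1.
  by rewrite big1 ?addr0 // => i /negbTE ni; rewrite coefXn ni normr0.
rewrite big_nat big1 // => i /andP[_ ins]; rewrite coefXn.
by case: eqP => [ni|_]; [move: ins; rewrite ni ltnNge ns|rewrite normr0].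
Qed.

Lemma seg_tail y e : 0 < e -> exists n, forall m, (n <= m)%N -> `|y - ofpoly (seg 0 m y)| <= e.
Proof.
move=> e0; have [n hn] := partition_norm_tail (space_bounded y) e0.
exists n => m nm; apply: norm_le_partition_norm => s.
rewrite (@eq_partition_norm _ p s _ (nth 0 (seg m (maxn m (last 0%N s)) y))); first exact: hn.
move=> i il; rewrite coef_seg leq_max il orbT andbT.
have -> : (y - ofpoly (seg 0 m y)) i = y i - (seg 0 m y)`_i by [].
by rewrite coef_seg /=; case: (ltnP i m) => im; rewrite ?subrr ?subr0.
Qed.

End Space.

(** The units counted in [spread_out] are indicators that can only switch on. *)
Lemma add_bools_leq (a b c a' b' c' : bool) : (a -> a') -> (b -> b') -> (c -> c') ->
  (a + b + c <= a' + b' + c')%N /\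
  [|| a' && ~~ a, b' && ~~ b | c' && ~~ c] = (a + b + c < a' + b' + c')%N.
Proof.
by case: a; case: a' => //; case: b; case: b' => //; case: c; case: c' => // h1 h2 h3;
  solve [by have := h1 isT|by have := h2 isT|by have := h3 isT].
Qed.

Lemma range_widen (n N N' j : nat) : (N <= N')%N -> (n <= j < N)%N -> (n <= j < N')%N.
Proof. by move=> NN /andP[-> jN]; exact: leq_trans NN. Qed.

Lemma range_split (n N N' j : nat) : (n <= N)%N -> (N <= j < N')%N ->
  (n <= j < N')%N && ~~ (n <= j < N)%N.
Proof. lia. Qed.

Lemma add_step (R : realType) (u v d : R) (A A' m : nat) : 0 <= d ->
  u <= A%:R + m%:R * d -> v <= 1 -> (A < A')%N -> u + v <= A'%:R + m.+1%:R * d.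
Proof. by rewrite -(ler_nat R) -!natr1 => d0 h1 h2 h3; lra. Qed.

Lemma add_step_small (R : realType) (u v d : R) (A A' m : nat) :
  u <= A%:R + m%:R * d -> v <= d -> (A <= A')%N -> u + v <= A'%:R + m.+1%:R * d.
Proof. by rewrite -(ler_nat R) -!natr1 => h1 h2 h3; lra. Qed.

Lemma le_two_step (R : realType) (m : nat) : 2 * m%:R + 1 + 1 <= 2 * m.+1%:R :> R.
Proof. by have -> : m.+1%:R = m%:R + 1 :> R; [rewrite natr1|lra]. Qed.

Section WeaklyNull.
Context {R : realType} (p : spreading_datum R) (g : {poly R} -> R) (M : R).
Implicit Types (a b : {poly R}) (F s : seq nat).
Hypotheses (gD : forall a b, g (a + b) = g a + g b) (gZ : forall c a, g (c *: a) = c * g a).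
Hypothesis gM : forall a, `|g a| <= M * `|ofpoly p a|.
Variable e : R.
Hypothesis e_gt0 : 0 < e.

Let g0 : g 0 = 0.
Proof. by have := gZ 0 0; rewrite scale0r mul0r. Qed.

Let supported n N a := forall i, ~~ (n <= i < N)%N -> a`_i = 0.
Let balanced a := summing p -> a.[1] = 0.

Let supportedD n N N' a b : (n <= N)%N -> (N <= N')%N ->
  supported n N a -> supported N N' b -> supported n N' (a + b).
Proof. by move=> nN NN ha hb i hi; rewrite coefD ha ?hb ?addr0 //; lia. Qed.

Let balancedD a b : balanced a -> balanced b -> balanced (a + b).
Proof. by move=> ha hb hs; rewrite hornerD ha ?hb ?addr0. Qed.

Let balancedZ c a : balanced a -> balanced (c *: a).
Proof. by move=> ha hs; rewrite hornerZ ha ?mulr0. Qed.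

Let supportedZ n N c a : supported n N a -> supported n N (c *: a).
Proof. by move=> ha i hi; rewrite coefZ ha ?mulr0. Qed.

Let quot_norm_gap n N a F : supported n N a -> balanced a ->
  ~~ has (fun i => (n <= i < N)%N) F -> quot_norm p F a = 0.
Proof.
move=> ha hb hF; apply: quot_norm_null; apply: (null_gap (l := n) (r := N)) => // i hi.
by apply: contra hF => iF; apply/hasP; exists i.
Qed.

Let seg_block n N a l r : supported n N a -> ~~ (n <= l < N)%N -> ~~ (n <= r < N)%N ->
  seg l r (nth 0 a) = a \/ seg l r (nth 0 a) = 0.
Proof.
move=> aN hl hr; have [lrN|lrN] := boolP ((l <= n) && (N <= r))%N; [left|right]; apply/polyP => i;
  rewrite coef_seg ?coef0; case: ifP => // h.
  by rewrite aN //; move: h lrN; clear; lia.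
by rewrite aN //; move: h lrN hl hr; clear; lia.
Qed.

Let norm_scale_le c a (m : R) : 0 <= c -> `|ofpoly p a| <= m -> `|ofpoly p (c *: a)| <= c * m.
Proof. by move=> c0 am; rewrite linearZ normrZ (ger0_norm c0) ler_wpM2l. Qed.

Hypothesis far : forall n, exists a, [/\ (forall i, (i < n)%N -> a`_i = 0), balanced a,
  `|ofpoly p a| <= 1 & e <= g a].

Let far_supported n : exists a N, [/\ (n <= N)%N, supported n N a, balanced a,
  `|ofpoly p a| <= 1 & e <= g a].
Proof.
have [a [an ab a1 ea]] := far n; exists a, (maxn n (size a)); split=> //; first exact: leq_maxl.
move=> i; case: (ltnP i n) => [/an//|ni] /=; rewrite -leqNgt geq_max => /andP[_].
exact: nth_default.
Qed.

(** Blocks that [F] does not meet are null for [F]. *)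
Let average_sum n m : exists a N, [/\ (n <= N)%N, supported n N a & balanced a] /\
  [/\ `|ofpoly p a| <= m%:R, m%:R * e <= g a &
      forall F, adm F -> quot_norm p F a <= (count (fun i => (n <= i < N)%N) F)%:R].
Proof.
elim: m => [|m [a [N [[nN aN ab] [am ga qa]]]]].
  exists 0, n; split; first by split=> // [i _|_]; rewrite ?coef0 ?horner0.
  split; rewrite ?linear0 ?normr0 //.
    by rewrite mul0r g0.
  by move=> F _; rewrite (seminorm0 (quot_norm_seminorm p F)).
have [b [N' [NN' bN' bb b1 gb]]] := far_supported N.
exists (a + b), N'; split; first split.
- exact: leq_trans NN'.
- exact: (supportedD nN NN').
- exact: balancedD.
split=> [||F aF].
- rewrite linearD; apply: le_trans (ler_normD _ _) _; rewrite -natr1; exact: lerD.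
- rewrite gD -natr1 mulrDl mul1r; exact: lerD.
apply: le_trans (seminormD (quot_norm_seminorm p F) _ _) _.
have -> : count (fun i => (n <= i < N')%N) F =
    (count (fun i => (n <= i < N)%N) F + count (fun i => (N <= i < N')%N) F)%N.
  rewrite -count_predUI -[LHS]addn0; congr addn; last first.
    by apply/esym/eqP; rewrite -leqn0 leqNgt -has_count; apply/hasPn => i _ /=; lia.
  by apply: eq_count => i /=; lia.
rewrite natrD; apply: lerD; first exact: qa.
case: (boolP (has (fun i => (N <= i < N')%N) F)) => hF.
  apply: le_trans (_ : _ <= 1) _; last by rewrite ler1n -has_count.
  exact: le_trans (schreier_quot _ _ aF) (le_trans (schreier_le_ofpoly _ _) b1).
by rewrite (quot_norm_gap bN' bb hF).
Qed.

Let average n k d : 0 < d -> exists a N, [/\ (n <= N)%N, supported n N a & balanced a] /\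
  [/\ `|ofpoly p a| <= 1, e <= g a &
      forall F, adm F -> (size F <= k)%N -> quot_norm p F a <= d].
Proof.
move=> d0.
pose m := (Num.bound (k%:R / d)).+1.
have m0 : 0 < m%:R :> R by rewrite ltr0n.
have km : k%:R / m%:R <= d.
  rewrite ler_pdivrMr // mulrC -ler_pdivrMr //; apply: ltW.
  have := archi_boundP (divr_ge0 (ler0n R k) (ltW d0)) => h.
  by apply: lt_le_trans h _; rewrite ler_nat.
have [a [N [[nN aN ab] [am ga qa]]]] := average_sum n m.
exists (m%:R^-1 *: a), N; split; first by split=> //; [exact: supportedZ|exact: balancedZ].
have mi0 : 0 <= m%:R^-1 :> R by rewrite invr_ge0 ltW.
split.
- by have := norm_scale_le mi0 am; rewrite mulVf ?gt_eqF.
- by rewrite gZ ler_pdivlMl.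
move=> F aF Fk; rewrite (seminormZ (quot_norm_seminorm p F)) ger0_norm //.
apply: le_trans km; rewrite mulrC ler_pM2r ?invr_gt0 //.
by apply: le_trans (qa F aF) _; rewrite ler_nat (leq_trans (count_size _ _)).
Qed.

(** Each block is a mean that no admissible set of the size allowed by the
    previous blocks can see. Once [F] meets a block its size is bounded in terms
    of this block, so only the first block that it meets contributes; the blocks
    containing an end of the interval contribute one unit each. *)
Let spread_out n d m : 0 < d -> exists a N, [/\ (n <= N)%N, supported n N a & balanced a] /\
  [/\ `|ofpoly p a| <= m%:R, m%:R * e <= g a &
      forall F l r, adm F -> quot_norm p F (seg l r (nth 0 a)) <=
        ((n <= l < N)%N + (n <= r < N)%N + has (fun i => (n <= i < N)%N) F)%:R + m%:R * d].
Proof.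
move=> d0; elim: m => [|m [a [N [[nN aN ab] [am ga qa]]]]].
  exists 0, n; split; first by split=> // [i _|_]; rewrite ?coef0 ?horner0.
  split; rewrite ?linear0 ?normr0 //.
    by rewrite mul0r g0.
  move=> F l r _; rewrite seg_eq0; last by move=> i _; rewrite coef0.
  by rewrite (seminorm0 (quot_norm_seminorm p F)) addr_ge0 // mul0r.
have [b [N' [[NN' bN' bb] [b1 gb qb]]]] := average N N d0.
exists (a + b), N'; split; first split.
- exact: leq_trans NN'.
- exact: (supportedD nN NN').
- exact: balancedD.
split=> [||F l r aF].
- rewrite linearD; apply: le_trans (ler_normD _ _) _; rewrite -natr1; exact: lerD.
- rewrite gD -natr1 mulrDl mul1r; exact: lerD.
rewrite segD; apply: le_trans (seminormD (quot_norm_seminorm p F) _ _) _.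
have qb1 : quot_norm p F (seg l r (nth 0 b)) <= 1.
  exact: le_trans (schreier_ge _ _ _ _ aF) (le_trans (schreier_le_ofpoly _ _) b1).
have hmono : has (fun i => (n <= i < N)%N) F -> has (fun i => (n <= i < N')%N) F.
  by apply: sub_has => i; exact: range_widen.
have [AA' ltAA'] := add_bools_leq (@range_widen n N N' l NN') (@range_widen n N N' r NN') hmono.
have caseA := add_step (ltW d0) (qa F l r aF) qb1.
have caseB h := add_step_small (qa F l r aF) h AA'.
have [lN|lN] := boolP (N <= l < N')%N.
  by apply: caseA; rewrite -ltAA' (range_split nN lN).
have [rN|rN] := boolP (N <= r < N')%N.
  by apply: caseA; rewrite -ltAA' (range_split nN rN) orbT.
have segb := seg_block bN' lN rN.
case: segb => [sb|sb]; last first.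
  by apply: caseB; rewrite sb (seminorm0 (quot_norm_seminorm p F)) ltW.
have [hF|hF] := boolP (has (fun i => (N <= i < N')%N) F); last first.
  by apply: caseB; rewrite sb (quot_norm_gap bN' bb hF) ltW.
have [hF'|hF'] := boolP (has (fun i => (n <= i < N)%N) F).
  apply: caseB; rewrite sb; apply: qb => //.
  case/hasP: hF' => i iF /andP[_ iN]; apply: leq_trans iN.
  by move/allP: aF => /(_ i iF).
apply: caseA; rewrite -ltAA' hF' andbT.
suff -> : has (fun i => (n <= i < N')%N) F by rewrite !orbT.
by apply: sub_has hF => i /andP[Ni ->]; rewrite (leq_trans nN Ni).
Qed.

Let small_q n d : 0 < d -> exists a N, [/\ (n <= N)%N, supported n N a & balanced a] /\
  [/\ `|ofpoly p a| <= 1, e <= g a & schreier p a <= d].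
Proof.
move=> d0; pose m := (Num.bound (4%:R / d)).+1.
have m0 : 0 < m%:R :> R by rewrite ltr0n.
(* 3 units from [spread_out], and one for its error term [m] times [1 / m] *)
have dm : 4%:R / m%:R <= d.
  rewrite ler_pdivrMr // mulrC -ler_pdivrMr //; apply: ltW.
  have := archi_boundP (divr_ge0 (ler0n R 4) (ltW d0)) => h.
  by apply: lt_le_trans h _; rewrite ler_nat.
have mi0 : 0 <= m%:R^-1 :> R by rewrite invr_ge0 ltW.
have mi1 : 0 < m%:R^-1 :> R by rewrite invr_gt0.
have [a [N [[nN aN ab] [am ga qa]]]] := spread_out n m mi1.
exists (m%:R^-1 *: a), N; split; first by split=> //; [exact: supportedZ|exact: balancedZ].
split.
- by have := norm_scale_le mi0 am; rewrite mulVf ?gt_eqF.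
- by rewrite gZ ler_pdivlMl.
apply: schreier_le => [|F l r aF]; first exact: ltW.
rewrite segZ (seminormZ (quot_norm_seminorm p F)) ger0_norm //.
apply: le_trans dm; rewrite mulrC ler_pM2r //.
apply: le_trans (qa F l r aF) _; rewrite mulfV ?gt_eqF // natr1 ler_nat.
by case: (n <= l < N)%N; case: (n <= r < N)%N; case: (has _ _).
Qed.

(** With small Schreier norms the cross terms disappear and the squares of the
    norms add up. *)
Let square_sum (m0 m : nat) : (m <= m0)%N -> exists a N, [/\ supported 0 N a & balanced a] /\
  [/\ `|ofpoly p a| <= m%:R, m%:R * e <= g a &
      forall s, path leq 0%N s -> partition_sqr p s (nth 0 a) <= 2 * m%:R].
Proof.
elim: m => [|m IH] mm.
  exists 0, 0%N; split; first by split=> // [i _|_]; rewrite ?coef0 ?horner0.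
  split; rewrite ?linear0 ?normr0 //.
    by rewrite mul0r g0.
  move=> s ls; rewrite mulr0; have := @partition_sqr_partition_norm _ p s (nth 0 (0 : {poly R})) 0 ls.
  rewrite expr0n /=; apply; apply: le_trans (partition_norm_le_norm s (ofpoly p 0)) _.
  by rewrite linear0 normr0.
have [a [N [[aN ab] [am ga sa]]]] := IH (ltnW mm).
(* small enough for the cross term [2 * m * d] to be at most 1 *)
have d0 : 0 < (2 * m0.+1%:R)^-1 :> R by rewrite invr_gt0 mulr_gt0 ?ltr0n.
have [b [N' [[NN' bN' bb] [b1 gb qb]]]] := small_q N d0.
exists (a + b), N'; split; first split.
- exact: (supportedD (leq0n N) NN').
- exact: balancedD.
split.
- rewrite linearD; apply: le_trans (ler_normD _ _) _; rewrite -natr1; exact: lerD.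
- rewrite gD -natr1 mulrDl mul1r; exact: lerD.
move=> s ls.
have ha i : (N <= i)%N -> a`_i = 0 by move=> Ni; apply: aN; rewrite ltnNge Ni.
have hb i : (i < N)%N -> b`_i = 0 by move=> iN; apply: bN'; rewrite leqNgt iN.
have qa l r : schreier p (seg l r (nth 0 a)) <= m%:R.
  exact: le_trans (schreier_seg _ _ _ _) (le_trans (schreier_le_ofpoly _ _) am).
have qb' l r : schreier p (seg l r (nth 0 b)) <= (2 * m0.+1%:R)^-1.
  exact: le_trans (schreier_seg _ _ _ _) qb.
have hab := partition_sqr_add ha hb qa qb' ls.
have <- : (fun i => a`_i + b`_i) = nth 0 (a + b) by apply: funext => i; rewrite coefD.
have sb : partition_sqr p s (nth 0 b) <= 1.
  rewrite -[leRHS](expr1n _ 2); apply: partition_sqr_partition_norm => //.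
  exact: le_trans (partition_norm_le_norm s (ofpoly p b)) b1.
have h1 : m%:R * (2 * m0.+1%:R)^-1 *+ 2 <= 1 :> R.
  rewrite -mulr_natr -mulrA invfM mulrAC mulVf ?pnatr_eq0 // mul1r.
  by rewrite ler_pdivrMr ?ltr0n // mul1r ler_nat (leq_trans (leqnSn _)) // (leq_trans mm).
apply: le_trans hab _; apply: le_trans (lerD (lerD (sa s ls) sb) h1) _.
exact: le_two_step.
Qed.

(** The mean of [m] of the blocks of [square_sum] has norm of order the inverse
    of the square root of [m], while [g] stays above [e] on it. *)
Lemma no_far_blocks : False.
Proof.
pose m := (Num.bound (2 * M ^+ 2 / e ^+ 2)).+1.
have m0 : 0 < m%:R :> R by rewrite ltr0n.
have [a [N [[aN ab] [am ga sa]]]] := square_sum (leqnn m).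
have na : `|ofpoly p a| <= Num.sqrt (2 * m%:R).
  apply: norm_le_partition_norm => s; apply: partition_norm_le => [|ls]; first exact: sqrtr_ge0.
  by rewrite sqr_sqrtr ?mulr_ge0 //; exact: sa.
have M0 : 0 < M.
  have [b [_ _ b1 eb]] := far 0%N.
  have h : e <= M * `|ofpoly p b| by apply: le_trans eb (le_trans (ler_norm _) (gM b)).
  rewrite ltNge; apply/negP => M0; have := lt_le_trans e_gt0 h.
  by rewrite ltNge mulr_le0_ge0.
have h1 : m%:R * e <= M * Num.sqrt (2 * m%:R).
  by apply: le_trans ga (le_trans (ler_norm _) (le_trans (gM a) _)); rewrite ler_pM2l.
have h2 : (m%:R * e) ^+ 2 <= M ^+ 2 * (2 * m%:R).
  have h0 : 0 <= m%:R * e by rewrite mulr_ge0 ?ltW.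
  rewrite -[2 * m%:R](@sqr_sqrtr _ (2 * m%:R)) ?mulr_ge0 // -exprMn.
  by rewrite ler_sqr ?nnegrE // ?mulr_ge0 ?sqrtr_ge0 ?ltW.
have h3 : 2 * M ^+ 2 / e ^+ 2 < m%:R.
  have := archi_boundP (_ : 0 <= 2 * M ^+ 2 / e ^+ 2) => h.
  apply: lt_trans (h _) _; last by rewrite ltr_nat.
  by apply: divr_ge0; [apply: mulr_ge0; [exact: ler0n|exact: sqr_ge0]|exact: sqr_ge0].
move: h3; rewrite ltr_pdivrMr ?exprn_gt0 // ltNge => /negP; apply.
rewrite -(ler_pM2l m0); move: h2; rewrite exprMn.
move: (M ^+ 2) (e ^+ 2) (m%:R) => u v w; nra.
Qed.

End WeaklyNull.

(** * The basis, the bidual and reflexivity *)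

Section Basis.
Context {R : realType} (p : spreading_datum R).
Notation X := (space p).
Implicit Types (x y : X) (a b : {poly R}).

Definition ebasis n : X := ofpoly p 'X^n.

Lemma series_ebasis (c : nat -> R) n :
  series (expansion c ebasis) n = ofpoly p (seg 0 n c).
Proof.
by rewrite segE linear_sum; apply: eq_bigr => i _; rewrite linearZ.
Qed.

Lemma lcomb_ebasis a : lcomb ebasis a = ofpoly p a.
Proof.
rewrite -[in RHS](lcombX a) /lcomb linear_sum; apply: eq_bigr => i _.
by rewrite linearZ.
Qed.

Lemma series_cvg_coord y : series (expansion y ebasis) @ \oo --> y.
Proof.
apply/cvgrPdist_le => e e0; have [n hn] := seg_tail y e0.
exists n; first by [].
move=> m nm; have -> := series_ebasis y m; exact: hn.
Qed.

Lemma series_coord (c : nat -> R) y k :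
  series (expansion c ebasis) @ \oo --> y -> c k = y k.
Proof.
move=> cy; apply/eqP; rewrite -subr_eq0 -normr_le0; apply/ler_addgt0Pr => e e0.
have P0 := d_gt0 p.
have ep : 0 < e * p 1 by rewrite mulr_gt0.
move/cvgrPdist_le : cy => /(_ _ ep)[n _ hn].
have := hn (maxn n k.+1) (leq_maxl _ _); rewrite series_ebasis => h.
have := norm_seq_coord k (y - ofpoly p (seg 0 (maxn n k.+1) c)).
have -> : (y - ofpoly p (seg 0 (maxn n k.+1) c) : nat -> R^o) k =
    y k - (seg 0 (maxn n k.+1) c)`_k by [].
rewrite coef_seg leq0n /= leq_max ltnSn orbT add0r distrC => hk; apply: le_trans hk _.
by rewrite /= ler_pdivrMl // mulrC.
Qed.

Lemma schauder_ebasis : schauder_basis ebasis.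
Proof.
split=> // y _; exists (y : nat -> R); split; first exact: series_cvg_coord.
by move=> c cy; apply/funext => k; rewrite (series_coord k cy).
Qed.

Lemma coord_comb (h : nat -> R) n : exists d : dual X, forall y, d y = \sum_(i < n) h i * y i.
Proof.
have P0 := d_gt0 p.
have [|y|d [dE _]] := @dual_exists R X (fun y => \sum_(i < n) h i * y i)
  ((\sum_(i < n) `|h i|) * (p 1)^-1).
- move=> c y z; rewrite scaler_sumr -big_split; apply: eq_bigr => i _.
  by rewrite [LHS](mulrDr (h i) (c * y i) (z i)) mulrCA.
- rewrite -mulrA mulr_suml; apply: le_trans (ler_norm_sum _ _ _) _.
  by apply: ler_sum => i _; rewrite normrM ler_wpM2l //; exact: norm_seq_coord.
by exists d.
Qed.

Section Bidual.
Variable Phi : dual (dual X).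

Definition coord n : dual X := projT1 (cid (coord_comb (fun i => (i == n)%:R) n.+1)).

Lemma coordE n y : coord n y = y n.
Proof.
rewrite /coord; case: cid => d /= ->; rewrite (bigD1 ord_max) //= eqxx mul1r.
by rewrite big1 ?addr0 // => i /negbTE ni; rewrite -val_eqE /= in ni; rewrite ni mul0r.
Qed.

Lemma coord_sumE (h : nat -> R) n y : (\sum_(i < n) h i *: coord i) y = \sum_(i < n) h i * y i.
Proof.
elim: n => [|n IH]; first by rewrite !big_ord0.
by rewrite !big_ord_recr dual_addE IH dual_scaleE coordE.
Qed.

(** The partial sums with coefficients [Phi (coord n)] are normed by
    combinations of coordinates, where [Phi] is controlled; and a sequence with
    bounded partial sums is an element of the space. *)
Lemma bidual_coords : exists x : X, forall n, Phi (coord n) = x n.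
Proof.
pose phi : nat -> R^o := fun n => Phi (coord n).
suff hb : norm_bounded p phi by exists (SeqSpace (mem_space hb)).
exists `|Phi| => s; set n := last 0%N s.
rewrite (@eq_partition_norm _ p s phi (nth 0 (seg 0 n phi))); last first.
  by move=> i i_n; rewrite coef_seg /= i_n.
apply: le_trans (partition_norm_le_norm s (ofpoly p (seg 0 n phi))) _.
pose N (a : {poly R}) := `|ofpoly p a|.
have Ns : seminorm N.
  by split=> [a b|c a]; rewrite /N ?linearD ?linearZ ?ler_normD ?normrZ.
have [h [h1 h2]] := @norming_coefficients R _ N (fun i => 'X^i) n phi Ns.
have segphi (f : nat -> R) : \sum_(i < n) f i *: 'X^i = seg 0 n f.
  by rewrite segE big_mkord.
rewrite segphi in h2; rewrite -/(N _) h2.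
have -> : \sum_(i < n) phi i * h i = Phi (\sum_(i < n) h i *: coord i).
  by rewrite linear_sum; apply: eq_bigr => i _; rewrite linearZ /= mulrC.
apply: le_trans (ler_norm _) (le_trans (dual_le _ _) _).
rewrite -[leRHS]mulr1 ler_wpM2l //; apply: opnorm_le => y y1.
rewrite coord_sumE; apply: le_trans y1.
apply: le_trans (norm_ofseg 0 n y); rewrite -/(N _) -segphi.
by under eq_bigr do rewrite mulrC; exact: h1.
Qed.

End Bidual.

(** These functionals form the closed span of the coordinates. *)
Definition tail_small (f : dual X) :=
  forall e, 0 < e -> exists n, forall r y, `|f (ofpoly p (seg n r y))| <= e * `|y|.

Lemma tail_small_dist (f : dual X) e : tail_small f -> 0 < e ->
  exists n, `|f - \sum_(i < n) f (ebasis i) *: coord i| <= e.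
Proof.
move=> fs e0; have [n hn] := fs e e0; exists n; apply: opnorm_le => y y1.
set P := \sum_(i < n) _.
have PE : P y = f (ofpoly p (seg 0 n y)).
  rewrite /P (coord_sumE (fun i => f (ebasis i))) segE big_mkord !linear_sum.
  by apply: eq_bigr => i _; rewrite !linearZ mulrC.
have -> : (f - P) y = f y - P y by rewrite dual_addE dual_oppE.
rewrite PE; apply/ler_addgt0Pr => d d0.
have M0 : 0 < 1 + `|f| by rewrite ltr_pwDl.
have [m hm] := seg_tail y (divr_gt0 d0 M0).
(* [f y - f (P_n y)] splits into a far segment and a far remainder *)
pose r := maxn n m.
have -> : f y - f (ofpoly p (seg 0 n y)) =
    f (ofpoly p (seg n r y)) + f (y - ofpoly p (seg 0 r y)).
  have -> : ofpoly p (seg 0 r y) = ofpoly p (seg 0 n y) + ofpoly p (seg n r y).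
    by rewrite (@seg_split _ 0 n r) ?leq_maxl // linearD.
  by rewrite (linearB f) (linearD f) [RHS]addrC -addrA opprD subrK.
apply: le_trans (ler_normD _ _) _; apply: lerD.
  by apply: le_trans (hn r y) _; rewrite ler_piMr // ltW.
apply: le_trans (dual_le _ _) _.
apply: (@le_trans _ _ ((1 + `|f|) * (d / (1 + `|f|)))).
  by apply: ler_pM => //; [rewrite lerDr|apply: hm; exact: leq_maxr].
by rewrite mulrC divfK // gt_eqF.
Qed.

Lemma kills_tail_small (Psi : dual (dual X)) (f : dual X) :
  (forall n, Psi (coord n) = 0) -> tail_small f -> Psi f = 0.
Proof.
move=> Pc fs; apply/eqP; rewrite -normr_le0; apply/ler_addgt0Pr => e e0; rewrite add0r.
have M0 : 0 < 1 + `|Psi| by rewrite ltr_pwDl.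
have [n hn] := tail_small_dist fs (divr_gt0 e0 M0).
have -> : Psi f = Psi (f - \sum_(i < n) f (ebasis i) *: coord i).
  rewrite linearB linear_sum /= big1 ?subr0 // => i _.
  by rewrite linearZ /= Pc scaler0.
apply: le_trans (dual_le _ _) _.
apply: (@le_trans _ _ ((1 + `|Psi|) * (e / (1 + `|Psi|)))).
  by apply: ler_pM => //; rewrite lerDr.
by rewrite mulrC divfK // gt_eqF.
Qed.

(** After normalization, a failure of this estimate is what [no_far_blocks]
    excludes. *)
Lemma far_small (f : dual X) e : 0 < e -> exists n, forall a : {poly R},
  (forall i, (i < n)%N -> a`_i = 0) -> (summing p -> a.[1] = 0) ->
  `|f (ofpoly p a)| <= e * `|ofpoly p a|.
Proof.
move=> e0; apply: contrapT => hN.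
have gD a b : f (ofpoly p (a + b)) = f (ofpoly p a) + f (ofpoly p b) by rewrite !linearD.
have gZ c a : f (ofpoly p (c *: a)) = c * f (ofpoly p a) by rewrite !linearZ.
apply: (@no_far_blocks R p (fun a => f (ofpoly p a)) `|f| gD gZ (fun a => dual_le f _) e e0).
move=> n; apply: contrapT => hn; apply: hN; exists n => a an as1.
rewrite leNgt; apply/negP => hlt; apply: hn.
have [s [s1 sE]] : exists s : R, `|s| = 1 /\ s * f (ofpoly p a) = `|f (ofpoly p a)|.
  have [h|h] := leP 0 (f (ofpoly p a)).
    by exists 1; rewrite normr1 mul1r (ger0_norm h).
  by exists (-1); rewrite normrN normr1 mulN1r (ltr0_norm h).
have a0 : 0 < `|ofpoly p a|.
  rewrite normr_gt0; apply/eqP => z; move: hlt; rewrite z linear0 !normr0 mulr0.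
  by rewrite ltxx.
exists ((s / `|ofpoly p a|) *: a); split.
- by move=> i i_n; rewrite coefZ an ?mulr0.
- by move=> h; rewrite hornerZ as1 ?mulr0.
- by rewrite linearZ normrZ normrM s1 mul1r normfV normr_id mulVf ?gt_eqF.
by rewrite gZ mulrAC sE ler_pdivlMr // ltW.
Qed.

Lemma tail_small_nonsumming (f : dual X) : ~~ summing p -> tail_small f.
Proof.
move=> ns e e0; have [n hn] := far_small f e0; exists n => r y.
apply: le_trans (hn _ _ _) _.
- by move=> i i_n; rewrite coef_seg leqNgt i_n.
- by move=> s; move: ns; rewrite s.
by apply: ler_wpM2l; [exact: ltW|exact: norm_ofseg].
Qed.

(** Every functional is in the closed span of the coordinates, so an element of
    the bidual is determined by its values on them. *)
Lemma reflexive_nonsumming : ~~ summing p -> reflexive_space X.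
Proof.
move=> ns; apply/seteqP; split=> // Phi _.
have [x hx] := bidual_coords Phi; exists x => //.
apply/eqP; rewrite eq_sym -subr_eq0; apply/eqP; apply/val_inj/funext => f /=.
apply: (@kills_tail_small (Phi - canonical_embedding x)).
  move=> n; rewrite dual_addE dual_oppE hx.
  have -> : canonical_embedding x (coord n) = coord n x by [].
  by rewrite coordE subrr.
exact: tail_small_nonsumming.
Qed.

End Basis.

(** * Quasi-reflexivity in the summing case *)

Lemma affine_approx (R : realType) (c u v s t w d : R) :
  `|c * u + v - w| <= d -> `|u - s| <= d -> `|v - t| <= d ->
  `|w - (c * s + t)| <= d * (2 + `|c|).
Proof.
move=> h1 h2 h3.
have -> : w - (c * s + t) = c * (u - s) + (v - t) - (c * u + v - w) by ring.
apply: le_trans (ler_normB _ _) _; apply: le_trans (lerD (ler_normD _ _) h1) _.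
have h4 : `|c * (u - s)| <= `|c| * d by rewrite normrM ler_wpM2l.
lra.
Qed.

Section Summing.
Context {R : realType} (p : spreading_datum R).
Notation X := (space p).
Implicit Types (x y : X) (a b : {poly R}).
Hypothesis p_sum : summing p.

Let C_ge0 : 0 <= sum_const p.
Proof.
have := d_sum p_sum 1; rewrite hornerC normr1; have := d_gt0 p; nra.
Qed.

Lemma horner1_le_norm a : `|a.[1]| <= sum_const p * `|ofpoly p a|.
Proof.
by apply: le_trans (schreier_sum p_sum a) _; apply: ler_wpM2l; [exact: C_ge0|exact: schreier_le_ofpoly].
Qed.

(** The sums of the initial segments converge as fast as the initial segments
    themselves, the sum functional being bounded. *)
Lemma sum_exists y : exists s, forall n,
  `|(seg 0 n y).[1] - s| <= sum_const p * `|y - ofpoly p (seg 0 n y)|.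
Proof.
apply: (@nested_limit _ (fun n => (seg 0 n y).[1])
  (fun n => sum_const p * `|y - ofpoly p (seg 0 n y)|)) => m n.
rewrite -hornerN -hornerD -mulrDr; apply: le_trans (horner1_le_norm _) _.
apply: ler_wpM2l; first exact: C_ge0.
rewrite linearB.
have -> : ofpoly p (seg 0 m y) - ofpoly p (seg 0 n y) =
    (y - ofpoly p (seg 0 n y)) - (y - ofpoly p (seg 0 m y)).
  by rewrite opprB [RHS]addrC addrA subrK.
by rewrite [leRHS]addrC; exact: ler_normB.
Qed.

Definition sumX y : R := projT1 (cid (sum_exists y)).

Lemma sumXP y n : `|(seg 0 n y).[1] - sumX y| <= sum_const p * `|y - ofpoly p (seg 0 n y)|.
Proof. by rewrite /sumX; case: cid. Qed.

Lemma sumX_lim y e : 0 < e -> exists n, forall m, (n <= m)%N -> `|(seg 0 m y).[1] - sumX y| <= e.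
Proof.
move=> e0; have C1 : 0 < 1 + sum_const p by rewrite ltr_pwDl.
have [n hn] := seg_tail y (divr_gt0 e0 C1); exists n => m nm.
apply: le_trans (sumXP y m) _.
apply: (@le_trans _ _ ((1 + sum_const p) * (e / (1 + sum_const p)))).
  by apply: ler_pM; [exact: C_ge0|exact: normr_ge0|rewrite lerDr|exact: hn].
by rewrite mulrC divfK // gt_eqF.
Qed.

Lemma sumX_linear : linear (sumX : X -> R^o).
Proof.
move=> c y z; apply/eqP; rewrite -subr_eq0 -normr_le0; apply/ler_addgt0Pr => e e0.
rewrite add0r; have M0 : 0 < 2 + `|c| by rewrite ltr_pwDl.
have e'0 : 0 < e / (2 + `|c|) by exact: divr_gt0.
have [n1 h1] := sumX_lim (c *: y + z) e'0.
have [n2 h2] := sumX_lim y e'0; have [n3 h3] := sumX_lim z e'0.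
pose m := maxn n1 (maxn n2 n3).
have {}h1 := h1 m (leq_maxl _ _).
have {}h2 := h2 m (leq_trans (leq_maxl _ _) (leq_maxr _ _)).
have {}h3 := h3 m (leq_trans (leq_maxr _ _) (leq_maxr _ _)).
have sE : (seg 0 m (c *: y + z : X)).[1] = c * (seg 0 m y).[1] + (seg 0 m z).[1].
  by rewrite (seg_add 0 m (fun i => c * y i) z) hornerD seg_scale hornerZ.
rewrite sE in h1.
set d := e / _ in h1 h2 h3.
(* the three errors come from [c *: y + z], [y] and [z] *)
have dE : d * (2 + `|c|) = e by rewrite /d divfK // gt_eqF.
rewrite -dE; exact: affine_approx h1 h2 h3.
Qed.

Lemma sum_functional : exists S : dual X, forall a, S (ofpoly p a) = a.[1].
Proof.
have [|y|S [SE _]] := @dual_exists R X (sumX : X -> R^o) (sum_const p).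
- exact: sumX_linear.
- have := sumXP y 0; rewrite (_ : seg 0 0 y = 0); last first.
    by apply: seg_eq0 => i; rewrite ltn0 andbF.
  by rewrite linear0 horner0 subr0 sub0r normrN.
exists S => a; rewrite SE; apply/eqP; rewrite eq_sym -subr_eq0 -normr_le0.
have := sumXP (ofpoly p a) (size a).
by rewrite (_ : seg 0 (size a) _ = a) ?seg_all // subrr normr0 mulr0.
Qed.

(** Differences of far basis vectors have sum zero. *)
Lemma basis_lim (f : dual X) : cvg ((fun n => f (ebasis p n)) @ \oo).
Proof.
have B0 : 0 <= seg_const p * p 1 by apply: le_trans (schreier_Xn p 0); exact: schreier_ge0.
have M0 : 0 < 1 + (seg_const p * p 1 + seg_const p * p 1) by rewrite ltr_pwDl // addr_ge0.
apply: cauchy_cvg; apply/cauchyP => e e0.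
have e20 : 0 < e / 2 by rewrite divr_gt0.
have [n hn] := far_small f (divr_gt0 e20 M0).
exists (f (ebasis p n)); exists n; first by [].
move=> m /= nm; rewrite -ball_normE /=.
have -> : f (ebasis p n) - f (ebasis p m) = f (ofpoly p ('X^n - 'X^m)) by rewrite !linearB.
apply: (@le_lt_trans _ _ (e / 2)); last by rewrite ltr_pdivrMr // ltr_pMr // ltrDl.
apply: le_trans (hn _ _ _) _ => [i i_n|_|].
- by rewrite coefB !coefXn !ltn_eqF ?subrr // (leq_trans i_n).
- by rewrite hornerD hornerN !hornerXn !expr1n subrr.
rewrite mulrAC ler_pdivrMr //; apply: ler_wpM2l; first exact: ltW.
rewrite linearB.
apply: le_trans (ler_normB _ _) _; apply: le_trans (lerD (norm_ofXn p n) (norm_ofXn p m)) _.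
by rewrite lerDr.
Qed.

Definition limX (f : dual X) : R := lim ((fun n => f (ebasis p n)) @ \oo).

Lemma limXP (f : dual X) (e : R) : 0 < e ->
  exists n, forall m, (n <= m)%N -> `|limX f - f (ebasis p m)| <= e.
Proof.
move=> e0; have /cvgrPdist_le/(_ e e0)[n _ hn] := @basis_lim f.
by exists n => m nm; exact: hn.
Qed.

Lemma limX_bidual : exists w : dual (dual X), forall f, w f = limX f.
Proof.
have B0 : 0 <= seg_const p * p 1 by apply: le_trans (schreier_Xn p 0); exact: schreier_ge0.
have [|f|w [wE _]] := @dual_exists R (dual X) (limX : dual X -> R^o) (seg_const p * p 1).
- move=> c f g; rewrite /limX.
  have h : (fun n => (c *: f + g) (ebasis p n)) @ \oo -->
      (c *: limX f + limX g : R^o).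
    apply: (@cvgD _ R^o); last exact: basis_lim.
    by apply: cvgZr; exact: (@basis_lim f).
  exact: (cvg_lim (@Rhausdorff R) h).
- apply/ler_addgt0Pr => e e0; have [n hn] := limXP f e0.
  have := hn n (leqnn n) => h.
  have -> : limX f = f (ebasis p n) + (limX f - f (ebasis p n)) by rewrite addrC subrK.
  apply: le_trans (ler_normD _ _) _; apply: lerD => //.
  apply: le_trans (dual_le _ _) _; rewrite mulrC; apply: ler_wpM2r => //.
  exact: norm_ofXn.
by exists w.
Qed.

(** Transfer the sum of a far block to a single far basis vector: the
    difference has sum zero, and [f] is close to its limit at that vector. *)
Lemma tail_small_summing (S f : dual X) : (forall a, S (ofpoly p a) = a.[1]) ->
  tail_small (f - limX f *: S).
Proof.
move=> SE e e0; set B := seg_const p * p 1.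
have eB m : `|ofpoly p 'X^m| <= B by exact: norm_ofXn.
have B0 : 0 <= B by apply: le_trans (schreier_Xn p 0); exact: schreier_ge0.
clearbody B.
have M0 : 0 < 1 + (sum_const p * B + sum_const p) by rewrite ltr_pwDl // addr_ge0 // mulr_ge0.
have d0 := divr_gt0 e0 M0; set d := e / _ in d0.
have [n1 h1] := far_small f d0; have [n2 h2] := limXP f d0.
exists n1 => r y; set a := seg n1 r y; pose m := maxn n1 n2.
have hs : `|a.[1]| <= sum_const p * `|y|.
  apply: le_trans (horner1_le_norm _) _.
  by apply: ler_wpM2l; [exact: C_ge0|exact: norm_ofseg].
have ha : `|ofpoly p a| <= `|y| by exact: norm_ofseg.
have y0 : 0 <= `|y| by [].
have h3 : `|f (ofpoly p (a - a.[1] *: 'X^m))| <= d * (`|y| + sum_const p * `|y| * B).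
  apply: le_trans (h1 _ _ _) _ => [i i_n|_|].
  - rewrite coefB coefZ coefXn ltn_eqF ?mulr0 ?subr0; last first.
      by apply: leq_trans i_n _; exact: leq_maxl.
    by rewrite coef_seg leqNgt i_n.
  - by rewrite hornerD hornerN hornerZ hornerXn expr1n mulr1 subrr.
  apply: ler_wpM2l; first exact: ltW.
  rewrite linearB linearZ; apply: le_trans (ler_normB _ _) _; apply: lerD; first exact: ha.
  by rewrite normrZ; apply: ler_pM; [exact: normr_ge0|exact: normr_ge0|exact: hs|exact: eB].
have h4 : `|a.[1] * (f (ebasis p m) - limX f)| <= sum_const p * `|y| * d.
  rewrite normrM; apply: ler_pM; [exact: normr_ge0|exact: normr_ge0|exact: hs|].
  rewrite distrC; apply: h2; exact: leq_maxr.
have -> : (f - limX f *: S) (ofpoly p a) =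
    f (ofpoly p (a - a.[1] *: 'X^m)) + a.[1] * (f (ebasis p m) - limX f).
  have -> : f (ofpoly p (a - a.[1] *: 'X^m)) = f (ofpoly p a) - a.[1] * f (ebasis p m).
    by rewrite !linearB !linearZ.
  by rewrite dual_addE dual_oppE dual_scaleE SE mulrBr addrA subrK (mulrC (limX f)).
apply: le_trans (ler_normD _ _) _; apply: le_trans (lerD h3 h4) _.
have ring_id (u c b v : R) : u * (v + c * v * b) + c * v * u = u * (1 + (c * b + c)) * v by ring.
by rewrite ring_id /d divfK ?gt_eqF.
Qed.

(** Taking limits along the basis is an element [w] of the bidual that vanishes
    on the coordinates but not on the sum functional, so it is not in the space.
    Conversely every functional is in the closed span of the coordinates and of
    the sum functional. *)
Lemma quasi_reflexive_summing : quasi_reflexive_order_one X.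
Proof.
have [S SE] := sum_functional; have [w wE] := limX_bidual.
have limc n : limX (coord p n) = 0.
  apply/eqP; rewrite -normr_le0; apply/ler_addgt0Pr => e e0; rewrite add0r.
  have [k hk] := limXP (coord p n) e0.
  have := hk (maxn k n.+1) (leq_maxl _ _).
  rewrite coordE -[ebasis p _ n]/(('X^(maxn k n.+1) : {poly R})`_n) coefXn ltn_eqF ?subr0 //.
  exact: leq_maxr.
have limS : limX S = 1.
  apply/eqP; rewrite -subr_eq0 -normr_le0; apply/ler_addgt0Pr => e e0; rewrite add0r.
  have [k hk] := limXP S e0; have := hk k (leqnn k).
  by rewrite SE hornerXn expr1n.
exists w; split.
  move=> [x _ xw].
  have x0 : x = 0.
    apply/val_inj/funext => n /=.
    have : canonical_embedding x (coord p n) = w (coord p n) by rewrite xw.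
    by rewrite wE limc -[canonical_embedding x _]/(coord p n x) coordE.
  have : canonical_embedding x S = w S by rewrite xw.
  rewrite wE limS -[canonical_embedding x _]/(S x) x0 linear0 => /esym/eqP.
  by rewrite oner_eq0.
move=> Phi; have [x hx] := bidual_coords Phi.
pose Psi := Phi - canonical_embedding x.
exists (canonical_embedding x), (Psi S); split; first by exists x.
apply/val_inj/funext => f /=.
pose T := Psi - Psi S *: w.
have TE g : T g = Psi g - Psi S * limX g by rewrite dual_addE dual_oppE dual_scaleE wE.
have T0 : T (f - limX f *: S) = 0.
  apply: kills_tail_small; last exact: tail_small_summing.
  move=> n; rewrite TE limc mulr0 subr0 dual_addE dual_oppE hx.
  by rewrite -[canonical_embedding x _]/(coord p n x) coordE subrr.
have : T (f - limX f *: S) = T f - limX f * T S by rewrite linearB linearZ.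
rewrite T0 !TE limS mulr1 subrr mulr0 subr0 => /esym/eqP; rewrite subr_eq0 => /eqP h.
rewrite -[RHS]/(canonical_embedding x f + Psi S * w f).
by rewrite wE -h /Psi dual_addE dual_oppE addrC subrK.
Qed.

End Summing.

(** * Unconditionality and the spreading model of the basis *)

Lemma lcomb_seg (R : realType) (V : lmodType R) (v : nat -> V) l r (f : nat -> R) :
  lcomb v (seg l r f) = \sum_(l <= i < r) f i *: v i.
Proof. by rewrite segE linear_sum; apply: eq_bigr => i _; rewrite linearZ /= lcombXn. Qed.

Definition restr (R : realType) (G : pred nat) (f : nat -> R) : nat -> R :=
  fun i => if G i then f i else 0.

Section Unconditional.
Context {R : realType} {E : completeNormedModType R} (x : nat -> E) (K : R).
Hypothesis xK : forall G l r (f : nat -> R),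
  `|lcomb x (seg l r (restr G f))| <= K * `|lcomb x (seg l r f)|.

(** A segment of a rearranged series is obtained from a segment of the original
    one by suppressing terms. *)
Lemma suppression_unconditional : unconditional x.
Proof.
move=> a a_cvg s [t st ts]; apply: cauchy_cvg; apply/cauchyP => e e0.
have K0 : 0 < 1 + `|K| by rewrite ltr_pwDl.
have e'0 : 0 < e / 2 / (1 + `|K|) by rewrite !divr_gt0.
have /cauchy_cvgP/cauchyP/(_ _ e'0)[y [m _ hm]] := a_cvg.
pose N := (\sum_(j < m) (t j).+1)%N.
have sN i : (N <= i)%N -> (m <= s i)%N.
  move=> Ni; rewrite leqNgt; apply/negP => sim.
  have : (i < N)%N; last by rewrite ltnNge Ni.
  by rewrite /N (bigD1 (Ordinal sim)) //= st ltnS leq_addr.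
exists (series (expansion a x \o s) N); exists N; first by [].
move=> n /= Nn; rewrite -ball_normE /= distrC.
rewrite (sub_series_geq _ Nn).
pose T := map s (index_iota N n).
pose M := (m + \sum_(j <- T) j.+1)%N.
have TM j : j \in T -> (m <= j < M)%N.
  move=> jT; apply/andP; split.
    by case/mapP: jT => i; rewrite mem_index_iota => /andP[Ni _] ->; exact: sN.
  rewrite /M (big_rem j) //= addnCA; apply: leq_trans (leq_addr _ _); exact: leqnn.
have -> : \sum_(N <= i < n) (expansion a x \o s) i =
    lcomb x (seg m M (restr (fun j => j \in T) a)).
  transitivity (\sum_(j <- T) expansion a x j); first by rewrite big_map.
  rewrite lcomb_seg.
  rewrite [RHS](eq_bigr (fun j => if j \in T then expansion a x j else 0)); last first.
    by move=> j _; rewrite /restr; case: ifP => // _; rewrite scale0r.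
  rewrite -big_mkcond -big_filter; apply: perm_big; apply: uniq_perm.
  - by rewrite map_inj_uniq ?iota_uniq //; exact: can_inj st.
  - by rewrite filter_uniq ?iota_uniq.
  by move=> j; rewrite mem_filter mem_index_iota; case: (boolP (j \in T)) => // /TM ->.
apply: le_lt_trans (xK _ _ _ _) _.
have mM : (m <= M)%N by rewrite leq_addr.
have -> : lcomb x (seg m M a) = series (expansion a x) M - series (expansion a x) m.
  by rewrite sub_series_geq // lcomb_seg.
have h1 := hm m (leqnn m); have h2 := hm M mM.
rewrite -ball_normE /= in h1 h2.
set u := series _ M in h2 *; set v := series _ m in h1 *.
have h3 : `|u - v| <= e / (1 + `|K|).
  have -> : u - v = (y - v) - (y - u) by rewrite opprB [RHS]addrC addrA subrK.
  apply: le_trans (ler_normB _ _) _; apply: le_trans (ltW (ltrD h1 h2)) _.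
  by rewrite -mulrDl -splitr.
have h4 : K * `|u - v| <= `|K| * (e / (1 + `|K|)).
  apply: le_trans (ler_wpM2r (normr_ge0 _) (ler_norm K)) _.
  by apply: ler_wpM2l h3.
apply: le_lt_trans h4 _; rewrite mulrCA -[ltRHS]mulr1 ltr_pM2l // ltr_pdivrMr // mul1r.
by rewrite ltrDr.
Qed.

End Unconditional.

Section UnconditionalSpace.
Context {R : realType} (p : spreading_datum R).
Hypothesis p_ns : ~~ summing p.
Let ps : seminorm p := d_seminorm p.
Implicit Types (f : nat -> R) (G : pred nat).

(** The unwanted coordinates are dropped one at a time. *)
Lemma p_restr G l r f : p (seg l r (restr G f)) <= p (seg l r f).
Proof.
suff key n : (l + n <= r)%N -> p (seg l (l + n) (restr G f) + seg (l + n) r f) <= p (seg l r f).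
  case: (leqP l r) => [lr|rl]; last first.
    by rewrite !seg_eq0 // => i; lia.
  have := key (r - l)%N; rewrite subnKC // => /(_ (leqnn r)).
  by rewrite (_ : seg r r f = 0) ?addr0 //; apply: seg_eq0; lia.
elim: n => [|n IH] h.
  by rewrite addn0 (_ : seg l l _ = 0) ?add0r //; apply: seg_eq0; lia.
have h' : (l + n <= r)%N by lia.
apply: le_trans (IH h'); rewrite addnS.
case GE : (G (l + n)%N).
  rewrite (_ : seg l (l + n).+1 (restr G f) + seg (l + n).+1 r f =
    seg l (l + n) (restr G f) + seg (l + n) r f) //.
  rewrite (@seg_split _ l (l + n) (l + n).+1); last lia.
  rewrite (@seg_split _ (l + n) (l + n).+1 r); last lia.
  rewrite -addrA; congr (_ + (_ + _)); apply: eq_seg => i hi.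
  by have -> : i = (l + n)%N by [lia]; rewrite /restr GE.
have -> : seg l (l + n) (restr G f) + seg (l + n) r f =
    (seg l (l + n).+1 (restr G f) + seg (l + n).+1 r f) + seg (l + n) (l + n).+1 f.
  rewrite (@seg_split _ l (l + n) (l + n).+1); last lia.
  rewrite (@seg_split _ (l + n) (l + n).+1 r); last lia.
  rewrite [X in _ = _ + X + _ + _](_ : _ = 0); last first.
    apply: seg_eq0 => i hi; have -> : i = (l + n)%N by lia.
    by rewrite /restr GE.
  by rewrite addr0 [LHS]addrCA [LHS]addrC.
apply: (@d_drop _ p (l + n) (l + n).+1) => [i hi|i hi|s].
- have iE : i = (l + n)%N by lia.
  by rewrite iE coefD !coef_seg /restr GE ltnn if_same add0r.
- by rewrite coef_seg (negbTE hi).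
by move: p_ns; rewrite s.
Qed.

Lemma quot_norm_restr F G l r f : quot_norm p F (seg l r (restr G f)) <= quot_norm p F (seg l r f).
Proof.
apply: quot_norm_ge => z [z0 _].
pose n := maxn r (size z).
have bn : (size (seg l r f + z)%R <= n)%N.
  apply: leq_trans (size_polyD _ _) _; rewrite geq_max leq_maxr andbT.
  by rewrite (leq_trans (size_seg _ _ _)) // leq_maxl.
have nz : null p F (seg 0 n (restr G (nth 0 z))).
  split=> [i iF|s]; first by rewrite coef_seg /restr z0 // !if_same.
  by move: p_ns; rewrite s.
apply: le_trans (quot_norm_le _ nz) _.
have -> : seg l r (restr G f) + seg 0 n (restr G (nth 0 z)) =
    seg 0 n (restr G (nth 0 (seg l r f + z))).
  apply/polyP => i; rewrite coefD !coef_seg /restr coefD coef_seg leq0n /=.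
  case: (ltnP i n) => [_|ni]; first by case: (G i); rewrite ?if_same ?addr0.
  rewrite addr0; case: ifP => // /andP[_ ir].
  by move: ni; rewrite leqNgt (leq_trans ir) ?leq_maxl.
by rewrite -[X in _ <= p X](seg_all bn); exact: p_restr.
Qed.

Lemma schreier_restr G l r f : schreier p (seg l r (restr G f)) <= schreier p (seg l r f).
Proof.
apply: schreier_le => [|F l' r' aF]; first exact: schreier_ge0.
by rewrite seg_seg; apply: le_trans (quot_norm_restr _ _ _ _ _) _; rewrite -seg_seg; exact: schreier_ge.
Qed.

Lemma partition_norm_restr G s f : partition_norm p s (restr G f) <= partition_norm p s f.
Proof.
rewrite /partition_norm; case: (boolP (path leq 0%N s)) => ls; last exact: lexx.
apply: ler_wsqrtr; apply: (ler_chain ls) => i j _ _ _.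
rewrite ler_sqr; [|rewrite nnegrE; exact: window_ge0..].
by apply: window_mono => i' j' _ _ _; exact: schreier_restr.
Qed.

Lemma unconditional_ebasis : unconditional (ebasis p).
Proof.
apply: (@suppression_unconditional _ _ _ 1) => G l r f; rewrite mul1r !lcomb_ebasis.
apply: norm_le_partition_norm => s; apply: le_trans (partition_norm_le_norm s _).
apply: le_trans (partition_norm_restr G s (nth 0 (seg l r f))).
rewrite (@eq_partition_norm _ p s _ (restr G (nth 0 (seg l r f)))) // => i _.
by rewrite /restr ofpolyE !coef_seg /restr; case: (G i); rewrite ?if_same.
Qed.

End UnconditionalSpace.

Section SpreadingModel.
Context {R : realType} (p : spreading_datum R).
Let ps : seminorm p := d_seminorm p.
Implicit Types (a b : {poly R}) (k : nat -> nat).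

Lemma seg_Xn l r n : seg l r (nth 0 ('X^n : {poly R})) = if (l <= n < r)%N then 'X^n else 0.
Proof.
apply/polyP => i; rewrite coef_seg coefXn; case: eqP => [->|ni].
  by case: ifP; rewrite ?coefXn ?eqxx ?coef0.
by case: ifP; case: ifP; rewrite ?coefXn ?coef0 //; case: eqP.
Qed.

Lemma seg_sum l r n (c : nat -> R) (v : nat -> {poly R}) :
  seg l r (nth 0 (\sum_(i < n) c i *: v i)) = \sum_(i < n) c i *: seg l r (nth 0 (v i)).
Proof.
elim: n => [|n IH].
  by rewrite !big_ord0; apply: seg_eq0 => i _; rewrite coef0.
by rewrite !big_ord_recr segD segZ IH.
Qed.

Lemma seg_spread k l r l' r' a :
  (forall i, (l' <= i < r')%N = (l <= k i < r)%N) ->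
  seg l r (nth 0 (lcomb (fun i => 'X^(k i)) a)) =
  lcomb (fun i => 'X^(k i)) (seg l' r' (nth 0 a)).
Proof.
move=> kk; pose n := maxn (size a) (size (seg l' r' (nth 0 a))).
have h1 : (size a <= n)%N by exact: leq_maxl.
have h2 : (size (seg l' r' (nth 0%R a)) <= n)%N by exact: leq_maxr.
rewrite (lcomb_wide _ h1) (lcomb_wide _ h2).
rewrite (seg_sum l r n (nth 0 a) (fun i => 'X^(k i))); apply: eq_bigr => i _; rewrite seg_Xn coef_seg kk.
by case: ifP; rewrite ?scaler0 ?scale0r.
Qed.

(** Through an increasing map, intervals of the image correspond to intervals
    of the source. *)
Lemma interval_norm_spread : spread_invariant (interval_norm p).
Proof.
move=> k a kH; set b := lcomb _ a.
have kle i : (i <= k i)%N by elim: i => // i IH; apply: leq_ltn_trans IH (kH _ _ (ltnSn i)).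
have kmono i j : (k i < k j)%N = (i < j)%N.
  case: (ltngtP i j) => [/kH//|/kH/ltnW|->]; last by rewrite ltnn.
  by rewrite ltnNge => ->.
have cut l : exists l', forall i, (i < l')%N = (k i < l)%N.
  have ex : exists i, (l <= k i)%N by exists l.
  exists (ex_minn ex) => i; case: ex_minnP => m lm mmin.
  case: (ltnP i m) => im; case: (ltnP (k i) l) => // kl.
    by have := mmin i kl; rewrite leqNgt im.
  have : (k m <= k i)%N by rewrite leqNgt kmono ltnNge im.
  by rewrite leqNgt (leq_trans kl lm).
apply/eqP; rewrite eq_le; apply/andP; split; apply: interval_norm_le => l r.
  have [l' hl] := cut l; have [r' hr] := cut r.
  rewrite (@seg_spread k l r l' r'); last by move=> i; rewrite hr leqNgt hl -leqNgt.
  by rewrite (@d_spread _ p k _ kH); exact: interval_norm_ge.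
rewrite -(@d_spread _ p k _ kH) -(@seg_spread k (k l) (k r)); first exact: interval_norm_ge.
by move=> i; rewrite kmono leqNgt -kmono -leqNgt.
Qed.

Lemma spread_ord n (k : 'I_n -> nat) (c : 'I_n -> R) :
  {homo k : i j / (i < j)%N} ->
  exists2 k' : nat -> nat, {homo k' : i j / (i < j)%N} &
    \sum_(i < n) c i *: 'X^(k i) =
    lcomb (fun i => 'X^(k' i)) (\sum_(i < n) c i *: 'X^i) :> {poly R}.
Proof.
move=> kH; pose S := (\sum_(i < n) k i)%N.
have kS i : (k i <= S)%N by rewrite /S (bigD1 i) //= leq_addr.
exists (fun i => if insub i is Some j then k j else (S + i).+1).
  move=> i j ij; case: insubP => [u ui uE|ni]; case: insubP => [v vj vE|nj].
  - by apply: kH; rewrite uE vE.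
  - by rewrite ltnS (leq_trans (kS u)) // leq_addr.
  - by move: ni; rewrite (ltn_trans ij vj).
  - by rewrite ltnS ltn_add2l.
rewrite linear_sum; apply: eq_bigr => i _; rewrite linearZ /= lcombXn.
case: insubP => [u _ uE|]; last by rewrite ltn_ord.
by have -> : u = i by exact: val_inj.
Qed.

Lemma sum_coef_le n (k : 'I_n -> nat) (c : 'I_n -> R) m : (forall i, `|c i| <= 1) ->
  \sum_(0 <= j < m) `|(\sum_(i < n) c i *: 'X^(k i) : {poly R})`_j| <= n%:R.
Proof.
move=> c1; apply: (@le_trans _ _ (\sum_(0 <= j < m) \sum_(i < n) (j == k i)%:R)).
  apply: ler_sum => j _; rewrite coef_sum; apply: le_trans (ler_norm_sum _ _ _) _.
  apply: ler_sum => i _; rewrite coefZ coefXn normrM normr_nat.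
  by rewrite ler_piMl.
rewrite exchange_big /= -[n in leRHS]card_ord -sumr_const; apply: ler_sum => i _.
case: (ltnP (k i) m) => km.
  rewrite (bigD1_seq (k i)) ?mem_index_iota ?iota_uniq //= eqxx big1 ?addr0 //.
  by move=> j /negbTE ->.
rewrite big_nat big1 // => j /andP[_ jm]; case: eqP => // jk.
by move: jm; rewrite jk ltnNge km.
Qed.

(** The vectors in question are supported by admissible sets, where the Schreier
    norm is the interval norm; a partition adds to it only what is seen by
    windows starting beyond [n0]. *)
Lemma ebasis_spreading_model :
  generates_spreading_model (ebasis p) (interval_norm p) (fun i => 'X^i : {poly R}).
Proof.
have B0 : 0 <= seg_const p * p 1 by apply: le_trans (schreier_Xn p 0); exact: schreier_ge0.
split; first 1 last; first exact: interval_norm_seminorm.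
- move=> n eps e0; set B := seg_const p * p 1 in B0.
  (* beyond [n] for admissibility, and beyond [n * B / eps] for the error *)
  pose n0 := (n + (Num.bound (n%:R * B / eps)).+1)%N; exists n0 => k c kn0 kH c1.
  set A := \sum_(i < n) c i *: 'X^(k i) : {poly R}.
  have -> : \sum_(i < n) c i *: ebasis p (k i) = ofpoly p A.
    by rewrite linear_sum; apply: eq_bigr => i _; rewrite linearZ.
  have [k' k'H AE] := spread_ord c kH; rewrite -/A in AE.
  rewrite -(interval_norm_spread (\sum_(i < n) c i *: 'X^i) k'H) -AE.
  pose F := [seq k i | i <- enum 'I_n].
  have sF : size F = n by rewrite size_map size_enum_ord.
  have aF : adm F.
    apply/allP => _ /mapP[i _ ->]; rewrite sF; apply: leq_trans (leqnSn _).
    by apply: leq_trans (kn0 i); rewrite leq_addr.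
  have AF i : i \notin F -> A`_i = 0.
    move=> iF; rewrite coef_sum big1 // => j _; rewrite coefZ coefXn.
    case: eqP => [ij|]; last by rewrite mulr0.
    by move: iF; rewrite ij map_f ?mem_enum.
  have qA : schreier p A = interval_norm p A by exact: schreier_supp aF AF.
  have q0 : 0 <= interval_norm p A by rewrite -qA; exact: schreier_ge0.
  have A0 j : (j < n0)%N -> A`_j = 0.
    move=> jn; apply: AF; apply/mapP => -[i _ ji]; move: (kn0 i); rewrite -ji.
    by rewrite leqNgt jn.
  have c1' i : `|c i| <= 1 by rewrite ler_norml.
  have small : n%:R * B / n0.+1%:R < eps.
    rewrite ltr_pdivrMr ?ltr0n // [ltRHS]mulrC -ltr_pdivrMr //.
    have := archi_boundP (divr_ge0 (mulr_ge0 (ler0n R n) B0) (ltW e0)) => h.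
    apply: lt_le_trans h _; rewrite ler_nat /n0; apply: leqW.
    by apply: leq_trans (leqnSn _) (leq_addl _ _).
  have r0 : 0 <= n%:R * B / n0.+1%:R by rewrite divr_ge0 // mulr_ge0.
  have up : `|ofpoly p A| <= interval_norm p A + n%:R * B / n0.+1%:R.
    apply: norm_le_partition_norm => s; apply: partition_norm_le => [|ls]; first exact: addr_ge0.
    have := @partition_sqr_far _ p n0 (nth 0 A) s (interval_norm p A) n%:R A0 ls.
    rewrite -/B => h; apply: le_trans (h _ _) _.
    - by move=> l r; rewrite -qA; exact: schreier_seg.
    - by move=> m; exact: sum_coef_le.
    by move: (interval_norm p A) (n%:R * B / _) q0 r0 => u v u0 v0; rewrite sqrrD; nra.
  have low : interval_norm p A <= `|ofpoly p A| by rewrite -qA; exact: schreier_le_ofpoly.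
  by rewrite ger0_norm ?subr_ge0 // ltrBlDl (le_lt_trans up) // ltrD2l.
- exists (seg_const p * p 1); split; first exact: num_real.
  by move=> M BM i _; apply: le_trans (norm_ofXn p i) (ltW BM).
Qed.

Lemma ebasis_spreading_model_equivalent (E : normedModType R) (x : nat -> E) (c : R) :
  0 < c -> (forall a, p a <= c * `|lcomb x a| /\ `|lcomb x a| <= c * p a) ->
  generates_spreading_model_equivalent_to (ebasis p) x.
Proof.
move=> c0 px; exists {poly R}, (interval_norm p), (fun i => 'X^i); split.
  exact: ebasis_spreading_model.
have K0 : 0 < 1 + `|seg_const p| by rewrite ltr_pwDl.
have KE : seg_const p <= 1 + `|seg_const p| by have := ler_norm (seg_const p); lra.
exists ((1 + `|seg_const p|) * c)^-1, c; split=> //; first by rewrite invr_gt0 mulr_gt0.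
move=> n a; set A := \sum_(i < n) _.
have -> : \sum_(i < n) a i *: x i = lcomb x A.
  by rewrite linear_sum; apply: eq_bigr => i _; rewrite linearZ /= lcombXn.
have [h1 h2] := px A; split.
  rewrite ler_pdivrMl ?mulr_gt0 //; apply: le_trans (interval_norm_le_p p A) _.
  apply: (@le_trans _ _ ((1 + `|seg_const p|) * p A)).
    by apply: ler_wpM2r => //; exact: (seminorm_ge0 ps).
  by rewrite -mulrA ler_pM2l.
by apply: le_trans h2 _; rewrite ler_pM2l //; exact: p_le_interval_norm.
Qed.

End SpreadingModel.

(** * Block rearrangements and gliding humps *)

Section Blocks.
Variables (m : nat -> nat).
Hypotheses (m0 : m 0%N = 0%N) (mS : forall j, (m j < m j.+1)%N).

Lemma block_mono i j : (i <= j)%N -> (m i <= m j)%N.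
Proof.
move=> /subnKC <-; elim: (j - i)%N => [|d IH]; first by rewrite addn0.
by rewrite addnS; exact: leq_trans IH (ltnW (mS _)).
Qed.

Lemma block_ge j : (j <= m j)%N.
Proof. by elim: j => // j IH; exact: leq_ltn_trans IH (mS j). Qed.

Lemma block_exists i : exists j, (m j <= i < m j.+1)%N.
Proof.
have ex : exists j, (i < m j)%N by exists i.+1; exact: block_ge.
case: (ex_minnP ex) => -[|j] ij jmin; first by rewrite m0 in ij.
exists j; rewrite ij andbT leqNgt; apply/negP => h.
by have := jmin j h; rewrite ltnn.
Qed.

Lemma block_unique i j j' : (m j <= i < m j.+1)%N -> (m j' <= i < m j'.+1)%N -> j = j'.
Proof.
move=> /andP[h1 h2] /andP[h3 h4]; apply/eqP; case: ltngtP => // h.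
  by have := leq_trans h2 (leq_trans (block_mono h) h3); rewrite ltnn.
by have := leq_trans h4 (leq_trans (block_mono h) h1); rewrite ltnn.
Qed.

(** The permutation acts on each block separately, listing first the indices
    that satisfy [P]. *)
Lemma block_rearrangement (P : pred nat) : exists s : nat -> nat, bijective s /\
  forall j, map s (index_iota (m j) (m j + count P (index_iota (m j) (m j.+1)))) =
            [seq i <- index_iota (m j) (m j.+1) | P i].
Proof.
have [blk blkP] := choice block_exists.
pose L j := [seq i <- index_iota (m j) (m j.+1) | P i] ++
            [seq i <- index_iota (m j) (m j.+1) | ~~ P i].
have Lp j : perm_eq (L j) (index_iota (m j) (m j.+1)).
  by rewrite /L (perm_filterC P).
have Lu j : uniq (L j) by rewrite (perm_uniq (Lp j)) iota_uniq.
have Lm j i : (i \in L j) = (m j <= i < m j.+1)%N.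
  by rewrite (perm_mem (Lp j)) mem_index_iota.
have Ls j : size (L j) = (m j.+1 - m j)%N by rewrite (perm_size (Lp j)) size_iota.
pose s i := nth 0%N (L (blk i)) (i - m (blk i)).
pose t v := (m (blk v) + index v (L (blk v)))%N.
have off i : (i - m (blk i) < size (L (blk i)))%N.
  by rewrite Ls; have := blkP i; lia.
have sblk i : (m (blk i) <= s i < m (blk i).+1)%N by rewrite -Lm mem_nth ?off.
have tblk v : (m (blk v) <= t v < m (blk v).+1)%N.
  have : (index v (L (blk v)) < size (L (blk v)))%N by rewrite index_mem Lm.
  by rewrite /t Ls; have := mS (blk v); lia.
have bs i : blk (s i) = blk i by exact: block_unique (blkP (s i)) (sblk i).
have bt v : blk (t v) = blk v by exact: block_unique (blkP (t v)) (tblk v).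
exists s; split.
  exists t => i.
    by rewrite /t bs /s index_uniq ?off // subnKC //; case/andP: (blkP i).
  by rewrite {1}/s bt /t addKn nth_index // Lm.
move=> j; set c := count P _.
have cL : (c <= size (L j))%N by rewrite /L size_cat size_filter leq_addr.
rewrite /index_iota addKn -/(index_iota _ _).
have -> : map s (iota (m j) c) = take c (L j).
  apply: (@eq_from_nth _ 0%N); first by rewrite size_map size_iota size_takel.
  rewrite size_map size_iota => i ic.
  rewrite (nth_map 0%N) ?size_iota // nth_iota // nth_take //.
  have -> : s (m j + i)%N = nth 0%N (L j) (m j + i - m j)%N; last by rewrite addKn.
  have bj : blk (m j + i)%N = j.
    apply: block_unique (blkP _) _; rewrite leq_addr /=.
    by move: (leq_trans ic cL); rewrite Ls; lia.
  by rewrite /s bj.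
by rewrite /L take_size_cat // size_filter.
Qed.

End Blocks.

Section Glide.
Context {R : realType} {E : completeNormedModType R} (x : nat -> E).
Hypothesis x_basic : schauder_basic x.

Lemma series_lcomb (a : nat -> R) n : series (expansion a x) n = lcomb x (seg 0 n a).
Proof. by rewrite lcomb_seg. Qed.

Lemma lcomb_closed_span (a : {poly R}) : closed_span x (lcomb x a).
Proof. by apply: subset_closure; exists (size a), (nth 0 a). Qed.

(** Zero has only one expansion. *)
Lemma lcomb_eq0 (a : {poly R}) : lcomb x a = 0 -> a = 0.
Proof.
move=> a0; have [_ /(_ 0)] := x_basic; case.
  by have := @lcomb_closed_span 0; rewrite linear0.
move=> b [_ bu]; have zero (c : {poly R}) : lcomb x c = 0 -> series (expansion (nth 0 c) x) @ \oo --> (0 : E).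
  move=> c0; apply/cvgrPdist_le => e e0; exists (size c); first by [].
  move=> n /= cn; rewrite series_lcomb seg_all // c0 subrr normr0; exact: ltW.
have h1 := bu _ (zero a a0); have h2 := bu _ (zero 0 (linear0 _)).
by apply/polyP => i; rewrite -[LHS]/((nth 0 a) i) -h1 h2.
Qed.

Variables (p : {poly R} -> R) (c : R).
Hypotheses (ps : seminorm p) (pI : spread_invariant p) (c0 : 0 < c).
Hypothesis px : forall a, p a <= c * `|lcomb x a| /\ `|lcomb x a| <= c * p a.

Lemma p_gt0 (a : {poly R}) : a != 0 -> 0 < p a.
Proof.
move=> a0; rewrite lt_neqAle (seminorm_ge0 ps) andbT eq_sym; apply: contraNneq a0 => pa.
apply/eqP/lcomb_eq0/eqP; rewrite -normr_le0.
by have [_ h] := px a; rewrite pa mulr0 in h.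
Qed.

(** The vectors obtained by opening a gap just after and just before the index
    [i] differ in their [i]-th terms only. *)
Lemma coef_le (a : {poly R}) i : `|a`_i| * p (1 - 'X) <= p a + p a.
Proof.
pose k1 j := if (j <= i)%N then j else j.+1.
pose k2 j := if (j < i)%N then j else j.+1.
have k1H : {homo k1 : j l / (j < l)%N} by rewrite /k1 => j l; case: ifP; case: ifP; lia.
have k2H : {homo k2 : j l / (j < l)%N} by rewrite /k2 => j l; case: ifP; case: ifP; lia.
have E12 : lcomb (fun j => 'X^(k1 j)) a - lcomb (fun j => 'X^(k2 j)) a =
    a`_i *: ('X^i * (1 - 'X)) :> {poly R}.
  pose n := maxn (size a) i.+1.
  have an : (size a <= n)%N by exact: leq_maxl.
  have i_n : (i < n)%N by exact: leq_maxr.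
  rewrite !(lcomb_wide _ an) -sumrB (bigD1 (Ordinal i_n)) //= big1 ?addr0.
    by rewrite /k1 /k2 leqnn ltnn -scalerBr mulrBr mulr1 -exprSr.
  move=> j ji; rewrite /k1 /k2 leq_eqVlt.
  have -> : (j == i :> nat) = false by apply/negbTE; move: ji; rewrite -val_eqE.
  by rewrite subrr.
rewrite -(spread_shift pI i) -(seminormZ ps) -E12.
by apply: le_trans (seminormB ps _ _) _; rewrite !pI.
Qed.

(** Small vectors placed on successive blocks add up to an element of the closed
    span. This element has an expansion by hypothesis, and its coefficients are
    the expected ones because coordinates are continuous. *)
Lemma gliding_hump (Q : {poly R} -> Prop) :
  (forall j : nat, exists a, p a <= 2^-1 ^+ j /\ Q a) ->
  exists (al : nat -> R) (m : nat -> nat), [/\ m 0%N = 0%N, (forall j, (m j < m j.+1)%N),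
    cvgn (series (expansion al x)) &
    forall j, exists2 a, Q a & seg (m j) (m j.+1) al = 'X^(m j) * a].
Proof.
move=> /choice[a aP].
pose m := fix m j := if j is i.+1 then (m i + (size (a i)).+1)%N else 0%N.
have mS j : (m j < m j.+1)%N by rewrite /= addnS ltnS leq_addr.
have mge : forall j, (j <= m j)%N by exact: block_ge.
have mmono : forall i j, (i <= j)%N -> (m i <= m j)%N by exact: block_mono.
pose B J := \sum_(j < J) 'X^(m j) * a j.
pose al i := (B i.+1)`_i.
have Bstable i J d : (i < m J)%N -> (B (J + d)%N)`_i = (B J)`_i.
  move=> iJ; elim: d => [|d IH]; first by rewrite addn0.
  rewrite addnS /B big_ord_recr /= coefD -/(B _) IH coefXnM.
  by rewrite (leq_trans iJ) ?addr0 // mmono // leq_addr.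
have Bal i J : (i < m J)%N -> al i = (B J)`_i.
  move=> iJ; rewrite /al; case: (leqP i.+1 J) => h.
    by rewrite -(subnKC h) Bstable //; exact: leq_trans (mge _).
  by rewrite -(subnKC (ltnW h)) Bstable.
have Bsize J : (size (B J) <= m J)%N.
  elim: J => [|J IH]; first by rewrite /B big_ord0 size_poly0.
  rewrite /B big_ord_recr /=; apply: leq_trans (size_polyD _ _) _.
  rewrite geq_max (leq_trans IH) ?leq_addr //=.
  apply: leq_trans (size_polyMleq _ _) _; rewrite size_polyXn /=.
  by rewrite addnS; exact: leqnSn.
have segB J : seg 0 (m J) al = B J.
  rewrite -(seg_all (Bsize J)); apply: eq_seg => i /andP[_ iJ]; exact: Bal.
have segJ J : seg (m J) (m J.+1) al = 'X^(m J) * a J.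
  have h : (0 <= m J <= m J.+1)%N by rewrite leq0n ltnW.
  have := seg_split al h; rewrite !segB {1}/B big_ord_recr /= -/(B _).
  by move=> /addrI.
exists al, m; split=> //; last by move=> J; exists (a J); [case: (aP J)|exact: segJ].
pose u j := lcomb x ('X^(m j) * a j).
have uB j : `|u j| <= geometric c 2^-1 j.
  have [_ h] := px ('X^(m j) * a j); apply: le_trans h _.
  rewrite (spread_shift pI) /geometric /= ler_pM2l //; by case: (aP j).
have u_cvg : cvgn (series u).
  apply: normed_cvg; apply: (@series_le_cvg _ (fun j => `|u j|) (geometric c 2^-1)) => //.
    by move=> j; rewrite /geometric /= mulr_ge0 ?exprn_ge0 ?invr_ge0 // ltW.
  by apply: is_cvg_geometric_series; rewrite ger0_norm ?invr_ge0 // invf_lt1 // ltr1n.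
have serB J : series u J = lcomb x (B J).
  by rewrite /B linear_sum /series /= big_mkord.
pose y := limn (series u).
have y_span : closed_span x y.
  move=> W /(u_cvg W)[J _ hJ]; exists (series u J); split; last exact: hJ (leqnn J).
  by rewrite serB; exists (size (B J)), (nth 0 (B J)).
have [b [by_ _]] := x_basic.2 y y_span.
suff -> : al = b by apply/cvg_ex; exists y.
have d0 : 0 < p (1 - 'X).
  apply: p_gt0; apply/eqP => /(congr1 (fun q : {poly R} => q`_0)).
  by rewrite coefB coef1 coefX coef0 subr0 => /eqP; rewrite oner_eq0.
apply/funext => i; apply/eqP; rewrite -subr_eq0 -normr_le0; apply/ler_addgt0Pr => e e0.
rewrite add0r.
have e'0 : 0 < e * p (1 - 'X) / (c * 4) by rewrite divr_gt0 ?mulr_gt0.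
move/cvgrPdist_le : by_ => /(_ _ e'0)[n _ hn].
move/cvgrPdist_le : u_cvg => /(_ _ e'0)[J _ hJ].
pose N := maxn n i.+1; pose J' := maxn J i.+1.
have h1 := hn N (leq_maxl _ _); have h2 := hJ J' (leq_maxl _ _).
rewrite /= series_lcomb in h1; rewrite /= serB in h2.
rewrite -(ler_pM2r d0).
have iJ' : (i < m J')%N by apply: leq_trans (mge J'); exact: leq_maxr.
have -> : al i - b i = (B J' - seg 0 N b)`_i.
  rewrite coefB -(Bal _ _ iJ') coef_seg /= (_ : (i < N)%N = true) //; exact: leq_maxr.
apply: le_trans (coef_le _ _) _.
have h3 : p (B J' - seg 0 N b) <= c * (e * p (1 - 'X) / (c * 4) + e * p (1 - 'X) / (c * 4)).
  have [h _] := px (B J' - seg 0 N b); apply: le_trans h _; rewrite ler_pM2l // linearB.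
  have -> : lcomb x (B J') - lcomb x (seg 0 N b) =
      (y - lcomb x (seg 0 N b)) - (y - lcomb x (B J')).
    by rewrite opprB [RHS]addrC addrA subrK.
  by apply: le_trans (ler_normB _ _) _; exact: lerD.
apply: le_trans (lerD h3 h3) _; rewrite le_eqVlt; apply/orP; left; apply/eqP.
by field; rewrite gt_eqF.
Qed.

End Glide.

(** * The two cases *)

Section EllOne.
Context {R : realType}.
Implicit Types (a b z : {poly R}).

Definition l1norm a : R := \sum_(i < size a) `|a`_i|.

Lemma l1norm_wide n a : (size a <= n)%N -> l1norm a = \sum_(i < n) `|a`_i|.
Proof.
move=> an; rewrite /l1norm (big_ord_widen n (fun i => `|a`_i|) an) big_mkcond /=.
by apply: eq_bigr => i _; case: ltnP => // ai; rewrite nth_default ?normr0.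
Qed.

Lemma l1norm_le a b : (forall i, `|a`_i| <= `|b`_i|) -> l1norm a <= l1norm b.
Proof.
move=> ab; rewrite (@l1norm_wide (maxn (size a) (size b)) a) ?leq_maxl //.
rewrite (@l1norm_wide (maxn (size a) (size b)) b) ?leq_maxr //.
by apply: ler_sum => i _; exact: ab.
Qed.

Lemma l1norm_seminorm : seminorm l1norm.
Proof.
split=> [a b|c a].
  pose n := maxn (size (a + b)%R) (maxn (size a) (size b)).
  rewrite (@l1norm_wide n (a + b)) ?leq_maxl //.
  rewrite (@l1norm_wide n a) ?leq_max ?leqnn ?orbT //.
  rewrite (@l1norm_wide n b) ?leq_max ?leqnn ?orbT //.
  by rewrite -big_split; apply: ler_sum => i _; rewrite coefD ler_normD.
rewrite (@l1norm_wide (size a) (c *: a)) ?size_scale_leq // mulr_sumr.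
by apply: eq_bigr => i _; rewrite coefZ normrM.
Qed.

Lemma l1norm_spread : spread_invariant l1norm.
Proof.
move=> k a kH; set P := lcomb _ a.
have kinj : injective k.
  by move=> i j kij; apply/eqP; case: ltngtP => // /kH; rewrite kij ltnn.
have coefP j : `|P`_j| = \sum_(i < size a) (if k i == j then `|a`_i| else 0).
  rewrite coef_spread -big_mkcond /=.
  have [[i /eqP ij]|h] := pselect (exists i : 'I_(size a), k i == j).
    rewrite (big_pred1 i) => [|l]; last by rewrite /= -ij (inj_eq kinj).
    by rewrite (big_pred1 i) => [|l]; last by rewrite /= -ij (inj_eq kinj).
  have h0 (i : 'I_(size a)) : (k i == j) = false by apply/negbTE/negP => ij; apply: h; exists i.
  by rewrite !big_pred0 ?normr0.
have sP : (size P <= k (size a))%N.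
  apply/leq_sizeP => j kj; rewrite coef_spread big1 // => i /eqP ij.
  by move: kj; rewrite -ij leqNgt kH.
rewrite (l1norm_wide sP); under eq_bigr do rewrite coefP.
rewrite exchange_big /=.
apply: eq_bigr => i _; rewrite (bigD1 (Ordinal (kH _ _ (ltn_ord i)))) //= eqxx.
rewrite big1 ?addr0 // => j; rewrite -val_eqE /= eq_sym => /negbTE h.
by rewrite h.
Qed.

Lemma l1norm_drop l r a z :
  (forall i, (l <= i < r)%N -> a`_i = 0) -> (forall i, ~~ (l <= i < r)%N -> z`_i = 0) ->
  l1norm a <= l1norm (a + z).
Proof.
move=> a0 z0; apply: l1norm_le => i; rewrite coefD.
by have [/a0 ->|/z0 ->] := boolP (l <= i < r)%N; rewrite ?normr0 ?addr0.
Qed.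

Lemma l1norm_seg l r a : l1norm (seg l r (nth 0 a)) <= 1 * l1norm a.
Proof.
by rewrite mul1r; apply: l1norm_le => i; rewrite coef_seg; case: ifP; rewrite ?normr0.
Qed.

Lemma l1norm_segE l r (f : nat -> R) : l1norm (seg l r f) <= \sum_(l <= i < r) `|f i|.
Proof.
rewrite segE; apply: le_trans (seminorm_sum l1norm_seminorm _ _ _) _.
apply: ler_sum => i _; rewrite (seminormZ l1norm_seminorm) (spread_Xn l1norm_spread).
by rewrite /l1norm size_poly1 big_ord1 coef1 normr1 mulr1.
Qed.

Lemma l1norm1 : 0 < l1norm 1.
Proof. by rewrite /l1norm size_poly1 big_ord1 coef1 normr1. Qed.

Definition l1_datum : spreading_datum R :=
  @SpreadingDatum R l1norm false 1 0 l1norm_seminorm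
    (fun l r a z ha hz _ => l1norm_drop ha hz)
    (fun h => False_ind _ (notF h)) l1norm_seg l1norm_spread l1norm1.

End EllOne.

Lemma quarters_lt1 (R : realFieldType) (u v : R) :
  1 <= u *+ 2 - v -> `|v| <= 4^-1 -> `|u| <= 4^-1 -> False.
Proof. by rewrite mulr2n !ler_norml => h /andP[h1 h2] /andP[h3 h4]; lra. Qed.

Section Cases.
Context {R : realType} {E : completeNormedModType R} (x : nat -> E).
Hypothesis x_basic : schauder_basic x.
Variables (p : {poly R} -> R) (c : R).
Hypotheses (ps : seminorm p) (pI : spread_invariant p) (c0 : 0 < c).
Hypothesis px : forall a, p a <= c * `|lcomb x a| /\ `|lcomb x a| <= c * p a.
Implicit Types a z : {poly R}.

Let p1_gt0 : 0 < p 1.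
Proof. by apply: (p_gt0 x_basic ps px); exact: oner_neq0. Qed.

Section Null.
Hypothesis avg0 : forall e, 0 < e -> exists2 M, (0 < M)%N & p (ones_avg M) < e.

Let seg_le l r a : p (seg l r (nth 0 a)) <= 1 * p a.
Proof.
rewrite mul1r; case: (leqP l r) => lr; last first.
  by rewrite seg_eq0 ?(seminorm0 ps) ?(seminorm_ge0 ps) //; lia.
pose n := maxn r (size a).
have rn : (r <= n)%N by exact: leq_maxl.
have an : (size a <= n)%N by exact: leq_maxr.
apply: (@le_trans _ _ (p (seg 0 r (nth 0 a)))).
  rewrite (@seg_split _ 0 l r) ?lr // addrC.
  by apply: (drop_avg0 (l := 0) (r := l) ps pI avg0) => i;
    rewrite coef_seg; [case: ifP|case: ifP] => //; lia.
rewrite -[X in _ <= p X](seg_all an) (@seg_split _ 0 r n) ?rn //.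
by apply: (drop_avg0 (l := r) (r := n) ps pI avg0) => i;
  rewrite coef_seg; [case: ifP|case: ifP] => //; lia.
Qed.

Definition null_datum : spreading_datum R :=
  @SpreadingDatum R p false 1 0 ps
    (fun l r a z ha hz _ => drop_avg0 ps pI avg0 ha hz)
    (fun h => False_ind _ (notF h)) seg_le pI p1_gt0.

Lemma null_unconditional : unconditional x.
Proof.
apply: (@suppression_unconditional _ _ _ (c * c)) => G l r f.
have [_ h1] := px (seg l r (restr G f)); have [h2 _] := px (seg l r f).
apply: le_trans h1 _; rewrite -mulrA ler_pM2l //; apply: le_trans h2.
exact: (@p_restr R null_datum isT).
Qed.

End Null.

Section NonNull.
Variable d : R.
Hypotheses (d0 : 0 < d) (avg_ge : forall M, (0 < M)%N -> d <= p (ones_avg M)).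

Lemma horner1_le a : `|a.[1]| <= d^-1 * p a.
Proof. by rewrite ler_pdivlMl //; exact: norm_horner1_le. Qed.

(** The sum of the coefficients is a bounded functional. *)
Lemma sums_cvg (al : nat -> R) (s : nat -> nat) : cvgn (series (expansion al x \o s)) ->
  forall e, 0 < e -> exists N, forall l r, (N <= l <= r)%N -> `|\sum_(l <= i < r) al (s i)| <= e.
Proof.
move=> /cauchy_cvgP/cauchyP h e e0.
have K0 : 0 < d^-1 * (c * 2) by rewrite !mulr_gt0 // invr_gt0.
have [y [N _ hN]] := h _ (divr_gt0 e0 K0); exists N => l r /andP[Nl lr].
pose b : {poly R} := \sum_(l <= i < r) al (s i) *: 'X^(s i).
have -> : \sum_(l <= i < r) al (s i) = b.[1].
  by rewrite horner_sum; apply: eq_bigr => i _; rewrite !hornerE expr1n mulr1.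
apply: le_trans (horner1_le _) _.
have [h1 _] := px b; apply: le_trans (ler_wpM2l _ h1) _.
  by rewrite invr_ge0 ltW.
have -> : lcomb x b =
    (y - series (expansion al x \o s) l) - (y - series (expansion al x \o s) r).
  rewrite opprB [RHS]addrC addrA subrK sub_series_geq // linear_sum.
  by apply: eq_bigr => i _; rewrite linearZ /= lcombXn.
have := hN l Nl; have := hN r (leq_trans Nl lr); rewrite -!ball_normE /= => hr hl.
rewrite mulrA -ler_pdivlMl; last by rewrite mulr_gt0 // invr_gt0.
apply: le_trans (ler_normB _ _) _; apply: le_trans (ltW (ltrD hl hr)) _.
by rewrite le_eqVlt; apply/orP; left; apply/eqP; field; rewrite !gt_eqF.
Qed.

(** Otherwise a gliding hump produces a convergent expansion whose sums of
    coefficients oscillate. *)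
Lemma partial_sums_bounded : exists C, forall a n, `|(seg 0 n (nth 0 a)).[1]| <= C * p a.
Proof.
apply: contrapT => hN.
have [j|al [m [m0 mS al_cvg alm]]] := @gliding_hump R E x x_basic p c ps pI c0 px
    (fun a => exists n, 1 <= `|(seg 0 n (nth 0 a)).[1]|).
  apply: contrapT => hj; apply: hN; exists (2 ^+ j) => a n.
  rewrite leNgt; apply/negP => lt; apply: hj.
  have s0 : 0 < `|(seg 0 n (nth 0 a)).[1]|.
    by apply: le_lt_trans lt; rewrite mulr_ge0 ?exprn_ge0 ?(seminorm_ge0 ps).
  exists (`|(seg 0 n (nth 0 a)).[1]|^-1 *: a); split.
    rewrite (seminormZ ps) normfV normr_id ler_pdivrMl // exprVn mulrC ler_pdivlMl ?exprn_gt0 //.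
    exact: ltW.
  exists n; rewrite segZ hornerZ normrM normfV normr_id mulVf ?gt_eqF //.
have half0 : 0 < 2^-1 :> R by rewrite invr_gt0.
have [N hN'] := @sums_cvg al id al_cvg _ half0.
have [a [n an] aE] := alm N.
have mN : (N <= m N)%N by exact: block_ge.
(* the index [n] may lie beyond the end of the block *)
pose r := minn n (m N.+1 - m N).
have := hN' (m N) (m N + r)%N; rewrite mN leq_addr => /(_ isT).
rewrite -horner1_seg leNgt => /negP; apply.
apply: (@lt_le_trans _ _ 1); first by rewrite invf_lt1 // ltr1n.
suff -> : seg (m N) (m N + r) al = 'X^(m N) * seg 0 n (nth 0 a).
  by rewrite hornerM hornerXn expr1n mul1r.
apply/polyP => i; rewrite coefXnM !coef_seg.
have aEi : (seg (m N) (m N.+1) al)`_i = ('X^(m N) * a)`_i by rewrite aE.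
rewrite coefXnM coef_seg in aEi.
case: (ltnP i (m N)) aEi => iN aEi /=; first by [].
rewrite /= in aEi; have := mS N; rewrite /r => mSN.
case: (ltnP i (m N.+1)) aEi => iN1 aEi.
  have -> : (i < m N + minn n (m N.+1 - m N))%N = (i - m N < n)%N by lia.
  by case: ifP => //; rewrite aEi.
have -> : (i < m N + minn n (m N.+1 - m N))%N = false by lia.
by case: ifP => // _; rewrite -aEi.
Qed.

(** Replacing the tail of a vector by a long average with the same sum does not
    increase the norm, and such an average is controlled by its sum. *)
Lemma initial_segments_bounded : exists K, 0 <= K /\ forall a n, p (seg 0 n (nth 0 a)) <= K * p a.
Proof.
have [C hC] := partial_sums_bounded.
have C0 : 0 <= C.
  by rewrite -(pmulr_lge0 _ p1_gt0); apply: le_trans (hC 1 0%N).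
have di0 : 0 <= d^-1 by rewrite invr_ge0 ltW.
exists (1 + (d^-1 + C) * p 1); split.
  by rewrite addr_ge0 // mulr_ge0 // ?addr_ge0 // ltW.
move=> a n; set b := seg 0 n (nth 0 a).
pose N := maxn n (size a).
have nN : (n <= N)%N by exact: leq_maxl.
have aN : (size a <= N)%N by exact: leq_maxr.
set z := seg n N (nth 0 a).
have abz : a = b + z by rewrite -{1}(seg_all aN) (@seg_split _ 0 n N) ?nN.
have : root (z - z.[1]%:P) 1 by rewrite /root !hornerE subrr.
move=> /factor_theorem[w zE].
have z1 : `|z.[1]| <= (d^-1 + C) * p a.
  have -> : z.[1] = a.[1] - b.[1] by rewrite abz hornerD addrC addKr.
  apply: le_trans (ler_normB _ _) _; rewrite mulrDl.
  by apply: lerD; [exact: horner1_le|exact: hC].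
apply: (@le_of_inv_nat _ _ _ (p w + p w)) => M M0.
have bd : p b <= p (b + z) + p (ones_avg M * z).
  apply: (drop_avg (l := n) (r := N) ps pI) => // i; rewrite coef_seg.
    by case: ifP => //; lia.
  by case: ifP => //; lia.
have oM : p (ones_avg M) <= p 1.
  have := p_ones_avgM ps pI 1 M.
  rewrite /ones_avg (seminormZ ps) normfV normr_nat ler_pdivrMl ?ltr0n // => _.
  apply: le_trans (seminorm_sum ps _ _ _) _.
  under eq_bigr do rewrite (spread_Xn pI).
  by rewrite sumr_const card_ord mulr_natl.
have zM : p (ones_avg M * z) <= (d^-1 + C) * p a * p 1 + (p w + p w) / M%:R.
  have -> : ones_avg M * z = z.[1] *: ones_avg M + ones_avg M * (w * ('X - 1%:P)).
    by rewrite -zE mulrBr (mulrC _ (z.[1]%:P)) mul_polyC addrC subrK.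
  apply: le_trans (seminormD ps _ _) _; apply: lerD; last exact: ones_avg_sum0.
  by rewrite (seminormZ ps); apply: ler_pM => //; exact: (seminorm_ge0 ps).
apply: le_trans bd _; rewrite -abz; apply: le_trans (lerD (lexx _) zM) _.
by rewrite addrA lerD2r [leRHS]mulrDl mul1r [in leRHS]mulrAC.
Qed.

Lemma summing_datum_exists : exists D : spreading_datum R, (D : {poly R} -> R) = p /\ summing D.
Proof.
have [K [K0 hK]] := initial_segments_bounded.
have hseg l r a : p (seg l r (nth 0 a)) <= (K + K) * p a.
  have pa := seminorm_ge0 ps a.
  case: (leqP l r) => lr; last first.
    rewrite seg_eq0 ?(seminorm0 ps); last by move=> i; lia.
    by rewrite mulr_ge0 // addr_ge0.
  have -> : seg l r (nth 0 a) = seg 0 r (nth 0 a) - seg 0 l (nth 0 a).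
    by rewrite (@seg_split _ 0 l r) ?lr // addrC addKr.
  by apply: le_trans (seminormB ps _ _) _; rewrite mulrDl; apply: lerD; exact: hK.
exists (@SpreadingDatum R p true (K + K) d^-1 ps
  (fun l r a z ha hz h => drop_sum0 ps pI ha hz (h isT))
  (fun _ a => horner1_le a) hseg pI p1_gt0).
by [].
Qed.

(** Otherwise a gliding hump produces a convergent expansion with non-summable
    coefficients; listing the nonnegative coefficients of each block first makes
    the sums oscillate. *)
Lemma unconditional_l1 : unconditional x -> exists C, forall a, l1norm a <= C * p a.
Proof.
move=> xu; apply: contrapT => hN.
have [j|al [m [m0 mS al_cvg alm]]] := @gliding_hump R E x x_basic p c ps pI c0 px
    (fun a => 1 <= l1norm a).
  apply: contrapT => hj; apply: hN; exists (2 ^+ j) => a.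
  rewrite leNgt; apply/negP => lt; apply: hj.
  have s0 : 0 < l1norm a.
    by apply: le_lt_trans lt; rewrite mulr_ge0 ?exprn_ge0 ?(seminorm_ge0 ps).
  exists ((l1norm a)^-1 *: a); split.
    rewrite (seminormZ ps) normfV (ger0_norm (ltW s0)) ler_pdivrMl // exprVn mulrC.
    by rewrite ler_pdivlMl ?exprn_gt0 // ltW.
  by rewrite (seminormZ l1norm_seminorm) normfV (ger0_norm (ltW s0)) mulVf ?gt_eqF.
pose P i := 0 <= al i.
have [s [sb sP]] := block_rearrangement m0 mS P.
have q0 : 0 < 4^-1 :> R by rewrite invr_gt0.
have [N1 h1] := @sums_cvg al id al_cvg _ q0.
have [N2 h2] := @sums_cvg al s (xu al al_cvg s sb) _ q0.
pose j := maxn N1 N2; have jm : (j <= m j)%N by exact: block_ge.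
have [a a1 aE] := alm j.
have a1' : 1 <= \sum_(m j <= i < m j.+1) `|al i|.
  apply: le_trans a1 _; rewrite -(spread_shift l1norm_spread (m j)) -aE; exact: l1norm_segE.
have n1 : `|\sum_(m j <= i < m j.+1) al i| <= 4^-1.
  by apply: h1; rewrite (ltnW (mS j)) andbT (leq_trans _ jm) // leq_maxl.
have n2 : `|\sum_(m j <= i < m j.+1 | P i) al i| <= 4^-1.
  rewrite -big_filter -(sP j) big_map; apply: h2.
  by rewrite leq_addr andbT (leq_trans _ jm) // leq_maxr.
(* |t| is twice the positive part of t, minus t *)
have absE : \sum_(m j <= i < m j.+1) `|al i| =
    \sum_(m j <= i < m j.+1 | P i) al i *+ 2 - \sum_(m j <= i < m j.+1) al i.
  rewrite [X in _ = X - _]big_mkcond -sumrB; apply: eq_bigr => i _; rewrite /P.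
  by case: leP => h; rewrite ?(ger0_norm h) ?(ltr0_norm h) ?mul0rn ?sub0r // mulr2n addrK.
rewrite absE sumrMnl in a1'; exact: quarters_lt1 a1' n1 n2.
Qed.

Lemma l1_equiv : unconditional x -> exists C, 0 < C /\
  forall a, l1_datum a <= C * `|lcomb x a| /\ `|lcomb x a| <= C * l1_datum a.
Proof.
move=> xu; have [C hC] := unconditional_l1 xu.
have pa0 a : 0 <= p a by exact: (seminorm_ge0 ps).
have D0 : 0 < 1 + (`|C| * c + c * p 1).
  by rewrite ltr_pwDl // addr_ge0 // mulr_ge0 // ltW.
exists (1 + (`|C| * c + c * p 1)); split=> // a; have [h1 h2] := px a.
have l0 : 0 <= l1norm a by exact: (seminorm_ge0 l1norm_seminorm).
have C0 : 0 <= `|C| by [].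
have cp0 : 0 <= c * p 1 by rewrite mulr_ge0 // ltW.
have Cc0 : 0 <= `|C| * c by rewrite mulr_ge0 // ltW.
split.
  have h3 : l1norm a <= `|C| * (c * `|lcomb x a|).
    apply: le_trans (hC a) _; apply: le_trans (ler_wpM2r (pa0 a) (ler_norm C)) _.
    by apply: ler_wpM2l.
  apply: le_trans h3 _; rewrite mulrA; apply: ler_wpM2r => //; lra.
have h3 : p a <= p 1 * l1norm a.
  rewrite {1}(poly_sumXn (leqnn (size a))); apply: le_trans (seminorm_sum ps _ _ _) _.
  rewrite mulr_sumr; apply: ler_sum => i _.
  by rewrite (seminormZ ps) (spread_Xn pI) mulrC.
apply: le_trans h2 _; apply: (@le_trans _ _ (c * p 1 * l1norm a)).
  by rewrite -mulrA ler_pM2l.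
by apply: ler_wpM2r => //; lra.
Qed.

End NonNull.

(** If the means of the basis vectors tend to zero, any vector can be dropped
    from a gap without increasing [p]; otherwise the sequence is equivalent to
    the basis of l_1, and [p] is replaced by the norm of l_1. *)
Lemma reflexive_case : unconditional x ->
  exists (X : completeNormedModType R) (e : nat -> X),
    reflexive_space X /\ schauder_basis e /\ unconditional e /\
    generates_spreading_model_equivalent_to e x.
Proof.
move=> xu.
have [D [C [Ds C0 DC]]] : exists (D : spreading_datum R) (C : R), [/\ ~~ summing D, 0 < C &
    forall a, D a <= C * `|lcomb x a| /\ `|lcomb x a| <= C * D a].
  have [avg0|navg0] := pselect (forall e, 0 < e -> exists2 M, (0 < M)%N & p (ones_avg M) < e).
    by exists (null_datum avg0), c.
  have [d [d0 hd]] : exists d, 0 < d /\ forall M, (0 < M)%N -> d <= p (ones_avg M).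
    apply: contrapT => h; apply: navg0 => e e0; apply: contrapT => h'; apply: h.
    exists e; split=> // M M0; rewrite leNgt; apply/negP => lt; apply: h'.
    by exists M.
  by have [C [C0 hC]] := l1_equiv d0 hd xu; exists l1_datum, C.
exists (space D), (ebasis D); split; first exact: reflexive_nonsumming.
split; first exact: schauder_ebasis.
split; first exact: unconditional_ebasis.
exact: ebasis_spreading_model_equivalent C0 DC.
Qed.

(** The means of the basis vectors stay away from zero, for otherwise the
    sequence would be unconditional. *)
Lemma quasi_reflexive_case : conditional x ->
  exists (X : completeNormedModType R) (e : nat -> X),
    quasi_reflexive_order_one X /\ schauder_basis e /\
    generates_spreading_model_equivalent_to e x.
Proof.
move=> xc.
have [d [d0 hd]] : exists d, 0 < d /\ forall M, (0 < M)%N -> d <= p (ones_avg M).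
  apply: contrapT => h; apply: xc; apply: null_unconditional => e e0.
  apply: contrapT => h'; apply: h; exists e; split=> // M M0.
  by rewrite leNgt; apply/negP => lt; apply: h'; exists M.
have [D [Dp Ds]] := summing_datum_exists d0 hd.
exists (space D), (ebasis D); split; first exact: quasi_reflexive_summing.
split; first exact: schauder_ebasis.
by apply: (ebasis_spreading_model_equivalent c0) => a; rewrite Dp.
Qed.

End Cases.

Theorem theorem9 (R : realType) (E : completeNormedModType R) (x : nat -> E)
    (x_basic : schauder_basic x) (x_spreading : spreading x) :
  (unconditional x ->
     exists (X : completeNormedModType R) (e : nat -> X),
       reflexive_space X /\ schauder_basis e /\ unconditional e /\
       generates_spreading_model_equivalent_to e x) /\
  (conditional x ->
     exists (X : completeNormedModType R) (e : nat -> X),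
       quasi_reflexive_order_one X /\ schauder_basis e /\
       generates_spreading_model_equivalent_to e x).
Proof.
have [p [c [ps pI c0 px]]] := spread_renorming x_spreading.
split=> [xu|xc].
  exact: (reflexive_case x_basic ps pI c0 px xu).
exact: (quasi_reflexive_case x_basic ps pI c0 px xc).
Qed.
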